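(* Let $x^*\in J^*$. Then $x^*$ is an extreme point of the closed unit ball $B_{J^*}$ of $J^*$ if and only if there exist a family of intervals $\{I_i\}_{i\in F}$ of $\mathbb N$ and nonzero real numbers $(\alpha_i)_{i\in F}$ such that $x^*(x)=\sum_{i\in F}\alpha_i I_i^*(x)$ for all $x\in J$, and (1) $\sum_{i\in F}\alpha_i e_i$ is an extreme point of $B_J$, and (2) $\bigcup_{i\in F}I_i$ is an interval of $\mathbb N$.
   Context: For a real sequence $x=(x(n))_{n\in\mathbb N}$ let $\|x\|_J=\sup\bigl(\sum_{i=1}^n|\sum_{k\in I_i}x(k)|^2\bigr)^{1/2}$, the supremum taken over all $n\in\mathbb N$ and all families $I_1,\dots,I_n$ of pairwise disjoint intervals of $\mathbb N$ (an interval of $\mathbb N$ is a nonempty set of consecutive positive integers, possibly infinite). The James space is $J=\{x:\|x\|_J<\infty\}$ with this norm; $(e_n)$ is the unit vector basis, $B_J$ the closed unit ball. For $x\in J$ and any interval $I$ the series $\sum_{k\in I}x(k)$ converges, and $I^*\in J^*$ denotes the norm-one functional $I^*(x)=\sum_{n\in I}x(n)$. A family of intervals $\{I_i\}_{i\in F}$ means: $F=\{1,\dots,k\}$ for some $k\in\mathbb N$ or $F=\mathbb N$, each $I_i$ is an interval of $\mathbb N$, and $\max I_i<\min I_{i+1}$ whenever $i+1\in F$. *)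

(* Defs.v *)
From Stdlib Require Import Reals Lra List.
From Coquelicot Require Import Coquelicot.
Open Scope R_scope.

(* Sequences are indexed by nat, 0-based (position n stands for n+1 in N). *)
Definition seqR := nat -> R.

Inductive interval : Type :=
  | IFin (a b : nat)
  | IInf (a : nat).

Definition is_interval (I : interval) : Prop :=
  match I with IFin a b => (a <= b)%nat | IInf _ => True end.

Definition in_interval (I : interval) (n : nat) : Prop :=
  match I with
  | IFin a b => (a <= n /\ n <= b)%nat
  | IInf a => (a <= n)%nat
  end.

Definition imin (I : interval) : nat :=
  match I with IFin a _ => a | IInf a => a end.

Definition Isum (x : seqR) (I : interval) : R :=
  match I with
  | IFin a b => sum_n_m x a b
  | IInf a => Series (fun k => x (a + k)%nat)
  end.

Definition idisjoint (I1 I2 : interval) : Prop :=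
  forall n, ~ (in_interval I1 n /\ in_interval I2 n).

Definition disjoint_family (Is : list interval) : Prop :=
  List.Forall is_interval Is /\ List.ForallOrdPairs idisjoint Is.

Definition sumsq (x : seqR) (Is : list interval) : R :=
  fold_right (fun I acc => (Isum x I) ^ 2 + acc) 0 Is.

Definition Jvals (x : seqR) (r : R) : Prop :=
  exists Is, disjoint_family Is /\ r = sqrt (sumsq x Is).

Definition Jnorm (x : seqR) : Rbar := Lub_Rbar (Jvals x).

Definition inJ (x : seqR) : Prop :=
  (forall a, ex_series (fun k => x (a + k)%nat)) /\ Rbar_lt (Jnorm x) p_infty.

Definition BJ (x : seqR) : Prop := inJ x /\ Rbar_le (Jnorm x) 1.

Definition extreme_BJ (x : seqR) : Prop :=
  BJ x /\
  forall (y z : seqR) (t : R), BJ y -> BJ z -> 0 < t < 1 ->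
    (forall n, x n = t * y n + (1 - t) * z n) ->
    forall n, y n = z n.

(* J^*: bounded linear functionals on J (values outside J are irrelevant) *)
Definition in_Jdual (f : seqR -> R) : Prop :=
  (forall (x y : seqR) (a b : R), inJ x -> inJ y ->
     f (fun n => a * x n + b * y n) = a * f x + b * f y) /\
  exists M, forall x, inJ x -> Rabs (f x) <= M * real (Jnorm x).

Definition BJdual (f : seqR -> R) : Prop :=
  in_Jdual f /\ forall x, BJ x -> Rabs (f x) <= 1.

Definition eqJ (f g : seqR -> R) : Prop := forall x, inJ x -> f x = g x.

Definition extreme_BJdual (f : seqR -> R) : Prop :=
  BJdual f /\
  forall (g h : seqR -> R) (t : R), BJdual g -> BJdual h -> 0 < t < 1 ->
    eqJ f (fun x => t * g x + (1 - t) * h x) ->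
    eqJ g h.

Definition inF (F : option nat) (i : nat) : Prop :=
  match F with Some k => (i < k)%nat | None => True end.

Definition valid_F (F : option nat) : Prop :=
  match F with Some k => (1 <= k)%nat | None => True end.

Definition interval_family (F : option nat) (I : nat -> interval) : Prop :=
  valid_F F /\
  (forall i, inF F i -> is_interval (I i)) /\
  (forall i, inF F (S i) ->
     match I i with
     | IFin _ b => (b < imin (I (S i)))%nat
     | IInf _ => False
     end).

Definition coef_seq (F : option nat) (alpha : nat -> R) : seqR :=
  fun i => match F with
           | Some k => if Nat.ltb i k then alpha i else 0
           | None => alpha i
           end.

Definition represents (f : seqR -> R) (F : option nat) (I : nat -> interval)
  (alpha : nat -> R) : Prop :=
  forall x, inJ x ->
    match F with
    | Some k => f x = sum_n_m (fun i => alpha i * Isum x (I i)) 0 (k - 1)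
    | None => is_series (fun i => alpha i * Isum x (I i)) (f x)
    end.

Definition union_is_interval (F : option nat) (I : nat -> interval) : Prop :=
  exists J0, is_interval J0 /\
    forall n, in_interval J0 n <-> exists i, inF F i /\ in_interval (I i) n.

(* Main.v *)
(* Extreme points of B_J.  If x is extreme, moving a small mass from t to t - 1 must break the norm
   constraint, so for each t there are almost norming families with no interval across t; an
   exchange argument upgrades this to: singletons are norming, i.e. sum x(k)^2 = 1.  Conversely
   strict convexity of l^2 makes every such x extreme.

   From representation to extremality.  Place alpha along points p_i of I_i to get x in B_J with
   f(x) = 1, so that f = t g + (1 - t) h forces g(x) = h(x) = 1.  Along suitable directions d the
   singletons stay norming to first order, whence g(d), h(d) <= <alpha, d>, with equality since
   f(d) = <alpha, d>; these directions are triangular in the basis, so g(e_n) = h(e_n) for all n.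

   From extremality to representation.  Norming families exhibit f as dominated by the supremum of
   the step functionals sum beta_i I_i^* with sum beta_i^2 <= 1.  A finitely additive version of
   Milman's theorem restricts this supremum to step functionals that jump wherever (f(e_n)) does.
   Hence the values of (f(e_n)) on its runs of constancy have sum of squares at most 1, and f is
   extreme among all such sequences.  Explicit convex combinations then show that consecutive runs
   satisfy (sum alpha_i)^2 <= sum alpha_i^2 and that no zero run lies between nonzero ones. *)

Require Import Defs.
From Stdlib Require Import Reals.
From Coquelicot Require Import Coquelicot.
From Stdlib Require Import Arith Lra Lia List Permutation ClassicalEpsilon FunctionalExtensionality.
From mathcomp Require classical.classical_sets.
Open Scope R_scope.
Set Bullet Behavior "Strict Subproofs".

(** * Partial sums and families of finite segments *)

(** The supremum in the James norm need not be attained, so families are compared up to an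
    arbitrarily small loss [delta]; infinite intervals are limits of finite segments, whose sums are
    increments of partial sums. To differentiate the norm at a point where singletons are norming,
    all other segments must be controlled at once, and infinitely many of them may be as good as
    their singletons or nearly so. In the other implication, step functionals give [f] only as a
    limit of averages, in which the jumps of the coefficient sequence could be smeared out. A
    finitely additive mean plays the part of a representing measure: by extremality, one cell of any
    partition in two suffices to dominate [f]. Finitely many partitions are enough, because the sum
    of squares is tested on the first [N] coordinates only. *)

Fixpoint psum (x : seqR) (n : nat) : R :=
  match n with O => 0 | S m => psum x m + x m end.

(* A segment [(a, b)] stands for the half-open interval [a <= n < b]. *)
Definition inc (x : seqR) (p : nat * nat) : R := psum x (snd p) - psum x (fst p).

Definition segdisj (p q : nat * nat) : Prop :=
  (snd p <= fst q \/ snd q <= fst p)%nat.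

Definition segfam (L : list (nat * nat)) : Prop :=
  List.Forall (fun p => (fst p < snd p)%nat) L /\ List.ForallOrdPairs segdisj L.

Definition sqinc (x : seqR) (L : list (nat * nat)) : R :=
  fold_right (fun p acc => (inc x p) ^ 2 + acc) 0 L.

(** The bound [||x||_J <= c], squared and tested on finite segments; [normle_sumsq] recovers the
    infinite intervals by a limit. The sign of [c] is recorded because squaring loses it. *)
Definition normle (x : seqR) (c : R) : Prop :=
  0 <= c /\ forall L, segfam L -> sqinc x L <= c ^ 2.

Lemma segfam_nil : segfam nil.
Proof. split; constructor. Qed.

Lemma segfam_cons p L :
  segfam (p :: L) <->
  (fst p < snd p)%nat /\ (forall q, In q L -> segdisj p q) /\ segfam L.
Proof.
  unfold segfam; split.
  - intros [H1 H2]; inversion H1 as [|? ? Ha Hb]; subst; inversion H2 as [|? ? Hc Hd]; subst.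
    rewrite Forall_forall in Hc; auto.
  - intros [H1 [H2 [H3 H4]]]; split; constructor; auto.
    now rewrite Forall_forall.
Qed.

Lemma segdisj_sym p q : segdisj p q -> segdisj q p.
Proof. unfold segdisj; tauto. Qed.

Lemma segfam_lt L p : segfam L -> In p L -> (fst p < snd p)%nat.
Proof. intros [H _] Hp; rewrite Forall_forall in H; auto. Qed.

Lemma segfam_perm L L' : Permutation L L' -> segfam L -> segfam L'.
Proof.
  induction 1; auto.
  - rewrite !segfam_cons; intros [A [B C]]; split; [auto|split; [|auto]].
    intros q Hq; apply B, (Permutation_in q (Permutation_sym H)), Hq.
  - intros HL; apply segfam_cons in HL; destruct HL as [A [B H]].
    apply segfam_cons in H; destruct H as [C [E F]].
    apply segfam_cons; split; [auto|split].
    + intros q [<-|Hq]; auto; apply segdisj_sym, B; now left.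
    + apply segfam_cons; split; [auto|split; auto]; intros q Hq; apply B; now right.
Qed.

Lemma sqinc_cons x p L : sqinc x (p :: L) = inc x p ^ 2 + sqinc x L.
Proof. reflexivity. Qed.

Lemma sqinc_perm x L L' : Permutation L L' -> sqinc x L = sqinc x L'.
Proof. induction 1; simpl; lra. Qed.

Lemma sqinc_app x L L' : sqinc x (L ++ L') = sqinc x L + sqinc x L'.
Proof. induction L; simpl; [|rewrite IHL]; lra. Qed.

Lemma sqinc_ge0 x L : 0 <= sqinc x L.
Proof. induction L as [|p L IH]; simpl; [lra|]. pose proof (pow2_ge_0 (inc x p)). simpl in *; lra. Qed.

Lemma segfam_app L L' :
  segfam L -> segfam L' -> (forall p q, In p L -> In q L' -> segdisj p q) ->
  segfam (L ++ L').
Proof.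
  induction L as [|p L IH]; simpl; auto.
  rewrite !segfam_cons; intros [A [B C]] H' H; split; [auto|split].
  - intros q Hq; apply in_app_or in Hq; destruct Hq; auto.
  - apply IH; auto.
Qed.

Lemma segfam_app_inv L L' : segfam (L ++ L') -> segfam L /\ segfam L'.
Proof.
  induction L as [|p L IH]; simpl; [split; auto using segfam_nil|].
  rewrite !segfam_cons; intros [A [B C]]; destruct (IH C); split; [|auto].
  split; [auto|split; [|auto]]; intros q Hq; apply B, in_or_app; auto.
Qed.

Lemma in_permutation_cons (A : Type) (p : A) L : In p L -> exists L', Permutation L (p :: L').
Proof.
  intros H; apply in_split in H; destruct H as [l1 [l2 ->]].
  exists (l1 ++ l2); symmetry; apply Permutation_middle.
Qed.

(** Moving endpoints by a monotone map may collapse segments; these have increment zero and are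
    dropped. If the partial sums of [y] are those of [x] reparametrised by [phi], up to a constant,
    norm bounds pass from [x] to [y]. This serves for tails ([phi] a maximum), for inserting zeros
    ([count]) and for the shift ([pred]). *)
Definition remap (phi : nat -> nat) (L : list (nat * nat)) : list (nat * nat) :=
  filter (fun p => Nat.ltb (fst p) (snd p))
    (map (fun p => (phi (fst p), phi (snd p))) L).

Lemma in_remap phi L p : In p (remap phi L) ->
  (fst p < snd p)%nat /\ exists q, In q L /\ p = (phi (fst q), phi (snd q)).
Proof.
  unfold remap; rewrite filter_In, in_map_iff.
  intros [[q [<- Hq]] H]; split; [now apply Nat.ltb_lt|eauto].
Qed.

Lemma segfam_remap phi L :
  (forall a b, (a <= b)%nat -> (phi a <= phi b)%nat) -> segfam L -> segfam (remap phi L).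
Proof.
  intros Hphi; induction L as [|p L IH]; [intros; apply segfam_nil|].
  rewrite segfam_cons; intros [A [B C]]; unfold remap; simpl.
  destruct (Nat.ltb_spec (phi (fst p)) (phi (snd p))); [|apply IH; auto].
  apply segfam_cons; split; [auto|split; [|apply IH; auto]].
  intros q Hq; apply in_remap in Hq; destruct Hq as [_ [q' [Hq' ->]]]; simpl.
  destruct (B _ Hq') as [E|E]; [left|right]; simpl; auto.
Qed.

Lemma sqinc_remap phi x y K L :
  (forall a b, (a <= b)%nat -> (phi a <= phi b)%nat) ->
  (forall n, psum y n = psum x (phi n) + K) -> segfam L ->
  sqinc y L = sqinc x (remap phi L).
Proof.
  intros Hphi HK; induction L as [|p L IH]; [reflexivity|].
  rewrite segfam_cons; intros [A [B C]]; unfold remap; simpl.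
  assert (Hi : inc y p = inc x (phi (fst p), phi (snd p)))
    by (unfold inc; simpl; rewrite !HK; lra).
  assert (Hm := Hphi (fst p) (snd p) (Nat.lt_le_incl _ _ A)).
  destruct (Nat.ltb_spec (phi (fst p)) (phi (snd p))); simpl; rewrite IH, Hi; auto.
  assert (E : phi (fst p) = phi (snd p)) by lia.
  unfold inc; simpl; rewrite E; unfold remap; lra.
Qed.

Lemma psum_S x n : psum x (S n) = psum x n + x n.
Proof. reflexivity. Qed.

Lemma psum_ext x y n : (forall k, (k < n)%nat -> x k = y k) -> psum x n = psum y n.
Proof. induction n; simpl; intros H; [auto|]; rewrite IHn, H; auto. Qed.

Lemma psum_lin x y a b n : psum (fun k => a * x k + b * y k) n = a * psum x n + b * psum y n.
Proof. induction n; simpl; [|rewrite IHn]; lra. Qed.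

Lemma psum_0 x n : (forall k, (k < n)%nat -> x k = 0) -> psum x n = 0.
Proof. induction n; simpl; intros H; [auto|]; rewrite IHn, H; auto; lra. Qed.

Lemma psum_const x m n : (m <= n)%nat -> (forall k, (m <= k < n)%nat -> x k = 0) ->
  psum x n = psum x m.
Proof.
  induction 1; intros Hk; [auto|]; simpl; rewrite IHle, Hk; try lra; try lia.
  intros; apply Hk; lia.
Qed.

Lemma psum_diff_ext x y a b : (a <= b)%nat -> (forall k, (a <= k < b)%nat -> x k = y k) ->
  psum x b - psum x a = psum y b - psum y a.
Proof.
  induction 1; intros Hk; [lra|]; simpl.
  rewrite <- (Hk m) by lia; assert (psum x m - psum x a = psum y m - psum y a); [|lra].
  apply IHle; intros; apply Hk; lia.
Qed.

Lemma psum_le x y n : (forall k, (k < n)%nat -> x k <= y k) -> psum x n <= psum y n.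
Proof.
  induction n; simpl; intros H; [lra|].
  apply Rplus_le_compat; [apply IHn; auto|auto].
Qed.

Lemma psum_mono x m n : (forall k, 0 <= x k) -> (m <= n)%nat -> psum x m <= psum x n.
Proof. intros Hx; induction 1; simpl; [|specialize (Hx m0)]; lra. Qed.

Lemma normle_inc x c a b : normle x c -> (a <= b)%nat -> Rabs (psum x b - psum x a) <= c.
Proof.
  intros [Hc H] Hab.
  destruct (Nat.eq_dec a b) as [->|Hne]; [rewrite Rminus_diag, Rabs_R0; auto|].
  assert (segfam ((a, b) :: nil)).
  { apply segfam_cons; simpl; split; [lia|split; [tauto|apply segfam_nil]]. }
  specialize (H _ H0); simpl in H; unfold inc in H; simpl in H.
  rewrite <- (Rabs_right c) by lra.
  apply Rsqr_le_abs_0; unfold Rsqr; lra.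
Qed.

Lemma normle_le x c c' : normle x c -> c <= c' -> normle x c'.
Proof.
  intros [Hc H] Hcc; split; [lra|]; intros L HL; specialize (H L HL); simpl in *; nra.
Qed.

Lemma normle_scal x c a : normle x c -> normle (fun n => a * x n) (Rabs a * c).
Proof.
  intros [Hc H]; split; [pose proof (Rabs_pos a); nra|]; intros L HL.
  assert (E : sqinc (fun n => a * x n) L = a ^ 2 * sqinc x L).
  { clear HL; induction L as [|p L IH]; simpl; [lra|]; rewrite IH.
    assert (Hi : inc (fun n => a * x n) p = a * inc x p).
    { unfold inc; rewrite !(psum_ext (fun n => a * x n) (fun n => a * x n + 0 * x n)) by (intros; lra).
      rewrite !psum_lin; lra. }
    rewrite Hi; ring. }
  rewrite E; rewrite Rpow_mult_distr, pow2_abs.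
  apply Rmult_le_compat_l; [apply pow2_ge_0|auto].
Qed.

(* Crude (no triangle inequality is needed): [(u + v)^2 <= 2 u^2 + 2 v^2]. *)
Lemma normle_lin x y a b c c' : normle x c -> normle y c' ->
  exists d, normle (fun n => a * x n + b * y n) d.
Proof.
  intros [Hc H] [Hc' H'].
  exists (sqrt (2 * a ^ 2 * c ^ 2 + 2 * b ^ 2 * c' ^ 2)); split; [apply sqrt_pos|].
  intros L HL; rewrite pow2_sqrt.
  2:{ pose proof (pow2_ge_0 a); pose proof (pow2_ge_0 b); pose proof (pow2_ge_0 c);
      pose proof (pow2_ge_0 c'); nra. }
  apply Rle_trans with (2 * a ^ 2 * sqinc x L + 2 * b ^ 2 * sqinc y L).
  - clear; induction L as [|p L IH]; [simpl; lra|].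
    rewrite !sqinc_cons.
    assert (Hi : inc (fun n => a * x n + b * y n) p = a * inc x p + b * inc y p)
      by (unfold inc; rewrite !psum_lin; lra).
    rewrite Hi.
    assert (0 <= (a * inc x p - b * inc y p) ^ 2) by apply pow2_ge_0.
    nra.
  - specialize (H L HL); specialize (H' L HL).
    pose proof (pow2_ge_0 a); pose proof (pow2_ge_0 b); nra.
Qed.

Definition tailseq (x : seqR) (N : nat) : seqR := fun n => if Nat.ltb n N then 0 else x n.
Definition headseq (x : seqR) (N : nat) : seqR := fun n => if Nat.ltb n N then x n else 0.

Lemma psum_tail x N n : psum (tailseq x N) n = psum x (Nat.max n N) - psum x N.
Proof.
  induction n.
  - replace (Nat.max 0 N) with N by lia; simpl; lra.
  - rewrite psum_S, IHn; unfold tailseq; destruct (Nat.ltb_spec n N).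
    + replace (Nat.max n N) with N by lia; replace (Nat.max (S n) N) with N by lia; lra.
    + replace (Nat.max n N) with n by lia; replace (Nat.max (S n) N) with (S n) by lia; rewrite psum_S; lra.
Qed.

Lemma normle_remap phi x y K c :
  (forall a b, (a <= b)%nat -> (phi a <= phi b)%nat) ->
  (forall n, psum y n = psum x (phi n) + K) -> normle x c -> normle y c.
Proof.
  intros Hphi HK [Hc H]; split; [auto|]; intros L HL.
  rewrite (sqinc_remap phi x y K); auto using segfam_remap.
Qed.

Lemma segfam_bounded (L : list (nat * nat)) : exists N, forall p, In p L -> (snd p <= N)%nat.
Proof.
  induction L as [|q L [N IH]]; [exists O; simpl; tauto|].
  exists (Nat.max N (snd q)); intros p [<-|Hp]; [lia|specialize (IH _ Hp); lia].
Qed.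

(** Fix a family whose value is within [eps ^ 2] of the supremum [V]. A family beyond its last
    endpoint can be adjoined to it, hence contributes at most [eps ^ 2]. *)
Lemma tail_small x c eps : normle x c -> 0 < eps ->
  exists N, forall n, (N <= n)%nat -> normle (tailseq x n) eps.
Proof.
  intros [Hc H] He.
  pose (E := fun r => exists L, segfam L /\ r = sqinc x L).
  destruct (completeness E) as [V [HV1 HV2]].
  - exists (c ^ 2); intros r [L [HL ->]]; auto.
  - exists 0, nil; split; [apply segfam_nil|reflexivity].
  - assert (HL : exists L, segfam L /\ V - eps ^ 2 < sqinc x L).
    { apply NNPP; intros Hn; assert (V <= V - eps ^ 2).
      - apply HV2; intros r [L [HL ->]]; apply Rnot_lt_le; intros Hlt; apply Hn; eauto.
      - assert (0 < eps ^ 2) by (apply pow_lt; auto); lra. }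
    destruct HL as [L [HL HLV]], (segfam_bounded L) as [N HN].
    exists N; intros n Hn; split; [lra|]; intros L' HL'.
    rewrite (sqinc_remap (fun m => Nat.max m n) x _ (- psum x n)); auto;
      [|intros; lia|intros m; rewrite psum_tail; lra].
    assert (HF : segfam (L ++ remap (fun m => Nat.max m n) L')).
    { apply segfam_app; auto; [apply segfam_remap; auto; intros; lia|].
      intros p q Hp Hq; apply in_remap in Hq; destruct Hq as [_ [q' [_ ->]]].
      left; simpl; specialize (HN _ Hp); lia. }
    assert (sqinc x (L ++ remap (fun m => Nat.max m n) L') <= V) by (apply HV1; red; eauto).
    rewrite sqinc_app in H0; lra.
Qed.

(** * The James norm and its dual through finite segments *)

Lemma sum_n_psum x n : sum_n x n = psum x (S n).
Proof.
  induction n; [rewrite sum_O; simpl; lra|].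
  rewrite sum_Sn, IHn; reflexivity.
Qed.

Lemma sum_n_m_psum x a b : (a <= b)%nat -> sum_n_m x a b = psum x (S b) - psum x a.
Proof.
  induction 1 as [|m H IH].
  - rewrite sum_n_n; simpl; lra.
  - rewrite sum_n_Sm by lia; rewrite IH; unfold plus; simpl; lra.
Qed.

Lemma psum_shift x a n : psum (fun k => x (a + k)%nat) n = psum x (a + n) - psum x a.
Proof.
  induction n; [rewrite Nat.add_0_r; simpl; lra|].
  rewrite psum_S, IHn; replace (a + S n)%nat with (S (a + n)) by lia; rewrite psum_S; lra.
Qed.

Lemma is_series_psum x l : is_series x l <-> is_lim_seq (psum x) l.
Proof.
  unfold is_series; split; intros H.
  - apply is_lim_seq_incr_1, is_lim_seq_ext with (sum_n x); [intros; apply sum_n_psum|exact H].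
  - apply is_lim_seq_incr_1 in H.
    apply (is_lim_seq_ext _ (sum_n x)) in H; [exact H|intros; now rewrite sum_n_psum].
Qed.

Lemma normle_cv x c : normle x c -> ex_finite_lim_seq (psum x).
Proof.
  intros H; apply ex_lim_seq_cauchy_corr; intros eps.
  destruct (tail_small x c (eps / 2) H) as [N HN]; [destruct eps; simpl; lra|].
  assert (K : forall n m, (N <= n)%nat -> (n <= m)%nat -> Rabs (psum x m - psum x n) < eps).
  { intros n m Hn Hm.
    pose proof (normle_inc _ _ n m (HN N (le_n N)) Hm) as HB.
    rewrite !psum_tail, !Nat.max_l in HB by lia.
    replace (psum x m - psum x N - (psum x n - psum x N)) with (psum x m - psum x n) in HB by lra.
    destruct eps; simpl in *; lra. }
  exists N; intros n m Hn Hm.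
  destruct (Nat.le_ge_cases n m); [rewrite Rabs_minus_sym|]; auto.
Qed.

Lemma psum_cv_shift x (l : R) a : is_lim_seq (psum x) l ->
  is_series (fun k => x (a + k)%nat) (l - psum x a).
Proof.
  intros H; apply is_series_psum.
  apply is_lim_seq_ext with (fun n => psum x (n + a) - psum x a).
  - intros n; rewrite psum_shift, Nat.add_comm; reflexivity.
  - apply is_lim_seq_minus'; [|apply is_lim_seq_const].
    now apply (is_lim_seq_incr_n (psum x) a).
Qed.

(** The cut of an infinite interval keeps at least the point [a], so the segment is nonempty for
    every [n]. *)
Definition trunc (n : nat) (I : interval) : nat * nat :=
  match I with IFin a b => (a, S b) | IInf a => (a, Nat.max n (S a)) end.

Lemma trunc_lt n I : is_interval I -> (fst (trunc n I) < snd (trunc n I))%nat.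
Proof. destruct I; simpl; lia. Qed.

Lemma trunc_disj n I J : is_interval I -> is_interval J -> idisjoint I J ->
  segdisj (trunc n I) (trunc n J).
Proof.
  intros HI HJ H; unfold segdisj.
  (* If the truncations overlapped, the larger left endpoint would be a common point of the
     intervals. *)
  specialize (H (Nat.max (fst (trunc n I)) (fst (trunc n J)))).
  destruct I, J; simpl in *; lia.
Qed.

Lemma Isum_trunc_lim x I : (forall a, ex_series (fun k => x (a + k)%nat)) -> is_interval I ->
  is_lim_seq (fun n => inc x (trunc n I)) (Isum x I).
Proof.
  intros Hx HI; destruct I as [a b|a]; simpl.
  - apply is_lim_seq_ext with (fun _ => sum_n_m x a b); [|apply is_lim_seq_const].
    intros n; unfold inc; simpl; now rewrite sum_n_m_psum.
  - assert (HS := Series_correct _ (Hx a)); apply is_series_psum in HS.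
    apply (is_lim_seq_incr_n _ (S a)).
    apply is_lim_seq_ext with (fun n => psum (fun k => x (a + k)%nat) (n + 1)).
    + intros n; unfold inc; simpl; rewrite psum_shift.
      replace (Nat.max (n + S a) (S a)) with (a + (n + 1))%nat by lia; reflexivity.
    + now apply (is_lim_seq_incr_n (psum (fun k => x (a + k)%nat)) 1).
Qed.

Lemma sumsq_trunc_lim x Is : (forall a, ex_series (fun k => x (a + k)%nat)) ->
  List.Forall is_interval Is ->
  is_lim_seq (fun n => sqinc x (map (trunc n) Is)) (sumsq x Is).
Proof.
  intros Hx; induction 1 as [|I Is HI HIs IH]; [apply is_lim_seq_const|].
  simpl. apply is_lim_seq_plus'; [|exact IH].
  assert (H := Isum_trunc_lim x I Hx HI).
  apply is_lim_seq_mult'; [exact H|].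
  apply is_lim_seq_mult'; [exact H|apply is_lim_seq_const].
Qed.

Lemma segfam_trunc n Is : disjoint_family Is -> segfam (map (trunc n) Is).
Proof.
  intros [H1 H2]; induction H2 as [|I Is HI HIs IH]; [apply segfam_nil|].
  inversion H1 as [|? ? H3 H4]; subst.
  apply segfam_cons; split; [now apply trunc_lt|split; [|auto]].
  intros q Hq; apply in_map_iff in Hq; destruct Hq as [J [<- HJ]].
  rewrite Forall_forall in HI; rewrite Forall_forall in H4.
  apply trunc_disj; auto.
Qed.

Lemma normle_sumsq x c Is : normle x c -> disjoint_family Is -> sumsq x Is <= c ^ 2.
Proof.
  intros H HIs.
  destruct (normle_cv _ _ H) as [l Hl].
  assert (Hs : forall a, ex_series (fun k => x (a + k)%nat))
    by (intros a; eexists; apply psum_cv_shift, Hl).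
  change (Rbar_le (sumsq x Is) (c ^ 2)).
  apply (is_lim_seq_le (fun n => sqinc x (map (trunc n) Is)) (fun _ => c ^ 2)).
  - intros n; apply H, segfam_trunc, HIs.
  - apply sumsq_trunc_lim; [exact Hs|apply HIs].
  - apply is_lim_seq_const.
Qed.

Lemma normle_inJ x c : normle x c -> inJ x /\ Rbar_le (Jnorm x) c.
Proof.
  intros H.
  assert (HL : Rbar_le (Jnorm x) c).
  { apply (Lub_Rbar_correct (Jvals x)); intros r [Is [HIs ->]]; simpl.
    destruct H as [Hc H]; rewrite <- (sqrt_pow2 c Hc).
    apply sqrt_le_1_alt, normle_sumsq; [split|]; auto. }
  split; [split|exact HL].
  - destruct (normle_cv _ _ H) as [l Hl].
    intros a; eexists; apply psum_cv_shift, Hl.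
  - destruct (Jnorm x); simpl in *; auto.
Qed.

Lemma inJ_fin x : inJ x -> Jnorm x = real (Jnorm x) /\ 0 <= real (Jnorm x).
Proof.
  intros [_ H].
  assert (H0 : Rbar_le 0 (Jnorm x)).
  { apply (Lub_Rbar_correct (Jvals x)); exists nil; split; [split; constructor|].
    simpl; now rewrite sqrt_0. }
  destruct (Jnorm x); simpl in *; tauto.
Qed.

Lemma inJ_normle x : inJ x -> normle x (real (Jnorm x)).
Proof.
  intros H; destruct (inJ_fin x H) as [HF H0]; split; [auto|]; intros L HL.
  pose (g := fun p : nat * nat => IFin (fst p) (pred (snd p))).
  assert (HD : disjoint_family (map g L)).
  { destruct HL as [H1 H2]; split.
    - rewrite Forall_forall in *; intros I HI; apply in_map_iff in HI.
      destruct HI as [p [<- Hp]]; specialize (H1 _ Hp); simpl; lia.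
    - induction H2 as [|p L Hp HL IH]; simpl; constructor;
        inversion H1 as [|? ? Hp1 HL1]; subst; auto.
      rewrite Forall_forall in *; intros I HI; apply in_map_iff in HI.
      destruct HI as [q [<- Hq]]; specialize (Hp _ Hq); specialize (HL1 _ Hq).
      intros n; unfold segdisj in Hp; simpl; lia. }
  assert (HS : sumsq x (map g L) = sqinc x L).
  { clear HD; destruct HL as [H1 _]; induction H1 as [|p L Hp HL IH]; [reflexivity|].
    change (Isum x (g p) ^ 2 + sumsq x (map g L) = sqinc x (p :: L)).
    rewrite IH, sqinc_cons; unfold inc, g; simpl Isum.
    rewrite sum_n_m_psum by lia; now replace (S (pred (snd p))) with (snd p) by lia. }
  assert (HJ : Rbar_le (sqrt (sqinc x L)) (Jnorm x)).
  { apply (Lub_Rbar_correct (Jvals x)); exists (map g L); rewrite HS; auto. }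
  rewrite HF in HJ; simpl in HJ.
  rewrite <- (pow2_sqrt (sqinc x L)) by apply sqinc_ge0.
  apply pow_incr; split; [apply sqrt_pos|exact HJ].
Qed.

Lemma BJ_normle x : BJ x <-> normle x 1.
Proof.
  split.
  - intros [H1 H2]; apply normle_le with (1 := inJ_normle x H1).
    destruct (inJ_fin x H1) as [E _]; rewrite E in H2; exact H2.
  - apply normle_inJ.
Qed.

Lemma normle_Jnorm_le x c : normle x c -> real (Jnorm x) <= c.
Proof.
  intros H; destruct (normle_inJ x c H) as [H1 H2]; destruct (inJ_fin x H1) as [E _].
  rewrite E in H2; exact H2.
Qed.

(** * Unit vectors and bounded functionals on J *)

Definition basis (n : nat) : seqR := fun k => if Nat.eqb k n then 1 else 0.

Lemma psum_basis n k : psum (basis n) k = if Nat.ltb n k then 1 else 0.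
Proof.
  induction k; [reflexivity|]; rewrite psum_S, IHk; unfold basis.
  destruct (Nat.eqb_spec k n), (Nat.ltb_spec n k), (Nat.ltb_spec n (S k)); try lia; lra.
Qed.

Lemma inJ_lin x y a b : inJ x -> inJ y -> inJ (fun n => a * x n + b * y n).
Proof.
  intros H1 H2; destruct (normle_lin x y a b _ _ (inJ_normle x H1) (inJ_normle y H2)) as [d Hd].
  apply (normle_inJ _ d Hd).
Qed.

Lemma normle_zero c : 0 <= c -> normle (fun _ => 0) c.
Proof.
  intros Hc; split; [auto|]; intros L _.
  replace (sqinc (fun _ => 0) L) with 0; [apply pow2_ge_0|].
  induction L as [|p L IH]; [reflexivity|]; rewrite sqinc_cons, <- IH.
  unfold inc; rewrite !psum_0 by auto; lra.
Qed.

Lemma normle_basis n : normle (basis n) 1.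
Proof.
  split; [lra|]; intros L HL.
  (* At most one segment of [L] contains [n]. *)
  enough (H : sqinc (basis n) L <= 1 /\
    ((forall p, In p L -> inc (basis n) p = 0) -> sqinc (basis n) L = 0)) by lra.
  revert HL; induction L as [|p L IH]; [simpl; intros; lra|].
  rewrite segfam_cons; intros [A [B C]]; destruct (IH C) as [H1 H2]; clear IH.
  rewrite sqinc_cons; split.
  - destruct (Req_dec (inc (basis n) p) 0) as [E|E]; [rewrite E; lra|].
    rewrite H2.
    + unfold inc; rewrite !psum_basis.
      destruct (Nat.ltb_spec n (snd p)), (Nat.ltb_spec n (fst p)); lra.
    + intros q Hq; specialize (B _ Hq); assert (Hlt := segfam_lt _ _ C Hq).
      revert E; unfold segdisj in B; unfold inc; rewrite !psum_basis.
      destruct (Nat.ltb_spec n (snd p)), (Nat.ltb_spec n (fst p)),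
        (Nat.ltb_spec n (snd q)), (Nat.ltb_spec n (fst q)); try lia; lra.
  - intros H; rewrite H2, (H p); [lra|now left|]; intros q Hq; apply H; now right.
Qed.

Lemma inJ_basis n : inJ (basis n).
Proof. apply (normle_inJ _ 1), normle_basis. Qed.

Definition lin_on_J (f : seqR -> R) : Prop :=
  forall (x y : seqR) (a b : R), inJ x -> inJ y ->
    f (fun n => a * x n + b * y n) = a * f x + b * f y.

Lemma lin_zero f : lin_on_J f -> f (fun _ => 0) = 0.
Proof.
  intros H; assert (HJ : inJ (fun _ => 0)) by (apply (normle_inJ _ 0), normle_zero; lra).
  specialize (H _ _ 0 0 HJ HJ).
  cbv beta in H; replace (fun _ : nat => 0 * 0 + 0 * 0) with (fun _ : nat => 0) in H; [lra|].
  apply functional_extensionality; intros; lra.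
Qed.

Lemma inJ_head x N : inJ (headseq x N).
Proof.
  induction N.
  - apply (normle_inJ _ 0).
    replace (headseq x 0) with (fun _ : nat => 0); [apply normle_zero; lra|].
    now apply functional_extensionality; intros k.
  - replace (headseq x (S N)) with (fun k => 1 * headseq x N k + x N * basis N k).
    + apply inJ_lin; [auto|apply inJ_basis].
    + apply functional_extensionality; intros k; unfold headseq, basis.
      destruct (Nat.ltb_spec k N), (Nat.ltb_spec k (S N)), (Nat.eqb_spec k N); try lia; subst; lra.
Qed.

Lemma lin_head f x N : lin_on_J f -> f (headseq x N) = psum (fun n => f (basis n) * x n) N.
Proof.
  intros Hf; induction N.
  - replace (headseq x 0) with (fun _ : nat => 0); [now apply lin_zero|].
    now apply functional_extensionality; intros k.
  - replace (headseq x (S N)) with (fun k => 1 * headseq x N k + x N * basis N k).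
    + rewrite Hf by auto using inJ_head, inJ_basis; rewrite IHN, psum_S; lra.
    + apply functional_extensionality; intros k; unfold headseq, basis.
      destruct (Nat.ltb_spec k N), (Nat.ltb_spec k (S N)), (Nat.eqb_spec k N); try lia; subst; lra.
Qed.

Lemma lin_head_eq f x N : lin_on_J f -> (forall n, (N <= n)%nat -> x n = 0) ->
  f x = psum (fun n => f (basis n) * x n) N.
Proof.
  intros Hf Hx; rewrite <- (lin_head f x N Hf); f_equal.
  apply functional_extensionality; intros n; unfold headseq.
  destruct (Nat.ltb_spec n N); auto.
Qed.

Lemma Jdual_bound f : in_Jdual f -> exists M, 0 <= M /\ forall x c, normle x c -> Rabs (f x) <= M * c.
Proof.
  intros [_ [M HM]]; exists (Rabs M); split; [apply Rabs_pos|]; intros x c H.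
  destruct (normle_inJ x c H) as [HJ _]; destruct (inJ_fin x HJ) as [_ H0].
  specialize (HM x HJ); assert (Hc := normle_Jnorm_le x c H).
  pose proof (Rle_abs M); pose proof (Rabs_pos M); nra.
Qed.

(** The unit vectors form a Schauder basis: [f] of a tail is at most [M] times the norm of the tail,
    which [tail_small] makes small. *)
Lemma Jdual_lim f x : in_Jdual f -> inJ x ->
  is_lim_seq (psum (fun n => f (basis n) * x n)) (f x).
Proof.
  intros Hf Hx; destruct (Jdual_bound f Hf) as [M [HM0 HM]].
  apply is_lim_seq_spec; intros eps; simpl.
  assert (He : 0 < eps / (M + 1)) by (apply Rdiv_lt_0_compat; [apply cond_pos|lra]).
  destruct (tail_small x _ (eps / (M + 1)) (inJ_normle x Hx) He) as [N HN].
  exists N; intros n Hn; specialize (HN n Hn).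
  rewrite <- (lin_head f x n (proj1 Hf)).
  assert (E : f x = f (headseq x n) + f (tailseq x n)).
  { replace x with (fun k => 1 * headseq x n k + 1 * tailseq x n k) at 1.
    - destruct Hf as [Hl _]; rewrite (Hl (headseq x n) (tailseq x n) 1 1);
        [lra|apply inJ_head|apply (normle_inJ _ _ HN)].
    - apply functional_extensionality; intros k; unfold headseq, tailseq.
      destruct (Nat.ltb k n); lra. }
  rewrite E; replace (f (headseq x n) - (f (headseq x n) + f (tailseq x n))) with (- f (tailseq x n)) by lra.
  rewrite Rabs_Ropp; apply Rle_lt_trans with (1 := HM _ _ HN).
  replace (pos eps) with ((M + 1) * (eps / (M + 1))) at 2 by (field; lra).
  apply Rmult_lt_compat_r; lra.
Qed.

Lemma BJdual_normle f x c : BJdual f -> normle x c -> Rabs (f x) <= c.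
Proof.
  intros [[Hl _] Hf] Hx.
  assert (K : forall d, 0 < d -> normle x d -> Rabs (f x) <= d).
  { intros d Hd H.
    assert (HB : BJ (fun n => / d * x n)).
    { apply BJ_normle; replace 1 with (Rabs (/ d) * d); [now apply normle_scal|].
      rewrite Rabs_right; [field; lra|]; left; now apply Rinv_0_lt_compat. }
    destruct (normle_inJ x d H) as [HJ _].
    specialize (Hf _ HB).
    replace (fun n => / d * x n) with (fun n => / d * x n + 0 * x n) in Hf
      by (apply functional_extensionality; intros; lra).
    rewrite (Hl x x (/ d) 0 HJ HJ) in Hf.
    replace (/ d * f x + 0 * f x) with (/ d * f x) in Hf by lra.
    assert (Hd' := Rinv_0_lt_compat _ Hd).
    rewrite Rabs_mult, (Rabs_right (/ d)) in Hf by lra.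
    apply Rmult_le_reg_l with (/ d); [auto|]; rewrite Rinv_l by lra; lra. }
  (* For [c = 0] no rescaling is possible, but then every positive bound is available, and
     [Rabs (f x) / 2] gives the contradiction. *)
  destruct (Rle_lt_or_eq_dec 0 c (proj1 Hx)) as [Hc|<-]; [auto|].
  apply Rnot_lt_le; intros Hlt.
  assert (Rabs (f x) <= Rabs (f x) / 2); [|lra].
  apply K; [lra|]; apply normle_le with (1 := Hx); lra.
Qed.

Lemma BJdual_intro f : lin_on_J f -> (forall x c, normle x c -> Rabs (f x) <= c) -> BJdual f.
Proof.
  intros Hl H; split; [split; [exact Hl|exists 1; intros x Hx; rewrite Rmult_1_l]|].
  - apply H, inJ_normle, Hx.
  - intros x Hx; apply H, BJ_normle, Hx.
Qed.

Lemma eqJ_basis f g : in_Jdual f -> in_Jdual g -> (forall n, f (basis n) = g (basis n)) -> eqJ f g.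
Proof.
  intros Hf Hg H x Hx.
  assert (H1 := Jdual_lim f x Hf Hx); assert (H2 := Jdual_lim g x Hg Hx).
  apply is_lim_seq_unique in H1; apply is_lim_seq_unique in H2.
  assert (E : Lim_seq (psum (fun n => f (basis n) * x n)) = Lim_seq (psum (fun n => g (basis n) * x n))).
  { apply Lim_seq_ext; intros n; apply psum_ext; intros; now rewrite H. }
  rewrite H1, H2 in E; now injection E.
Qed.

(** * Extreme points of the unit ball of J *)

Definition sqs (x : seqR) : seqR := fun k => x k ^ 2.

Lemma psum_sqs_S x n : psum (sqs x) (S n) = psum (sqs x) n + x n ^ 2.
Proof. reflexivity. Qed.

Definition singles (a n : nat) : list (nat * nat) := map (fun k => (k, S k)) (seq a n).

Lemma in_singles a n p : In p (singles a n) ->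
  (a <= fst p < a + n)%nat /\ snd p = S (fst p).
Proof.
  unfold singles; rewrite in_map_iff; intros [k [<- Hk]].
  apply in_seq in Hk; simpl; lia.
Qed.

Lemma segfam_singles a n : segfam (singles a n).
Proof.
  revert a; induction n; intros a; [apply segfam_nil|].
  change (segfam ((a, S a) :: singles (S a) n)); apply segfam_cons; split; [simpl; lia|split; auto].
  intros q Hq; apply in_singles in Hq; left; simpl; lia.
Qed.

Lemma sqinc_singles x a n : sqinc x (singles a n) = psum (sqs x) (a + n) - psum (sqs x) a.
Proof.
  revert a; induction n; intros a; [rewrite Nat.add_0_r; simpl; lra|].
  change (sqinc x ((a, S a) :: singles (S a) n) = psum (sqs x) (a + S n) - psum (sqs x) a).
  rewrite sqinc_cons, IHn; unfold inc; simpl fst; simpl snd.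
  replace (S a + n)%nat with (a + S n)%nat by lia.
  rewrite psum_sqs_S, psum_S; ring.
Qed.

Lemma sqinc_singles0 x n : sqinc x (singles 0 n) = psum (sqs x) n.
Proof. rewrite sqinc_singles; simpl; lra. Qed.

Lemma segfam_split m L L' : segfam L -> segfam L' ->
  (forall p, In p L -> (snd p <= m)%nat) -> (forall q, In q L' -> (m <= fst q)%nat) ->
  segfam (L ++ L').
Proof.
  intros H H' Hl Hr; apply segfam_app; auto.
  intros p q Hp Hq; left; specialize (Hl p Hp); specialize (Hr q Hq); lia.
Qed.

Lemma segfam_singles_app m L : segfam L -> (forall q, In q L -> (m <= fst q)%nat) ->
  segfam (singles 0 m ++ L).
Proof.
  intros HL Hq; apply (segfam_split m); auto using segfam_singles.
  intros p Hp; apply in_singles in Hp; lia.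
Qed.

Lemma sqs_psum_le1 x n : normle x 1 -> psum (sqs x) n <= 1.
Proof.
  intros [_ H]; specialize (H _ (segfam_singles 0 n)); rewrite sqinc_singles0 in H; lra.
Qed.

Lemma sqs_ge0 x k : 0 <= sqs x k.
Proof. apply pow2_ge_0. Qed.

(** Young's inequality with a free weight. In [extreme_break], [th = delta] turns a value of at most
    [1 - delta] into at most [(1 + delta) (1 - delta)] plus the quadratic term, which leaves room
    [delta ^ 2] for the latter. *)
Lemma sqinc_perturb x y c th L : 0 < th ->
  sqinc (fun n => x n + c * y n) L <= (1 + th) * sqinc x L + (1 + / th) * c ^ 2 * sqinc y L.
Proof.
  intros Hth; induction L as [|p L IH]; [simpl; lra|]; rewrite !sqinc_cons.
  assert (Hi : inc (fun n => x n + c * y n) p = inc x p + c * inc y p).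
  { unfold inc; rewrite !(psum_ext (fun n => x n + c * y n) (fun n => 1 * x n + c * y n))
      by (intros; lra).
    rewrite !psum_lin; lra. }
  rewrite Hi.
  assert (0 <= / th * (th * inc x p - c * inc y p) ^ 2).
  { apply Rmult_le_pos; [left; now apply Rinv_0_lt_compat|apply pow2_ge_0]. }
  replace (/ th * (th * inc x p - c * inc y p) ^ 2) with
    (th * inc x p ^ 2 - 2 * inc x p * (c * inc y p) + / th * (c * inc y p) ^ 2) in H by (field; lra).
  nra.
Qed.

(* Shifting a small mass from position [t] to [t - 1] only affects the segments that end or
   start at [t]; an extreme point therefore has almost norming families broken at [t]. *)
Lemma extreme_break x t delta : extreme_BJ x -> 0 < delta ->
  exists L, segfam L /\ (forall p, In p L -> snd p <= S t \/ S t <= fst p)%nat /\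
    1 - delta < sqinc x L.
Proof.
  intros [Hx Hext] Hd; apply NNPP; intros Hn.
  assert (HL : forall L, segfam L ->
    (forall p, In p L -> snd p <= S t \/ S t <= fst p)%nat -> sqinc x L <= 1 - delta).
  { intros L H1 H2; apply Rnot_lt_le; intros H3; apply Hn; eauto. }
  pose (d := fun n => 1 * basis t n + (-1) * basis (S t) n).
  destruct (normle_lin (basis t) (basis (S t)) 1 (-1) 1 1) as [m Hm];
    try apply normle_basis; fold d in Hm.
  (* Chosen so that the quadratic term of [sqinc_perturb] is at most [delta ^ 2]; [m ^ 2 + 1] keeps
     the denominator positive. *)
  pose (eps := sqrt (delta ^ 2 / ((1 + / delta) * (m ^ 2 + 1)))).
  assert (Hden : 0 < (1 + / delta) * (m ^ 2 + 1)).
  { apply Rmult_lt_0_compat; [pose proof (Rinv_0_lt_compat _ Hd)|pose proof (pow2_ge_0 m)]; lra. }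
  assert (He2 : 0 < delta ^ 2 / ((1 + / delta) * (m ^ 2 + 1))).
  { apply Rdiv_lt_0_compat; auto; apply pow_lt; auto. }
  assert (Heps : 0 < eps) by (apply sqrt_lt_R0; auto).
  assert (He : (1 + / delta) * eps ^ 2 * m ^ 2 <= delta ^ 2).
  { unfold eps; rewrite pow2_sqrt by lra.
    apply Rle_trans with ((1 + / delta) * (delta ^ 2 / ((1 + / delta) * (m ^ 2 + 1))) * (m ^ 2 + 1)).
    - apply Rmult_le_compat_l; [|lra].
      apply Rmult_le_pos; [pose proof (Rinv_0_lt_compat _ Hd)|]; lra.
    - right; field; repeat split; try lra; pose proof (pow2_ge_0 m); nra. }
  assert (HB : forall c, c ^ 2 = eps ^ 2 -> BJ (fun n => x n + c * d n)).
  { intros c Hc; apply BJ_normle; split; [lra|]; intros L HF.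
    apply BJ_normle in Hx.
    (* If some segment crosses the break, it contains both [t] and [S t] and every other segment
       contains neither, so the family does not see the perturbation. *)
    destruct (excluded_middle_informative
      (exists p, In p L /\ (fst p < S t < snd p)%nat)) as [[p [Hp Hpt]]|Hno].
    - replace (sqinc (fun n => x n + c * d n) L) with (sqinc x L); [apply Hx; auto|].
      assert (H0 : forall q, In q L -> inc d q = 0).
      { intros q Hq; unfold inc, d; rewrite !psum_lin, !psum_basis.
        destruct (in_permutation_cons _ _ _ Hp) as [L' HP].
        assert (HF' := segfam_perm _ _ HP HF); apply segfam_cons in HF'.
        destruct HF' as [_ [HD _]].
        assert (Hqq : q = p \/ segdisj p q).
        { apply (Permutation_in q HP) in Hq; destruct Hq as [->|Hq]; auto. }
        assert (Hlt := segfam_lt _ _ HF Hq); unfold segdisj in Hqq.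
        destruct Hqq as [->|Hqq];
        destruct (Nat.ltb_spec t (snd p)), (Nat.ltb_spec (S t) (snd p)),
          (Nat.ltb_spec t (fst p)), (Nat.ltb_spec (S t) (fst p)); try lia; try lra;
        destruct (Nat.ltb_spec t (snd q)), (Nat.ltb_spec (S t) (snd q)),
          (Nat.ltb_spec t (fst q)), (Nat.ltb_spec (S t) (fst q)); try lia; try lra. }
      clear - H0; induction L as [|q L IH]; [reflexivity|].
      rewrite !sqinc_cons, <- IH by (intros; apply H0; now right).
      specialize (H0 q (or_introl eq_refl)); unfold inc in *.
      rewrite !(psum_ext (fun n => x n + c * d n) (fun n => 1 * x n + c * d n)) by (intros; lra).
      rewrite !psum_lin; f_equal; f_equal.
      replace (1 * psum x (snd q) + c * psum d (snd q) - (1 * psum x (fst q) + c * psum d (fst q)))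
        with (psum x (snd q) - psum x (fst q) + c * (psum d (snd q) - psum d (fst q))) by lra.
      rewrite H0; lra.
    - assert (H1 : sqinc x L <= 1 - delta).
      { apply HL; auto; intros p Hp.
        destruct (Nat.le_gt_cases (snd p) (S t)); auto.
        destruct (Nat.le_gt_cases (S t) (fst p)); auto.
        exfalso; apply Hno; exists p; split; auto. }
      apply Rle_trans with (1 := sqinc_perturb x d c delta L Hd).
      assert (H2 := proj2 Hm L HF); rewrite Hc.
      assert ((1 + / delta) * eps ^ 2 * sqinc d L <= (1 + / delta) * eps ^ 2 * m ^ 2).
      { apply Rmult_le_compat_l; auto.
        apply Rmult_le_pos; [pose proof (Rinv_0_lt_compat _ Hd)|pose proof (pow2_ge_0 eps)]; lra. }
      nra. }
  specialize (Hext _ _ (1 / 2) (HB eps eq_refl) (HB (- eps) ltac:(ring)) ltac:(lra)).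
  specialize (Hext ltac:(intros; lra) t); unfold d, basis in Hext.
  rewrite Nat.eqb_refl in Hext; destruct (Nat.eqb_spec t (S t)); [lia|lra].
Qed.

(** [L] and [Q] lie on different sides of [b] and can be joined, with total at most 1. As the
    singletons together with [Q] almost reach 1, [L] cannot beat them. *)
Lemma sqinc_left_bound x b L : normle x 1 ->
  (forall delta, 0 < delta -> exists Q, segfam Q /\ (forall q, In q Q -> (b <= fst q)%nat) /\
     1 - delta < psum (sqs x) b + sqinc x Q) ->
  segfam L -> (forall p, In p L -> (snd p <= b)%nat) -> sqinc x L <= psum (sqs x) b.
Proof.
  intros [_ Hx] HA HL Hb; apply Rnot_lt_le; intros Hlt.
  destruct (HA (sqinc x L - psum (sqs x) b) ltac:(lra)) as [Q [HQ [HQb H]]].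
  specialize (Hx _ (segfam_split b L Q HL HQ Hb HQb)); rewrite sqinc_app in Hx; lra.
Qed.

(* If [D(s,b+1)^2] were larger than the sum of the squares over [s..b], compare an almost norming
   family whose segment [(b,e)] follows singletons with the families using [(s,e)], and
   [(s,b+1), (b+1,e)], instead: with [u = D(s,b)], [v = x b], [w = D(b+1,e)] one would get
   [uw < 0 < vw], while [(u+v)^2 > u^2 + v^2]. *)
Lemma inc_last_bound x s b : normle x 1 ->
  (forall delta, 0 < delta -> exists Q, segfam Q /\ (forall q, In q Q -> (b <= fst q)%nat) /\
     1 - delta < psum (sqs x) b + sqinc x Q) ->
  (s <= b)%nat -> inc x (s, S b) ^ 2 <= psum (sqs x) (S b) - psum (sqs x) s.
Proof.
  intros Hx HA Hsb; apply Rnot_lt_le; intros Hlt.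
  destruct (HA _ (proj2 (Rlt_0_minus _ _) Hlt)) as [Q [HQ [HQb H]]].
  assert (HT : (psum x b - psum x s) ^ 2 <= psum (sqs x) b - psum (sqs x) s).
  { destruct (Nat.eq_dec s b) as [->|Hne].
    - rewrite !Rminus_diag; lra.
    - assert (HF : segfam (singles 0 s ++ (s, b) :: nil)).
      { apply segfam_singles_app; [|intros q [<-|[]]; simpl; lia].
        apply segfam_cons; split; [simpl; lia|split; [intros q []|apply segfam_nil]]. }
      assert (HB := sqinc_left_bound x b _ Hx HA HF).
      rewrite sqinc_app, sqinc_singles0, sqinc_cons in HB; unfold inc in HB; simpl in HB.
      cut (psum (sqs x) s + ((psum x b - psum x s) * ((psum x b - psum x s) * 1) + 0) <=
        psum (sqs x) b); [simpl; lra|].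
      apply HB; intros p Hp; apply in_app_or in Hp; destruct Hp as [Hp|[<-|[]]]; simpl; [|lia].
      apply in_singles in Hp; lia. }
  assert (Hsb1 : segfam (singles 0 s ++ (s, S b) :: nil)).
  { apply segfam_singles_app; [|intros q [<-|[]]; simpl; lia].
    apply segfam_cons; split; [simpl; lia|split; [intros q []|apply segfam_nil]]. }
  assert (Hglue : forall Q', segfam Q' -> (forall q, In q Q' -> (S b <= fst q)%nat) ->
    psum (sqs x) s + inc x (s, S b) ^ 2 + sqinc x Q' <= 1).
  { intros Q' HQ' Hb'.
    assert (HF := segfam_split (S b) _ _ Hsb1 HQ').
    assert (HF' : segfam ((singles 0 s ++ (s, S b) :: nil) ++ Q')).
    { apply HF; auto; intros p Hp; apply in_app_or in Hp.
      destruct Hp as [Hp|[<-|[]]]; simpl; [|lia]; apply in_singles in Hp; lia. }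
    apply (proj2 Hx) in HF'; rewrite !sqinc_app, sqinc_singles0, sqinc_cons in HF'.
    simpl in *; lra. }
  rewrite psum_sqs_S in H, Hlt.
  unfold inc in H, Hlt, Hglue; simpl fst in *; simpl snd in *; rewrite psum_S in H, Hlt, Hglue.
  (* Only a segment of [Q] starting at [b] can prevent [Q] from being placed after [(s, S b)]. *)
  destruct (excluded_middle_informative (exists e, In (b, e) Q)) as [[e He]|Hno].
  - destruct (in_permutation_cons _ _ _ He) as [Q' HP].
    assert (HQ' := segfam_perm _ _ HP HQ); rewrite (sqinc_perm _ _ _ HP), sqinc_cons in H.
    apply segfam_cons in HQ'; destruct HQ' as [Hbe [HD HQ']]; simpl in Hbe.
    assert (HQe : forall q, In q Q' -> (e <= fst q)%nat).
    { intros q Hq; destruct (HD q Hq) as [E|E]; simpl in E; auto.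
      assert (In q Q) by (apply (Permutation_in q (Permutation_sym HP)); now right).
      specialize (HQb q H0); assert (Hl := segfam_lt _ _ HQ' Hq); lia. }
    unfold inc in H; simpl fst in H; simpl snd in H.
    destruct (Nat.eq_dec e (S b)) as [->|Hne].
    + assert (HG := Hglue Q' HQ' HQe); rewrite psum_S in H.
      replace (psum x b + x b - psum x b) with (x b) in H by lra; lra.
    + assert (HG := Hglue ((S b, e) :: Q')).
      assert (HA1 : segfam (singles 0 s ++ (s, e) :: Q')).
      { apply segfam_singles_app.
        - apply segfam_cons; split; [simpl; lia|split; auto].
          intros q Hq; left; simpl; auto.
        - intros q [<-|Hq]; simpl; [lia|]; specialize (HQe q Hq); lia. }
      apply (proj2 Hx) in HA1; rewrite sqinc_app, sqinc_singles0, sqinc_cons in HA1.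
      assert (HG' : psum (sqs x) s + (psum x b + x b - psum x s) ^ 2 +
        sqinc x ((S b, e) :: Q') <= 1).
      { apply HG.
        - apply segfam_cons; split; [simpl; lia|split; auto].
          intros q Hq; left; simpl; auto.
        - intros q [<-|Hq]; simpl; [lia|]; specialize (HQe q Hq); lia. }
      clear HG; rewrite sqinc_cons in HG'; unfold inc in HA1, HG'; simpl fst in *; simpl snd in *.
      rewrite psum_S in HG'.
      set (v := x b) in *.
      pose (u := psum x b - psum x s); pose (w := psum x e - (psum x b + v)).
      replace (psum x b - psum x s) with u in HT by reflexivity.
      replace (psum x b + v - psum x s) with (u + v) in * by (unfold u; lra).
      replace (psum x e - (psum x b + v)) with w in * by reflexivity.
      replace (psum x e - psum x b) with (v + w) in * by (unfold w; lra).
      replace (psum x e - psum x s) with (u + v + w) in * by (unfold u, w; lra).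
      assert (u * w < 0) by nra.
      assert (0 < v * w) by nra.
      (* By [HT], [u ^ 2] is at most the sum of squares over [[s, b)], so the assumed excess of
         [(u + v) ^ 2] comes from [2 u v]. The three signs are incompatible, since
         [(u v) (v w) = (u w) v ^ 2]. *)
      assert (0 < u * v) by nra.
      assert (0 < (u * v) * (v * w)) by (apply Rmult_lt_0_compat; auto).
      assert ((u * v) * (v * w) = (u * w) * v ^ 2) by ring.
      pose proof (pow2_ge_0 v); nra.
  - assert (HG : psum (sqs x) s + (psum x b + x b - psum x s) ^ 2 + sqinc x Q <= 1).
    { apply Hglue; auto; intros q Hq; specialize (HQb q Hq).
      destruct (Nat.eq_dec (fst q) b) as [E|E]; [|lia].
      exfalso; apply Hno; exists (snd q); rewrite <- E, <- surjective_pairing; auto. }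
    pose proof (pow2_ge_0 (x b)); lra.
Qed.

(** Induction on [b]. The family of [extreme_break] has no segment across [S b], so it splits there,
    and its left part is traded for singletons. The inductive hypothesis does this up to [b] through
    [sqinc_left_bound]; the possible segment ending at [S b] is the case of [inc_last_bound]. *)
Lemma extreme_singletons x : extreme_BJ x -> forall b delta, 0 < delta ->
  exists Q, segfam Q /\ (forall q, In q Q -> (b <= fst q)%nat) /\
    1 - delta < psum (sqs x) b + sqinc x Q.
Proof.
  intros Hext; assert (Hx : normle x 1) by apply BJ_normle, Hext.
  induction b as [|b IH]; intros delta Hd.
  - destruct (extreme_break x 0 delta Hext Hd) as [L [HL [_ H]]].
    exists L; split; [auto|split; [intros; lia|simpl; lra]].
  - destruct (extreme_break x b delta Hext Hd) as [L [HL [Hbr H]]].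
    pose (lo := filter (fun p : nat * nat => Nat.leb (snd p) (S b)) L).
    pose (hi := filter (fun p : nat * nat => negb (Nat.leb (snd p) (S b))) L).
    assert (HP : Permutation L (lo ++ hi)).
    { unfold lo, hi; clear; induction L as [|p L IH]; [constructor|]; simpl.
      destruct (Nat.leb (snd p) (S b)); simpl; [now constructor|].
      now apply Permutation_cons_app. }
    assert (HF := segfam_perm _ _ HP HL); apply segfam_app_inv in HF; destruct HF as [Hlo Hhi].
    rewrite (sqinc_perm _ _ _ HP), sqinc_app in H.
    assert (Hlb : forall p, In p lo -> (snd p <= S b)%nat).
    { intros p Hp; apply filter_In in Hp; now apply Nat.leb_le. }
    exists hi; split; [auto|split].
    + intros q Hq; apply filter_In in Hq; destruct Hq as [Hq E].
      destruct (Nat.leb_spec (snd q) (S b)); [discriminate|].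
      destruct (Hbr q Hq); lia.
    + enough (sqinc x lo <= psum (sqs x) (S b)) by lra.
      destruct (excluded_middle_informative (exists s, In (s, S b) lo)) as [[s Hs]|Hno].
      * destruct (in_permutation_cons _ _ _ Hs) as [lo' HP'].
        assert (HF := segfam_perm _ _ HP' Hlo); rewrite (sqinc_perm _ _ _ HP'), sqinc_cons.
        apply segfam_cons in HF; destruct HF as [Hsb [HD HF]]; simpl in Hsb.
        assert (Hl : inc x (s, S b) ^ 2 <= psum (sqs x) (S b) - psum (sqs x) s)
          by (apply inc_last_bound; auto; lia).
        assert (Hlo' : forall p, In p lo' -> (snd p <= s)%nat).
        { intros p Hp; destruct (HD p Hp) as [E|E]; simpl in E; auto.
          assert (Hp' : In p lo) by (apply (Permutation_in p (Permutation_sym HP')); now right).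
          specialize (Hlb p Hp'); assert (Hlt := segfam_lt _ _ HF Hp); lia. }
        assert (HG : segfam (lo' ++ singles s (b - s))).
        { apply (segfam_split s); auto using segfam_singles.
          intros p Hp; apply in_singles in Hp; lia. }
        assert (HS : sqinc x (lo' ++ singles s (b - s)) <= psum (sqs x) b).
        { apply sqinc_left_bound; auto; intros p Hp; apply in_app_or in Hp.
          destruct Hp as [Hp|Hp]; [specialize (Hlo' p Hp); lia|apply in_singles in Hp; lia]. }
        rewrite sqinc_app, sqinc_singles in HS; replace (s + (b - s))%nat with b in HS by lia; lra.
      * rewrite psum_S; pose proof (sqs_ge0 x b).
        enough (sqinc x lo <= psum (sqs x) b) by lra.
        apply sqinc_left_bound; auto; intros p Hp; specialize (Hlb p Hp).
        destruct (Nat.eq_dec (snd p) (S b)) as [E|E]; [|lia].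
        exfalso; apply Hno; exists (fst p); rewrite <- E, <- surjective_pairing; auto.
Qed.

Lemma sqinc_tailseq x N L : (forall q, In q L -> (N <= fst q)%nat) -> segfam L ->
  sqinc (tailseq x N) L = sqinc x L.
Proof.
  intros HN HL; induction L as [|p L IH]; [reflexivity|].
  apply segfam_cons in HL; destruct HL as [A [B C]].
  assert (Hp := HN p (or_introl eq_refl)).
  rewrite !sqinc_cons, IH by (auto; intros; apply HN; now right).
  unfold inc; rewrite !psum_tail, !Nat.max_l by lia; f_equal; f_equal; lra.
Qed.

(** The family [Q] of [extreme_singletons] lies beyond [n], so its share is at most the squared norm
    of a tail, which tends to zero. *)
Lemma extreme_BJ_l2 x : extreme_BJ x -> is_lim_seq (psum (sqs x)) 1.
Proof.
  intros Hext; assert (Hx : normle x 1) by apply BJ_normle, Hext.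
  apply is_lim_seq_spec; intros eps; simpl.
  assert (He : 0 < sqrt (eps / 2)) by (apply sqrt_lt_R0; destruct eps; simpl; lra).
  destruct (tail_small x 1 _ Hx He) as [N HN].
  exists N; intros n Hn; specialize (HN n Hn).
  destruct (extreme_singletons x Hext n (eps / 2)) as [Q [HQ [HQn H]]]; [destruct eps; simpl; lra|].
  apply HN in HQ as HQ'; rewrite sqinc_tailseq in HQ' by auto.
  rewrite pow2_sqrt in HQ' by (destruct eps; simpl; lra).
  assert (H1 := sqs_psum_le1 x n Hx).
  rewrite Rabs_left1 by lra; lra.
Qed.

Lemma extreme_BJ_intro x : normle x 1 -> is_lim_seq (psum (sqs x)) 1 -> extreme_BJ x.
Proof.
  intros Hx Hlim; split; [now apply BJ_normle|]; intros y z t Hy Hz Ht E n.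
  apply BJ_normle in Hy; apply BJ_normle in Hz.
  assert (K : forall N, t * (1 - t) * psum (sqs (fun k => y k - z k)) N <= 1 - psum (sqs x) N).
  { intros N; assert (H1 := sqs_psum_le1 y N Hy); assert (H2 := sqs_psum_le1 z N Hz).
    (* Termwise identity for the convexity defect of the square: [t y^2 + (1 - t) z^2 - (t y + (1 -
       t) z)^2 = t (1 - t) (y - z)^2]. *)
    assert (H3 : psum (sqs x) N = t * psum (sqs y) N + (1 - t) * psum (sqs z) N
      - t * (1 - t) * psum (sqs (fun k => y k - z k)) N).
    { clear - E; induction N; [simpl; lra|]; rewrite !psum_sqs_S, IHN, E; ring. }
    nra. }
  assert (K' : t * (1 - t) * (y n - z n) ^ 2 <= 0).
  { change (Rbar_le (t * (1 - t) * (y n - z n) ^ 2) 0).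
    apply (is_lim_seq_le_loc (fun _ => t * (1 - t) * (y n - z n) ^ 2) (fun N => 1 - psum (sqs x) N)).
    - exists (S n); intros N HN; apply Rle_trans with (2 := K N).
      apply Rmult_le_compat_l; [nra|].
      apply Rle_trans with (psum (sqs (fun k => y k - z k)) (S n)).
      + rewrite psum_sqs_S.
        assert (0 <= psum (sqs (fun k => y k - z k)) n); [|lra].
        replace 0 with (psum (sqs (fun k => y k - z k)) 0) by reflexivity.
        apply psum_mono; [apply sqs_ge0|lia].
      + apply psum_mono; auto using sqs_ge0.
    - apply is_lim_seq_const.
    - replace (Finite 0) with (Finite (1 - 1)) by (f_equal; lra).
      apply is_lim_seq_minus'; [apply is_lim_seq_const|auto]. }
  assert (0 < t * (1 - t)) by nra.
  assert (0 <= (y n - z n) ^ 2) by apply pow2_ge_0.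
  assert ((y n - z n) ^ 2 = 0) by nra.
  assert (y n - z n = 0); [|lra]. apply Rsqr_0_uniq; unfold Rsqr; lra.
Qed.

(** * Smooth directions at a point of norm one *)

(** By [extreme_BJ_l2] and [extreme_BJ_intro], exactly the extreme points of [BJ]. *)
Definition l2unit (x : seqR) : Prop := normle x 1 /\ is_lim_seq (psum (sqs x)) 1.

Definition dot (x y : seqR) : seqR := fun k => x k * y k.

(** The loss incurred by using the segment [[a, b)] instead of its singletons. *)
Definition slack (x : seqR) (a b : nat) : R := inc (sqs x) (a, b) - inc x (a, b) ^ 2.

(** Half the derivative of [slack] at [x] in the direction [d]. *)
Definition gain (x d : seqR) (a b : nat) : R :=
  inc (dot x d) (a, b) - inc x (a, b) * inc d (a, b).

(* Along a good direction the family of singletons stays norming to first order. *)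
Definition good (x d : seqR) : Prop :=
  exists N, 0 <= N /\ forall a b, (a < b)%nat -> 0 <= gain x d a b + N * slack x a b.

(** Surround [[a, b)] by singletons up to [n]. The total is at most 1, while the singletons alone
    tend to 1 as [n] grows. *)
Lemma slack_ge0 x a b : l2unit x -> (a <= b)%nat -> 0 <= slack x a b.
Proof.
  intros [Hx Hlim] Hab; unfold slack, inc; simpl fst; simpl snd.
  destruct (Nat.eq_dec a b) as [->|Hne]; [rewrite !Rminus_diag; lra|].
  assert (K : (psum x b - psum x a) ^ 2 - (psum (sqs x) b - psum (sqs x) a) <= 0); [|lra].
  change (Rbar_le ((psum x b - psum x a) ^ 2 - (psum (sqs x) b - psum (sqs x) a)) 0).
  apply (is_lim_seq_le_loc (fun _ => (psum x b - psum x a) ^ 2 - (psum (sqs x) b - psum (sqs x) a))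
    (fun n => 1 - psum (sqs x) n)).
  - exists b; intros n Hn.
    assert (HF : segfam (singles 0 a ++ (a, b) :: singles b (n - b))).
    { apply segfam_singles_app.
      - apply segfam_cons; split; [simpl; lia|split; [|apply segfam_singles]].
        intros q Hq; apply in_singles in Hq; left; simpl; lia.
      - intros q [<-|Hq]; simpl; [lia|]; apply in_singles in Hq; lia. }
    apply (proj2 Hx) in HF; rewrite sqinc_app, sqinc_singles0, sqinc_cons, sqinc_singles in HF.
    replace (b + (n - b))%nat with n in HF by lia; unfold inc in HF; simpl fst in HF; simpl snd in HF.
    lra.
  - apply is_lim_seq_const.
  - replace (Finite 0) with (Finite (1 - 1)) by (f_equal; lra).
    apply is_lim_seq_minus'; [apply is_lim_seq_const|auto].
Qed.

Definition suminc (w : seqR) (L : list (nat * nat)) : R :=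
  fold_right (fun p acc => inc w p + acc) 0 L.

Lemma suminc_le w N L : (forall k, 0 <= w k) -> segfam L ->
  (forall p, In p L -> (snd p <= N)%nat) -> suminc w L <= psum w N.
Proof.
  intros Hw HL HN.
  (* Double counting: [sqinc (basis k) L] is the number of segments of [L] containing [k], which is
     at most 1. *)
  replace (suminc w L) with (psum (fun k => w k * sqinc (basis k) L) N).
  - apply psum_le; intros k _; assert (H := proj2 (normle_basis k) L HL).
    specialize (Hw k); nra.
  - induction L as [|p L IH].
    + simpl; apply psum_0; intros; lra.
    + apply segfam_cons in HL; destruct HL as [A [_ C]].
      rewrite (psum_ext _ (fun k => 1 * (w k * inc (basis k) p ^ 2) + 1 * (w k * sqinc (basis k) L)))
        by (intros; rewrite sqinc_cons; ring).
      rewrite psum_lin, IH by (auto; intros; apply HN; now right); simpl suminc.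
      assert (E : forall n, psum (fun k => w k * inc (basis k) p ^ 2) n =
        psum w (Nat.min n (snd p)) - psum w (Nat.min n (fst p))).
      { clear - A; induction n; [simpl; lra|]; rewrite psum_S, IHn; unfold inc.
        rewrite !psum_basis.
        destruct (Nat.ltb_spec n (snd p)), (Nat.ltb_spec n (fst p)); try lia.
        - rewrite !Nat.min_l by lia; rewrite psum_S; lra.
        - rewrite (Nat.min_l n (snd p)), (Nat.min_l (S n) (snd p)) by lia.
          rewrite !Nat.min_r by lia; rewrite psum_S; lra.
        - rewrite !Nat.min_r by lia; lra. }
      rewrite E; assert (H := HN p (or_introl eq_refl)).
      rewrite !Nat.min_r by lia; unfold inc; lra.
Qed.

Lemma psum_dot_comb x d c n :
  psum (sqs (fun k => x k + c * d k)) n =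
  psum (sqs x) n + 2 * c * psum (dot x d) n + c ^ 2 * psum (sqs d) n.
Proof.
  induction n; [simpl; lra|]; rewrite !psum_sqs_S, IHn, (psum_S (dot x d)); unfold dot; ring.
Qed.

Lemma inc_add x d c p : inc (fun k => x k + c * d k) p = inc x p + c * inc d p.
Proof.
  unfold inc; rewrite !(psum_ext (fun n => x n + c * d n) (fun n => 1 * x n + c * d n))
    by (intros; lra).
  rewrite !psum_lin; lra.
Qed.

Lemma finsupp_normle d K : (forall k, (K <= k)%nat -> d k = 0) -> exists c, normle d c.
Proof.
  intros HK; exists (real (Jnorm d)); apply inJ_normle.
  replace d with (headseq d K); [apply inJ_head|].
  apply functional_extensionality; intros k; unfold headseq.
  destruct (Nat.ltb_spec k K); [auto|]; now rewrite HK.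
Qed.

(** A one-sided derivative of the norm: for small [c > 0], goodness gives
    [||x + c d||^2 <= 1 + 2 c l + c^2 Z], whereas [g (x + c d) = 1 + c g d]. Comparing the terms
    linear in [c] gives the claim. *)
Lemma good_dual_le x d K g : l2unit x -> good x d -> (forall k, (K <= k)%nat -> d k = 0) ->
  BJdual g -> g x = 1 -> g d <= psum (dot x d) K.
Proof.
  intros Hx [N [HN Hgood]] HK Hg Hgx.
  destruct (finsupp_normle d K HK) as [m Hm].
  set (l := psum (dot x d) K).
  pose (Z := psum (sqs d) K + m ^ 2).
  assert (HZ : 0 <= Z).
  { unfold Z; pose proof (psum_mono (sqs d) 0 K (sqs_ge0 d) (Nat.le_0_l K)).
    pose proof (pow2_ge_0 m); simpl in *; lra. }
  assert (Hstep : forall c, 0 < c -> 2 * c * N <= 1 -> g d <= l + c * Z / 2).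
  { intros c Hc HcN.
    pose (y := fun k => x k + c * d k).
    assert (Hy : forall L, segfam L -> sqinc y L <= 1 + 2 * c * l + c ^ 2 * Z).
    { intros L HL.
      assert (H1 : sqinc y L <= suminc (sqs y) L + c ^ 2 * sqinc d L).
      { clear - HL Hgood HcN Hc HN Hx; induction L as [|p L IH]; [simpl; lra|].
        apply segfam_cons in HL; destruct HL as [A [_ C]]; specialize (IH C).
        rewrite !sqinc_cons; simpl suminc; unfold y at 1; rewrite inc_add.
        enough ((inc x p + c * inc d p) ^ 2 <= inc (sqs y) p + c ^ 2 * inc d p ^ 2) by lra.
        assert (HG := Hgood _ _ A); assert (HS := slack_ge0 x _ _ Hx (Nat.lt_le_incl _ _ A)).
        unfold gain in HG; unfold slack in *; rewrite <- !surjective_pairing in *.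
        assert (E : inc (sqs y) p = inc (sqs x) p + 2 * c * inc (dot x d) p + c ^ 2 * inc (sqs d) p)
          by (unfold inc, y; rewrite !psum_dot_comb; ring).
        assert (Hd : 0 <= inc (sqs d) p).
        { unfold inc; pose proof (psum_mono (sqs d) _ _ (sqs_ge0 d) (Nat.lt_le_incl _ _ A)); lra. }
        assert (0 <= c ^ 2 * inc (sqs d) p) by (apply Rmult_le_pos; [apply pow2_ge_0|auto]).
        set (s := inc (sqs x) p - inc x p ^ 2) in *.
        set (e := inc (dot x d) p - inc x p * inc d p) in *.
        (* The condition [2 c N <= 1] lets the slack [s] absorb a negative gain [e]. *)
        assert (0 <= 2 * c * e + s).
        { assert (0 <= 2 * c * (e + N * s)) by (apply Rmult_le_pos; lra). nra. }
        rewrite E; unfold s, e in *; nra. }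
      destruct (segfam_bounded L) as [M HM].
      assert (H2 : suminc (sqs y) L <= psum (sqs y) (Nat.max M K)).
      { apply suminc_le; auto using sqs_ge0; intros p Hp; specialize (HM p Hp); lia. }
      unfold y in H2 at 2; rewrite psum_dot_comb in H2.
      rewrite (psum_const (dot x d) K), (psum_const (sqs d) K) in H2 by
        (try lia; intros k Hk; unfold dot, sqs; rewrite HK by lia; ring).
      assert (H3 := sqs_psum_le1 x (Nat.max M K) (proj1 Hx)).
      assert (H4 := proj2 Hm L HL).
      assert (c ^ 2 * sqinc d L <= c ^ 2 * m ^ 2) by (apply Rmult_le_compat_l; [apply pow2_ge_0|auto]).
      fold l in H2; unfold Z; lra. }
    assert (Hpos : 0 <= 1 + 2 * c * l + c ^ 2 * Z) by (apply (Hy nil), segfam_nil).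
    assert (Hny : normle y (sqrt (1 + 2 * c * l + c ^ 2 * Z))).
    { split; [apply sqrt_pos|]; intros L HL; rewrite pow2_sqrt by auto; auto. }
    assert (Hgy : g y = 1 + c * g d).
    { replace y with (fun k => 1 * x k + c * d k)
        by (apply functional_extensionality; intros; unfold y; ring).
      rewrite (proj1 (proj1 Hg) x d 1 c); [rewrite Hgx; lra| |].
      - apply (normle_inJ x 1), Hx.
      - apply (normle_inJ d m), Hm. }
    assert (HB := BJdual_normle g y _ Hg Hny).
    assert (HB2 : (g y) ^ 2 <= 1 + 2 * c * l + c ^ 2 * Z).
    { rewrite <- (pow2_abs (g y)), <- (pow2_sqrt (1 + 2 * c * l + c ^ 2 * Z)) by auto.
      apply pow_incr; split; [apply Rabs_pos|auto]. }
    rewrite Hgy in HB2.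
    assert (0 <= (c * g d) ^ 2) by apply pow2_ge_0.
    apply Rmult_le_reg_l with c; [auto|]; nra. }
  apply Rnot_lt_le; intros Hlt.
  (* The first bound ensures [2 c N <= 1], the second makes [c Z / 2] smaller than the supposed
     excess [g d - l]. *)
  pose (c := Rmin (/ (2 * (N + 1))) ((g d - l) / (Z + 1))).
  assert (H2 : 0 < / (2 * (N + 1))) by (apply Rinv_0_lt_compat; lra).
  assert (H3 : 0 < (g d - l) / (Z + 1)) by (apply Rdiv_lt_0_compat; lra).
  assert (Hc : 0 < c) by (apply Rmin_glb_lt; auto).
  assert (H1 : 2 * c * N <= 1).
  { apply Rle_trans with (2 * / (2 * (N + 1)) * (N + 1)).
    - assert (c <= / (2 * (N + 1))) by apply Rmin_l. nra.
    - right; field; lra. }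
  assert (HS := Hstep c Hc H1).
  assert (c * (Z + 1) <= g d - l); [|nra].
  apply Rle_trans with ((g d - l) / (Z + 1) * (Z + 1)); [|right; field; lra].
  apply Rmult_le_compat_r; [lra|apply Rmin_r].
Qed.

(** * Construction of good directions *)

Definition sgn (r : R) : R := if Rlt_dec 0 r then 1 else -1.

Lemma sgn_mul r : sgn r * r = Rabs r.
Proof. unfold sgn; destruct (Rlt_dec 0 r); [rewrite Rabs_right|rewrite Rabs_left1]; lra. Qed.

Lemma sgn_cases r : sgn r = 1 \/ sgn r = -1.
Proof. unfold sgn; destruct (Rlt_dec 0 r); auto. Qed.

Lemma gain_basis x s i a b : (a < b)%nat ->
  gain x (fun k => s * basis i k) a b =
  if (Nat.leb a i && Nat.ltb i b)%bool then s * (x i - inc x (a, b)) else 0.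
Proof.
  intros Hab.
  assert (E1 : forall n, psum (fun k => s * basis i k) n = if Nat.ltb i n then s else 0).
  { intros n; rewrite (psum_ext _ (fun k => s * basis i k + 0 * 0)) by (intros; lra).
    rewrite (psum_lin (basis i) (fun _ => 0)), psum_basis; destruct (Nat.ltb i n); lra. }
  assert (E2 : forall n, psum (dot x (fun k => s * basis i k)) n = if Nat.ltb i n then s * x i else 0).
  { induction n; [reflexivity|]; rewrite psum_S, IHn; unfold dot, basis.
    destruct (Nat.eqb_spec n i), (Nat.ltb_spec i n), (Nat.ltb_spec i (S n)); try lia; subst; lra. }
  unfold gain; set (D := inc x (a, b)); unfold inc; simpl fst; simpl snd.
  rewrite !E1, !E2.
  destruct (Nat.leb_spec a i), (Nat.ltb_spec i b), (Nat.ltb_spec i a); try lia; simpl; lra.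
Qed.

Lemma gain_lin x d e r s a b :
  gain x (fun k => r * d k + s * e k) a b = r * gain x d a b + s * gain x e a b.
Proof.
  unfold gain, inc; simpl fst; simpl snd; rewrite !psum_lin.
  rewrite !(psum_ext (dot x (fun k => r * d k + s * e k)) (fun k => r * dot x d k + s * dot x e k))
    by (intros; unfold dot; lra).
  rewrite !psum_lin; ring.
Qed.

Lemma gain_single x d a : gain x d a (S a) = 0.
Proof. unfold gain, inc; simpl; unfold dot; ring. Qed.

Lemma gain_first x d i b : (i < b)%nat -> (forall k, (i < k)%nat -> d k = 0) ->
  gain x d i b = d i * (x i - inc x (i, b)).
Proof.
  intros Hb Hd; unfold gain; set (D := inc x (i, b)); unfold inc; simpl fst; simpl snd.
  rewrite (psum_const (dot x d) (S i)), (psum_const d (S i))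
    by (try lia; intros; unfold dot; rewrite Hd by lia; lra).
  rewrite !psum_S; unfold dot; lra.
Qed.

Lemma gain_right x d i a b : (i < a < b)%nat -> (forall k, (i < k)%nat -> d k = 0) ->
  gain x d a b = 0.
Proof.
  intros Hab Hd; unfold gain, inc; simpl fst; simpl snd.
  rewrite (psum_const (dot x d) a b), (psum_const d a b)
    by (try lia; intros; unfold dot; rewrite Hd by lia; lra).
  ring.
Qed.

Lemma slack_first x i b : (i < b)%nat ->
  slack x i b = x i ^ 2 + inc (sqs x) (S i, b) - (x i + inc x (S i, b)) ^ 2.
Proof.
  intros Hb; unfold slack, inc; simpl fst; simpl snd; rewrite psum_sqs_S, psum_S; ring.
Qed.

Lemma inc_le1 x a b : normle x 1 -> (a <= b)%nat -> Rabs (inc x (a, b)) <= 1.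
Proof. intros H Hab; apply (normle_inc x 1 a b H Hab). Qed.

Lemma term_le1 x i : normle x 1 -> Rabs (x i) <= 1.
Proof.
  intros H; assert (K := inc_le1 x i (S i) H ltac:(lia)).
  unfold inc in K; simpl in K; replace (psum x i + x i - psum x i) with (x i) in K by lra; auto.
Qed.

(** For a segment starting at [i]: [M] is [|x i|], [u] the increment over the rest, signed by [x i],
    and [B] the sum of squares over the rest; the last expression is the slack [B - u^2 - 2 M u]. If
    [u < 0], it is at least [-2 M u], which after division by [M] outweighs [u]. *)
Lemma first_term_bound M u B : 0 < M -> u ^ 2 <= B -> 0 <= M ^ 2 + B - (M + u) ^ 2 ->
  0 <= u + / M * (M ^ 2 + B - (M + u) ^ 2).
Proof.
  intros HM HB Hs; assert (Hi := Rinv_0_lt_compat _ HM).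
  destruct (Rle_dec 0 u); [assert (0 <= / M * (M ^ 2 + B - (M + u) ^ 2)) by (apply Rmult_le_pos; lra); lra|].
  apply Rmult_le_reg_l with M; [auto|]; rewrite Rmult_plus_distr_l, <- Rmult_assoc, Rinv_r by lra; nra.
Qed.

(** For [u <= - q / 6] the argument of [first_term_bound] gives at least [-u]; for smaller [|u|] the
    slack [B - u^2 - 2 M u] retains a fixed part of [q]. The factor 6 is merely a convenient
    threshold. *)
Lemma first_term_strict M u B q : 0 < M <= 1 -> u ^ 2 <= B -> 0 < q <= 1 -> q <= B ->
  0 <= M ^ 2 + B - (M + u) ^ 2 -> q / 6 <= u + / M * (M ^ 2 + B - (M + u) ^ 2).
Proof.
  intros HM HB Hq HqB Hs; assert (Hi := Rinv_0_lt_compat M ltac:(lra)).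
  assert (0 <= / M * (M ^ 2 + B - (M + u) ^ 2)) by (apply Rmult_le_pos; lra).
  destruct (Rle_dec (q / 6) u); [lra|].
  apply Rmult_le_reg_l with M; [lra|]; rewrite Rmult_plus_distr_l, <- Rmult_assoc, Rinv_r by lra.
  destruct (Rle_dec u (- (q / 6))); nra.
Qed.

(** If [M + u < 0] then [u < - M], so the slack is at least [-2 M u > 2 M^2]; divided by [M^2] it
    exceeds [|M + u| <= 1]. *)
Lemma outside_term_bound M u C : 0 < M -> u ^ 2 <= C -> Rabs (M + u) <= 1 ->
  0 <= C + M ^ 2 - (M + u) ^ 2 -> 0 <= (M + u) + / M ^ 2 * (C + M ^ 2 - (M + u) ^ 2).
Proof.
  intros HM HC Hu Hs; apply Rabs_le_between in Hu.
  assert (HM2 : 0 < M ^ 2) by (apply pow_lt; auto); assert (Hi := Rinv_0_lt_compat _ HM2).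
  assert (0 <= / M ^ 2 * (C + M ^ 2 - (M + u) ^ 2)) by (apply Rmult_le_pos; lra).
  destruct (Rle_dec 0 (M + u)); [lra|].
  apply Rmult_le_reg_l with (M ^ 2); [lra|]; rewrite Rmult_plus_distr_l, <- Rmult_assoc, Rinv_r by lra.
  nra.
Qed.

(* Each step multiplies the direction by a factor so large that the strict gain on the segments
   starting before [i] absorbs the new term at [i]. *)
Lemma direction_exists x i : l2unit x -> (forall j, (j <= i)%nat -> x j <> 0) ->
  exists d, (forall k, (i < k)%nat -> d k = 0) /\ d i = - sgn (x i) /\
    exists N eps, 0 <= N /\ 0 < eps /\
      forall a b, (a < i)%nat -> (a + 2 <= b)%nat -> eps <= gain x d a b + N * slack x a b.
Proof.
  intros Hx; induction i as [|i IH]; intros Hnz.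
  - exists (fun k => - sgn (x 0%nat) * basis 0 k); split; [|split].
    + intros k Hk; unfold basis; destruct (Nat.eqb_spec k 0); [lia|lra].
    + unfold basis; simpl; lra.
    + exists 0, 1; repeat split; try lra; intros; lia.
  - destruct IH as [d [Hsupp [Hdi [N [eps [HN [Heps Hst]]]]]]]; [intros; apply Hnz; lia|].
    assert (HM : 0 < Rabs (x i)) by (apply Rabs_pos_lt, Hnz; lia).
    assert (Hq : 0 < x (S i) ^ 2 <= 1).
    { split; [rewrite <- pow2_abs; apply pow_lt, Rabs_pos_lt, Hnz; lia|].
      rewrite <- pow2_abs; assert (K := term_le1 x (S i) (proj1 Hx)).
      pose proof (Rabs_pos (x (S i))); nra. }
    pose (N1 := Rmax N (/ Rabs (x i))); pose (e1 := Rmin eps (x (S i) ^ 2 / 6)).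
    assert (He1 : 0 < e1) by (apply Rmin_glb_lt; lra).
    assert (HN1 : 0 <= N1) by (apply Rle_trans with (1 := HN), Rmax_l).
    assert (Hst1 : forall a b, (a < S i)%nat -> (a + 2 <= b)%nat -> e1 <= gain x d a b + N1 * slack x a b).
    { intros a b Ha Hb; assert (Hs := slack_ge0 x a b Hx ltac:(lia)).
      (* The segments starting at [i] are new at this stage. Having two points or more they contain
         [S i], and [x (S i) ^ 2] is the amount [q] that makes their gain strict. *)
      destruct (Nat.eq_dec a i) as [->|Hne].
      - rewrite gain_first, Hdi by (auto; lia).
        assert (HB : inc x (S i, b) ^ 2 <= inc (sqs x) (S i, b)).
        { assert (K := slack_ge0 x (S i) b Hx ltac:(lia)); unfold slack in K; lra. }
        assert (HqB : x (S i) ^ 2 <= inc (sqs x) (S i, b)).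
        { unfold inc; simpl fst; simpl snd.
          assert (K := psum_mono (sqs x) (S (S i)) b (sqs_ge0 x) ltac:(lia)).
          rewrite (psum_sqs_S x (S i)) in K; lra. }
        rewrite slack_first in * by lia.
        assert (Hi : inc x (i, b) = x i + inc x (S i, b))
          by (unfold inc; simpl fst; simpl snd; rewrite psum_S; ring).
        assert (Hx2 : x i = sgn (x i) * Rabs (x i)).
        { rewrite <- sgn_mul; destruct (sgn_cases (x i)) as [->| ->]; lra. }
        assert (Hr : forall r, (x i + r) ^ 2 = (Rabs (x i) + sgn (x i) * r) ^ 2).
        { intros r; rewrite Hx2 at 1; destruct (sgn_cases (x i)) as [->| ->]; ring. }
        rewrite Hr in *; rewrite <- (pow2_abs (x i)) in *.
        assert (K := first_term_strict (Rabs (x i)) (sgn (x i) * inc x (S i, b))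
          (inc (sqs x) (S i, b)) (x (S i) ^ 2) (conj HM (term_le1 x i (proj1 Hx)))).
        specialize (K ltac:(destruct (sgn_cases (x i)) as [->| ->]; lra) Hq HqB Hs).
        rewrite Hi.
        replace (- sgn (x i) * (x i - (x i + inc x (S i, b)))) with (sgn (x i) * inc x (S i, b)) by ring.
        assert (e1 <= x (S i) ^ 2 / 6) by apply Rmin_r.
        assert (/ Rabs (x i) <= N1) by apply Rmax_r.
        set (sl := Rabs (x i) ^ 2 + inc (sqs x) (S i, b) -
          (Rabs (x i) + sgn (x i) * inc x (S i, b)) ^ 2) in *.
        assert (/ Rabs (x i) * sl <= N1 * sl) by (apply Rmult_le_compat_r; auto). lra.
      - assert (K := Hst a b ltac:(lia) Hb).
        assert (e1 <= eps) by apply Rmin_l; assert (N <= N1) by apply Rmax_l.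
        assert (N * slack x a b <= N1 * slack x a b) by (apply Rmult_le_compat_r; auto). lra. }
    (* Terms and increments of [x] are at most 1 in absolute value, so the new unit vector changes
       the gain by at most 2. The old direction is scaled to contribute at least 3, which leaves
       1. *)
    exists (fun k => 3 / e1 * d k + (- sgn (x (S i))) * basis (S i) k); split; [|split].
    + intros k Hk; rewrite Hsupp by lia; unfold basis; destruct (Nat.eqb_spec k (S i)); [lia|lra].
    + rewrite Hsupp by lia; unfold basis; rewrite Nat.eqb_refl; lra.
    + exists (3 / e1 * N1), 1.
      assert (H3 : 0 < 3 / e1) by (apply Rdiv_lt_0_compat; lra).
      split; [apply Rmult_le_pos; lra|split; [lra|]]; intros a b Ha Hb.
      rewrite gain_lin; assert (K := Hst1 a b Ha Hb).
      assert (K1 : 3 <= 3 / e1 * (gain x d a b + N1 * slack x a b)).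
      { apply Rle_trans with (3 / e1 * e1); [right; field; lra|apply Rmult_le_compat_l; lra]. }
      assert (K2 : -2 <= - sgn (x (S i)) * gain x (basis (S i)) a b).
      { 
        replace (gain x (basis (S i)) a b) with (gain x (fun k => 1 * basis (S i) k) a b)
          by (f_equal; apply functional_extensionality; intros; ring).
        rewrite gain_basis by lia.
        assert (A1 := term_le1 x (S i) (proj1 Hx)); assert (A2 := inc_le1 x a b (proj1 Hx) ltac:(lia)).
        apply Rabs_le_between in A1; apply Rabs_le_between in A2.
        destruct (_ && _)%bool; destruct (sgn_cases (x (S i))) as [->| ->]; lra. }
      lra.
Qed.

(** [direction_exists] leaves the segments starting at [i]. On these the coefficient [- sgn (x i)]
    turns the gain into the signed increment of the rest, the [u] of [first_term_bound]; segments
    beyond [i] and single points have gain zero. *)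
Lemma good_direction x i : l2unit x -> (forall j, (j <= i)%nat -> x j <> 0) ->
  exists d, (forall k, (i < k)%nat -> d k = 0) /\ d i <> 0 /\ good x d.
Proof.
  intros Hx Hnz; destruct (direction_exists x i Hx Hnz) as [d [Hsupp [Hdi [N [eps [HN [He Hst]]]]]]].
  exists d; split; [auto|split].
  - rewrite Hdi; destruct (sgn_cases (x i)) as [->| ->]; lra.
  - assert (HM : 0 < Rabs (x i)) by (apply Rabs_pos_lt, Hnz; lia).
    exists (Rmax N (/ Rabs (x i))); split; [apply Rle_trans with (1 := HN), Rmax_l|].
    intros a b Hab; assert (Hs := slack_ge0 x a b Hx ltac:(lia)).
    assert (N * slack x a b <= Rmax N (/ Rabs (x i)) * slack x a b)
      by (apply Rmult_le_compat_r; [auto|apply Rmax_l]).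
    assert (/ Rabs (x i) * slack x a b <= Rmax N (/ Rabs (x i)) * slack x a b)
      by (apply Rmult_le_compat_r; [auto|apply Rmax_r]).
    assert (0 <= N * slack x a b) by (apply Rmult_le_pos; auto).
    destruct (Nat.eq_dec b (S a)) as [->|Hne]; [rewrite gain_single; lra|].
    destruct (Nat.lt_total a i) as [Hai|[->|Hai]].
    + assert (K := Hst a b Hai ltac:(lia)); lra.
    + rewrite gain_first, Hdi by (auto; lia).
      assert (HB : inc x (S i, b) ^ 2 <= inc (sqs x) (S i, b)).
      { assert (K := slack_ge0 x (S i) b Hx ltac:(lia)); unfold slack in K; lra. }
      rewrite slack_first in * by lia.
      assert (Hi : inc x (i, b) = x i + inc x (S i, b))
        by (unfold inc; simpl fst; simpl snd; rewrite psum_S; ring).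
      assert (Hx2 : x i = sgn (x i) * Rabs (x i)).
      { rewrite <- sgn_mul; destruct (sgn_cases (x i)) as [->| ->]; lra. }
      assert (Hr : forall r, (x i + r) ^ 2 = (Rabs (x i) + sgn (x i) * r) ^ 2).
      { intros r; rewrite Hx2 at 1; destruct (sgn_cases (x i)) as [->| ->]; ring. }
      rewrite Hr in *; rewrite <- (pow2_abs (x i)) in *.
      assert (K := first_term_bound (Rabs (x i)) (sgn (x i) * inc x (S i, b))
        (inc (sqs x) (S i, b)) HM).
      specialize (K ltac:(destruct (sgn_cases (x i)) as [->| ->]; lra) Hs).
      rewrite Hi; replace (- sgn (x i) * (x i - (x i + inc x (S i, b))))
        with (sgn (x i) * inc x (S i, b)) by ring; lra.
    + rewrite (gain_right x d i) by (auto; lia); lra.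
Qed.

(** For a position just before the support. On [[0, b)] with [b >= 2] the gain is the increment
    signed by [m], so [outside_term_bound] applies. One sign of the direction is enough, because in
    [pair_eq] the average of the two functionals attains the bound. *)
Lemma good_left x : l2unit x -> x 0%nat = 0 -> x 1%nat <> 0 ->
  good x (fun k => - sgn (x 1%nat) * basis 0 k).
Proof.
  intros Hx H0 H1; set (m := x 1%nat) in *.
  assert (HM : 0 < Rabs m) by now apply Rabs_pos_lt.
  assert (HM2 := Rinv_0_lt_compat _ (pow_lt _ 2 HM)).
  exists (/ Rabs m ^ 2); split; [lra|]; intros a b Hab.
  assert (Hs := slack_ge0 x a b Hx ltac:(lia)).
  assert (0 <= / Rabs m ^ 2 * slack x a b) by (apply Rmult_le_pos; lra).
  rewrite gain_basis by auto.
  destruct (Nat.leb_spec a 0), (Nat.ltb_spec 0 b); simpl andb; cbv iota; try lra.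
  assert (a = 0%nat) by lia; subst a.
  destruct (Nat.eq_dec b 1) as [->|Hb].
  - replace (inc x (0%nat, 1%nat)) with 0 by (unfold inc; simpl; lra).
    rewrite H0; lra.
  - assert (HC : inc x (2%nat, b) ^ 2 <= inc (sqs x) (2%nat, b)).
    { assert (K := slack_ge0 x 2 b Hx ltac:(lia)); unfold slack in K; lra. }
    assert (Hi : inc x (0%nat, b) = m + inc x (2%nat, b)).
    { unfold inc; simpl; rewrite H0; fold m; ring. }
    assert (Hi2 : slack x 0 b = inc (sqs x) (2%nat, b) + Rabs m ^ 2 - (m + inc x (2%nat, b)) ^ 2).
    { unfold slack; rewrite Hi, pow2_abs; unfold inc; simpl; unfold sqs; rewrite H0; fold m; ring. }
    assert (Hx2 : m = sgn m * Rabs m).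
    { rewrite <- sgn_mul; destruct (sgn_cases m) as [->| ->]; lra. }
    assert (Hr : forall r, (m + r) ^ 2 = (Rabs m + sgn m * r) ^ 2).
    { intros r; rewrite Hx2 at 1; destruct (sgn_cases m) as [->| ->]; ring. }
    assert (Hle := inc_le1 x 0 b (proj1 Hx) ltac:(lia)); rewrite Hi in Hle.
    rewrite Hr in Hi2; rewrite Hi2 in *; rewrite H0, Hi.
    assert (K := outside_term_bound (Rabs m) (sgn m * inc x (2%nat, b)) (inc (sqs x) (2%nat, b)) HM).
    replace (- sgn m * (0 - (m + inc x (2%nat, b)))) with (Rabs m + sgn m * inc x (2%nat, b)).
    + apply K; auto.
      * destruct (sgn_cases m) as [->| ->]; lra.
      * replace (Rabs m + sgn m * inc x (2%nat, b)) with (sgn m * (m + inc x (2%nat, b)))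
          by (rewrite <- sgn_mul; ring).
        rewrite Rabs_mult; destruct (sgn_cases m) as [->| ->];
          [rewrite (Rabs_right 1)|rewrite (Rabs_left (-1))]; lra.
    + rewrite <- sgn_mul; ring.
Qed.

(** Mirror image of [good_left]: a segment through [S k] ends where the partial sums are already
    constant, so only [m] and the part before [k] count. *)
Lemma good_right x k : l2unit x -> x k <> 0 -> (forall j, (k < j)%nat -> x j = 0) ->
  good x (fun n => - sgn (x k) * basis (S k) n).
Proof.
  intros Hx H1 H0; set (m := x k) in *.
  assert (HM : 0 < Rabs m) by now apply Rabs_pos_lt.
  assert (HM2 := Rinv_0_lt_compat _ (pow_lt _ 2 HM)).
  exists (/ Rabs m ^ 2); split; [lra|]; intros a b Hab.
  assert (Hs := slack_ge0 x a b Hx ltac:(lia)).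
  assert (0 <= / Rabs m ^ 2 * slack x a b) by (apply Rmult_le_pos; lra).
  rewrite gain_basis by auto.
  destruct (Nat.leb_spec a (S k)), (Nat.ltb_spec (S k) b); simpl andb; cbv iota; try lra.
  rewrite (H0 (S k)) by lia.
  destruct (Nat.eq_dec a (S k)) as [->|Ha].
  - replace (inc x (S k, b)) with 0; [lra|].
    unfold inc; simpl fst; simpl snd; rewrite (psum_const x (S k) b) by (try lia; intros; apply H0; lia); ring.
  - assert (HC : inc x (a, k) ^ 2 <= inc (sqs x) (a, k)).
    { assert (K := slack_ge0 x a k Hx ltac:(lia)); unfold slack in K; lra. }
    assert (Hi : inc x (a, b) = m + inc x (a, k)).
    { unfold inc; simpl fst; simpl snd; rewrite (psum_const x (S k) b), psum_S by (try lia; intros; apply H0; lia).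
      fold m; ring. }
    assert (Hi2 : slack x a b = inc (sqs x) (a, k) + Rabs m ^ 2 - (m + inc x (a, k)) ^ 2).
    { unfold slack; rewrite Hi, pow2_abs; unfold inc; simpl fst; simpl snd.
      rewrite (psum_const (sqs x) (S k) b), psum_sqs_S
        by (try lia; intros; unfold sqs; rewrite H0 by lia; ring).
      fold m; ring. }
    assert (Hx2 : m = sgn m * Rabs m).
    { rewrite <- sgn_mul; destruct (sgn_cases m) as [->| ->]; lra. }
    assert (Hr : forall r, (m + r) ^ 2 = (Rabs m + sgn m * r) ^ 2).
    { intros r; rewrite Hx2 at 1; destruct (sgn_cases m) as [->| ->]; ring. }
    assert (Hle := inc_le1 x a b (proj1 Hx) ltac:(lia)); rewrite Hi in Hle.
    rewrite Hr in Hi2; rewrite Hi2 in *; rewrite Hi.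
    assert (K := outside_term_bound (Rabs m) (sgn m * inc x (a, k)) (inc (sqs x) (a, k)) HM).
    replace (- sgn m * (0 - (m + inc x (a, k)))) with (Rabs m + sgn m * inc x (a, k)).
    + apply K; auto.
      * destruct (sgn_cases m) as [->| ->]; lra.
      * replace (Rabs m + sgn m * inc x (a, k)) with (sgn m * (m + inc x (a, k)))
          by (rewrite <- sgn_mul; ring).
        rewrite Rabs_mult; destruct (sgn_cases m) as [->| ->];
          [rewrite (Rabs_right 1)|rewrite (Rabs_left (-1))]; lra.
    + rewrite <- sgn_mul; ring.
Qed.

Lemma pair_eq x g h t d K : l2unit x -> BJdual g -> BJdual h -> 0 < t < 1 ->
  t * g x + (1 - t) * h x = 1 -> good x d -> (forall k, (K <= k)%nat -> d k = 0) ->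
  t * g d + (1 - t) * h d = psum (dot x d) K -> g d = h d.
Proof.
  intros Hx Hg Hh Ht E Hd HK Ed.
  assert (H1 := BJdual_normle g x 1 Hg (proj1 Hx)); apply Rabs_le_between in H1.
  assert (H2 := BJdual_normle h x 1 Hh (proj1 Hx)); apply Rabs_le_between in H2.
  assert (Eg : g x = 1) by nra; assert (Eh : h x = 1) by nra.
  assert (K1 := good_dual_le x d K g Hx Hd HK Hg Eg).
  assert (K2 := good_dual_le x d K h Hx Hd HK Hh Eh).
  nra.
Qed.

Lemma pair_basis_eq x g h t i : l2unit x -> BJdual g -> BJdual h -> 0 < t < 1 ->
  t * g x + (1 - t) * h x = 1 -> (forall j, (j <= i)%nat -> x j <> 0) ->
  (forall j, (j <= i)%nat -> t * g (basis j) + (1 - t) * h (basis j) = x j) ->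
  g (basis i) = h (basis i).
Proof.
  intros Hx Hg Hh Ht E; induction i as [i IH] using lt_wf_ind; intros Hnz Hc.
  destruct (good_direction x i Hx Hnz) as [d [Hsupp [Hdi Hd]]].
  assert (HK : forall k, (S i <= k)%nat -> d k = 0) by (intros; apply Hsupp; lia).
  assert (Eg := lin_head_eq g d (S i) (proj1 (proj1 Hg)) HK).
  assert (Eh := lin_head_eq h d (S i) (proj1 (proj1 Hh)) HK).
  assert (Eq : g d = h d).
  { apply (pair_eq x g h t d (S i)); auto.
    rewrite Eg, Eh, <- psum_lin; apply psum_ext; intros k Hk; unfold dot.
    rewrite <- (Hc k) by lia; ring. }
  rewrite Eg, Eh, !psum_S in Eq.
  rewrite (psum_ext (fun n => g (basis n) * d n) (fun n => h (basis n) * d n) i) in Eq.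
  - apply Rmult_eq_reg_r with (d i); [lra|auto].
  - intros k Hk; rewrite IH; auto; intros j Hj; [apply Hnz|apply Hc]; lia.
Qed.

Lemma pair_good_basis x g h t i s : l2unit x -> BJdual g -> BJdual h -> 0 < t < 1 ->
  t * g x + (1 - t) * h x = 1 -> good x (fun k => - sgn s * basis i k) -> x i = 0 ->
  t * g (basis i) + (1 - t) * h (basis i) = 0 -> g (basis i) = h (basis i).
Proof.
  intros Hx Hg Hh Ht E Hd Hi Hc.
  assert (Hsc : forall f, BJdual f -> f (fun k => - sgn s * basis i k) = - sgn s * f (basis i)).
  { intros f Hf; replace (fun k => - sgn s * basis i k) with
      (fun k => - sgn s * basis i k + 0 * basis i k)
      by (apply functional_extensionality; intros; ring).
    rewrite (proj1 (proj1 Hf)) by apply inJ_basis; ring. }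
  assert (Eq : g (fun k => - sgn s * basis i k) = h (fun k => - sgn s * basis i k)).
  { apply (pair_eq x g h t _ (S i)); auto.
    - intros k Hk; unfold basis; destruct (Nat.eqb_spec k i); [lia|ring].
    - rewrite !Hsc by auto; rewrite psum_0.
      + replace (t * (- sgn s * g (basis i)) + (1 - t) * (- sgn s * h (basis i))) with
          (- sgn s * (t * g (basis i) + (1 - t) * h (basis i))) by ring.
        rewrite Hc; ring.
      + intros k Hk; unfold dot, basis; destruct (Nat.eqb_spec k i); [subst; rewrite Hi|]; ring. }
  rewrite !Hsc in Eq by auto; destruct (sgn_cases s) as [Es|Es]; rewrite Es in Eq; lra.
Qed.

(** * Spreading a sequence along increasing positions *)

(* [count p n] is the number of [i] with [p i < n]. *)
Fixpoint count (p : nat -> nat) (n : nat) : nat :=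
  match n with
  | O => O
  | S m => if Nat.eqb (p (count p m)) m then S (count p m) else count p m
  end.

Definition spread (p : nat -> nat) (x : seqR) : seqR :=
  fun n => if Nat.eqb (p (count p n)) n then x (count p n) else 0.

Definition pos_increasing (p : nat -> nat) : Prop := forall i, (p i < p (S i))%nat.

Lemma increasing_lt p i j : pos_increasing p -> (i < j)%nat -> (p i < p j)%nat.
Proof. intros H; induction 1; [apply H|]; specialize (H m); lia. Qed.

Lemma increasing_inj p i j : pos_increasing p -> p i = p j -> i = j.
Proof.
  intros H E; destruct (Nat.lt_total i j) as [K|[K|K]]; auto;
    apply (increasing_lt p) in K; auto; lia.
Qed.

Lemma increasing_ge p i : pos_increasing p -> (i <= p i)%nat.
Proof. intros H; induction i; [lia|]; specialize (H i); lia. Qed.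

Lemma count_spec p : pos_increasing p -> forall n i, (i < count p n <-> p i < n)%nat.
Proof.
  intros H; induction n; intros i; simpl; [lia|].
  destruct (Nat.eqb_spec (p (count p n)) n) as [E|E].
  - destruct (Nat.eq_dec i (count p n)) as [->|Hne]; [lia|].
    assert (p i <> n) by (intros K; apply Hne, (increasing_inj p); auto; lia).
    specialize (IHn i); lia.
  - assert (Hni : p i <> n).
    { intros K; assert (~ (i < count p n)%nat) by (rewrite IHn; lia).
      assert (p (count p n) <= p i)%nat.
      { destruct (Nat.eq_dec (count p n) i) as [->|]; [auto|].
        apply Nat.lt_le_incl, increasing_lt; auto; lia. }
      assert (~ (p (count p n) < n)%nat) by (rewrite <- IHn; lia). lia. }
    specialize (IHn i); lia.
Qed.

Lemma count_mono p a b : (a <= b)%nat -> (count p a <= count p b)%nat.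
Proof. induction 1; auto; simpl; destruct (Nat.eqb _ _); lia. Qed.

Lemma psum_spread p x n : psum (spread p x) n = psum x (count p n).
Proof.
  induction n; [reflexivity|]; rewrite psum_S, IHn; unfold spread; simpl count.
  destruct (Nat.eqb (p (count p n)) n); [rewrite psum_S|]; lra.
Qed.

Lemma normle_spread p x c : normle x c -> normle (spread p x) c.
Proof.
  apply (normle_remap (count p) _ _ 0); [apply count_mono|].
  intros n; rewrite psum_spread; lra.
Qed.

Lemma count_at p i : pos_increasing p -> count p (p i) = i.
Proof.
  intros H; assert (K := count_spec p H (p i)).
  assert (~ (i < count p (p i))%nat) by (rewrite K; lia).
  destruct i; [lia|]; assert (i < count p (p (S i)))%nat by (rewrite K; apply H); lia.
Qed.

Lemma spread_at p x i : pos_increasing p -> spread p x (p i) = x i.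
Proof. intros H; unfold spread; rewrite count_at, Nat.eqb_refl; auto. Qed.

Lemma spread_off p x n : (forall i, p i <> n) -> spread p x n = 0.
Proof.
  intros H; unfold spread; destruct (Nat.eqb_spec (p (count p n)) n) as [E|]; auto.
  now apply H in E.
Qed.

Lemma spread_basis p i : pos_increasing p -> spread p (basis i) = basis (p i).
Proof.
  intros H; apply functional_extensionality; intros n.
  destruct (excluded_middle_informative (exists j, p j = n)) as [[j <-]|Hn].
  - rewrite spread_at by auto; unfold basis.
    destruct (Nat.eqb_spec j i) as [Hj|Hj], (Nat.eqb_spec (p j) (p i)) as [E|E]; try congruence.
    exfalso; apply Hj, (increasing_inj p); auto.
  - rewrite spread_off by (intros j E; apply Hn; eauto); unfold basis.
    destruct (Nat.eqb_spec n (p i)) as [->|]; auto; exfalso; apply Hn; eauto.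
Qed.

(** Pulling [g] back along the positions gives a functional with value [g (basis (p i))] on
    [basis i]. Questions about the intervals thus become questions about the coefficient sequence
    alone. *)
Lemma BJdual_spread p g : BJdual g -> BJdual (fun x => g (spread p x)).
Proof.
  intros Hg; apply BJdual_intro.
  - intros x y a b Hx Hy.
    rewrite <- (proj1 (proj1 Hg)).
    + f_equal; apply functional_extensionality; intros n; unfold spread.
      destruct (Nat.eqb _ _); lra.
    + apply (normle_inJ _ _ (normle_spread p x _ (inJ_normle x Hx))).
    + apply (normle_inJ _ _ (normle_spread p y _ (inJ_normle y Hy))).
  - intros x c Hx; apply BJdual_normle; auto using normle_spread.
Qed.

Definition cons0 (x : seqR) : seqR := fun n => match n with O => 0 | S m => x m end.

Lemma psum_cons0 x n : psum (cons0 x) n = psum x (pred n).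
Proof.
  induction n; [reflexivity|]; rewrite psum_S, IHn; destruct n; [simpl; lra|reflexivity].
Qed.

Lemma l2unit_cons0 x : l2unit x -> l2unit (cons0 x).
Proof.
  intros [H1 H2]; split.
  - apply (normle_remap pred x _ 0); [intros; lia| |auto].
    intros n; rewrite psum_cons0; lra.
  - apply is_lim_seq_incr_1; apply is_lim_seq_ext with (psum (sqs x)); [|auto].
    intros n; rewrite (psum_ext (sqs (cons0 x)) (cons0 (sqs x))), psum_cons0; [reflexivity|].
    intros [|k] _; unfold sqs, cons0; [ring|reflexivity].
Qed.

(** * Functionals represented by a family of intervals *)

Lemma psum_eventually_lim x (l : R) m : is_lim_seq (psum x) l ->
  (forall n, (m <= n)%nat -> x n = 0) -> l = psum x m.
Proof.
  intros H Hx; apply is_lim_seq_unique in H.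
  assert (K : is_lim_seq (psum x) (psum x m)).
  { apply is_lim_seq_ext_loc with (fun _ => psum x m); [|apply is_lim_seq_const].
    exists m; intros n Hn; symmetry; apply psum_const; auto; intros; apply Hx; lia. }
  apply is_lim_seq_unique in K; rewrite H in K; now injection K.
Qed.

Lemma coef_in F a i : inF F i -> coef_seq F a i = a i.
Proof. unfold coef_seq, inF; destruct F; auto; intros H; now apply Nat.ltb_lt in H as ->. Qed.

Lemma coef_out F a i : ~ inF F i -> coef_seq F a i = 0.
Proof.
  unfold coef_seq, inF; destruct F; [|tauto]; intros H.
  destruct (Nat.ltb_spec i n); tauto.
Qed.

(** Padding the coefficients by zeros turns the finite sum and the series into one kind of limit. *)
Lemma represents_lim f F I a x : valid_F F -> represents f F I a -> inJ x ->
  is_lim_seq (psum (fun i => coef_seq F a i * Isum x (I i))) (f x).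
Proof.
  intros HF H Hx; specialize (H x Hx); destruct F as [k|].
  - simpl in HF; rewrite sum_n_m_psum in H by lia; simpl psum in H at 2.
    replace (S (k - 1)) with k in H by lia.
    apply is_lim_seq_ext_loc with (fun _ => f x); [|apply is_lim_seq_const].
    exists k; intros n Hn; rewrite (psum_const _ k n Hn).
    + rewrite H, Rminus_0_r; apply psum_ext; intros i Hi.
      now rewrite coef_in by (simpl; lia).
    + intros i Hi; rewrite coef_out by (simpl; lia); ring.
  - apply is_series_psum in H; exact H.
Qed.

Lemma Isum_basis n I : is_interval I ->
  (in_interval I n -> Isum (basis n) I = 1) /\ (~ in_interval I n -> Isum (basis n) I = 0).
Proof.
  intros HI; destruct I as [a b|a]; simpl in *.
  - rewrite sum_n_m_psum, !psum_basis by auto.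
    destruct (Nat.ltb_spec n (S b)), (Nat.ltb_spec n a); split; intros; try lia; lra.
  - assert (K : is_lim_seq (psum (basis n)) 1).
    { apply is_lim_seq_ext_loc with (fun _ => 1); [|apply is_lim_seq_const].
      exists (S n); intros m Hm; rewrite psum_basis; destruct (Nat.ltb_spec n m); [auto|lia]. }
    apply (psum_cv_shift _ _ a), is_series_unique in K; rewrite psum_basis in K.
    rewrite K; destruct (Nat.ltb_spec n a); split; intros; try lia; lra.
Qed.

Lemma inF_le F i j : inF F j -> (i <= j)%nat -> inF F i.
Proof. destruct F; simpl; [lia|auto]. Qed.

Lemma inF_dec F i : inF F i \/ ~ inF F i.
Proof. destruct F; simpl; [lia|auto]. Qed.

Lemma imin_le I n : in_interval I n -> (imin I <= n)%nat.
Proof. destruct I; simpl; lia. Qed.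

Lemma family_lt F I i j n : interval_family F I -> inF F j -> (i < j)%nat ->
  in_interval (I i) n -> (n < imin (I j))%nat.
Proof.
  intros [_ [HI HS]] Hj Hij Hn; induction Hij as [|j Hij IH].
  - specialize (HS i Hj); destruct (I i); simpl in *; [lia|tauto].
  - assert (Hj' := inF_le _ j _ Hj ltac:(lia)); specialize (IH Hj').
    specialize (HS j Hj); specialize (HI j Hj'); destruct (I j); simpl in *; [lia|tauto].
Qed.

Lemma represents_basis f F I a n i : in_Jdual f -> interval_family F I -> represents f F I a ->
  inF F i -> in_interval (I i) n -> f (basis n) = a i.
Proof.
  intros Hf HF Hr Hi Hn.
  assert (K := represents_lim f F I a (basis n) (proj1 HF) Hr (inJ_basis n)).
  assert (Hz : forall j, j <> i -> coef_seq F a j * Isum (basis n) (I j) = 0).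
  { intros j Hj; destruct (inF_dec F j) as [Hj'|Hj']; [|rewrite coef_out by auto; ring].
    rewrite (proj2 (Isum_basis n (I j) (proj1 (proj2 HF) j Hj'))); [ring|].
    intros Hin; destruct (Nat.lt_total i j) as [L|[L|L]]; [|congruence|].
    - assert (Q := family_lt F I i j n HF Hj' L Hn); apply imin_le in Hin; lia.
    - assert (Q := family_lt F I j i n HF Hi L Hin); apply imin_le in Hn; lia. }
  rewrite (psum_eventually_lim _ _ (S i) K) by (intros; apply Hz; lia).
  rewrite psum_S, psum_0 by (intros; apply Hz; lia).
  rewrite coef_in by auto; rewrite (proj1 (Isum_basis n (I i) (proj1 (proj2 HF) i Hi))) by auto; lra.
Qed.

Lemma represents_basis_out f F I a n : in_Jdual f -> interval_family F I -> represents f F I a ->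
  (forall i, inF F i -> ~ in_interval (I i) n) -> f (basis n) = 0.
Proof.
  intros Hf HF Hr Hn.
  assert (K := represents_lim f F I a (basis n) (proj1 HF) Hr (inJ_basis n)).
  rewrite (psum_eventually_lim _ _ 0 K); [reflexivity|]; intros j _.
  destruct (inF_dec F j) as [Hj|Hj]; [|rewrite coef_out by auto; ring].
  rewrite (proj2 (Isum_basis n (I j) (proj1 (proj2 HF) j Hj))) by auto; ring.
Qed.

(** The sums of [x] over the disjoint intervals have square sum at most 1; [2 |u v| <= u^2 + v^2]
    then does the work of the Cauchy-Schwarz inequality. *)
Lemma represents_BJdual f F I a : in_Jdual f -> interval_family F I -> represents f F I a ->
  (forall m, psum (sqs (coef_seq F a)) m <= 1) -> BJdual f.
Proof.
  intros Hf HF Hr Ha; split; [auto|]; intros x Hx.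
  assert (K := represents_lim f F I a x (proj1 HF) Hr (proj1 Hx)).
  apply BJ_normle in Hx.
  assert (Hy : forall m, (forall i, (i < m)%nat -> inF F i) ->
    psum (sqs (fun i => Isum x (I i))) m <= 1).
  { intros m Hm.
    assert (HD : forall n a0, (forall i, (i < a0 + n)%nat -> inF F i) ->
      disjoint_family (map I (seq a0 n))).
    { induction n; intros a0 H; [split; constructor|]; simpl.
      destruct (IHn (S a0)) as [H1 H2]; [intros; apply H; lia|].
      split; constructor; auto; [apply (proj1 (proj2 HF)), H; lia|].
      rewrite Forall_forall; intros J HJ; apply in_map_iff in HJ; destruct HJ as [j [<- Hj]].
      apply in_seq in Hj; intros k [K1 K2]; apply imin_le in K2.
      assert (Q := family_lt F I a0 j k HF (H j ltac:(lia)) ltac:(lia) K1); lia. }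
    assert (HS : forall n a0, sumsq x (map I (seq a0 n)) =
      psum (sqs (fun i => Isum x (I i))) (a0 + n) - psum (sqs (fun i => Isum x (I i))) a0).
    { induction n; intros a0; [rewrite Nat.add_0_r; simpl; lra|].
      change (Isum x (I a0) ^ 2 + sumsq x (map I (seq (S a0) n)) =
        psum (sqs (fun i => Isum x (I i))) (a0 + S n) - psum (sqs (fun i => Isum x (I i))) a0).
      rewrite IHn, psum_sqs_S; replace (a0 + S n)%nat with (S a0 + n)%nat by lia; ring. }
    assert (Q := normle_sumsq x 1 _ Hx (HD m 0%nat Hm)); rewrite HS in Q; simpl in Q.
    simpl; lra. }
  assert (Hb : forall m, Rabs (psum (fun i => coef_seq F a i * Isum x (I i)) m) <= 1).
  { assert (Hb0 : forall m, (forall i, (i < m)%nat -> inF F i) ->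
      Rabs (psum (fun i => coef_seq F a i * Isum x (I i)) m) <= 1).
    { intros m Hm; specialize (Hy m Hm); specialize (Ha m).
      assert (2 * Rabs (psum (fun i => coef_seq F a i * Isum x (I i)) m) <=
        psum (sqs (coef_seq F a)) m + psum (sqs (fun i => Isum x (I i))) m); [|lra].
      clear; induction m; [simpl; rewrite Rabs_R0; lra|].
      rewrite psum_S, !psum_sqs_S.
      set (u := coef_seq F a m) in *; set (v := Isum x (I m)) in *.
      assert (Q := Rabs_triang (psum (fun i => coef_seq F a i * Isum x (I i)) m) (u * v)).
      assert (2 * Rabs (u * v) <= u ^ 2 + v ^ 2).
      { rewrite Rabs_mult, <- (pow2_abs u), <- (pow2_abs v).
        assert (0 <= (Rabs u - Rabs v) ^ 2) by apply pow2_ge_0; nra. }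
      lra. }
    intros m; destruct F as [k|]; [|apply Hb0; simpl; auto].
    destruct (Nat.le_gt_cases m k); [apply Hb0; simpl; lia|].
    rewrite (psum_const _ k m) by (try lia; intros; rewrite coef_out by (simpl; lia); ring).
    apply Hb0; simpl; lia. }
  change (Rbar_le (Rabs (f x)) 1).
  apply (is_lim_seq_le (fun m => Rabs (psum (fun i => coef_seq F a i * Isum x (I i)) m)) (fun _ => 1)).
  - exact Hb.
  - apply is_lim_seq_abs in K; exact K.
  - apply is_lim_seq_const.
Qed.

(** The only position in [I i] that carries a nonzero coefficient is [p i], so the sum over [I i] is
    the [i]-th coefficient, and [f] of the spread vector is the sum of the squares. *)
Lemma represents_spread f F I a p : in_Jdual f -> interval_family F I -> represents f F I a ->
  l2unit (coef_seq F a) -> pos_increasing p -> (forall i, inF F i -> in_interval (I i) (p i)) ->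
  f (spread p (coef_seq F a)) = 1.
Proof.
  intros Hf HF Hr Hu Hp HpI; set (al := coef_seq F a) in *.
  assert (HJ : inJ (spread p al)) by (apply (normle_inJ _ 1), normle_spread, Hu).
  assert (K := represents_lim f F I a _ (proj1 HF) Hr HJ); fold al in K.
  assert (HI : forall i, inF F i -> Isum (spread p al) (I i) = al i).
  { intros i Hi.
    assert (L := Isum_trunc_lim _ (I i) (proj1 HJ) (proj1 (proj2 HF) i Hi)).
    apply is_lim_seq_unique in L.
    assert (L' : is_lim_seq (fun n => inc (spread p al) (trunc n (I i))) (al i)).
    { apply is_lim_seq_ext_loc with (fun _ => al i); [|apply is_lim_seq_const].
      exists (S (p i)); intros n Hn; unfold inc; rewrite !psum_spread.
      assert (Hin := HpI i Hi).
      assert (E1 : count p (fst (trunc n (I i))) = i).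
      { assert (A : ~ (i < count p (fst (trunc n (I i))))%nat).
        { rewrite count_spec by auto; destruct (I i); simpl in *; lia. }
        destruct i as [|i]; [lia|].
        assert (Hi' := inF_le _ i _ Hi ltac:(lia)).
        assert (Q := family_lt F I i (S i) (p i) HF Hi ltac:(lia) (HpI i Hi')).
        assert (i < count p (fst (trunc n (I (S i)))))%nat; [|lia].
        rewrite count_spec by auto; destruct (I (S i)); simpl in *; lia. }
      assert (E2 : (S i <= count p (snd (trunc n (I i))))%nat).
      { assert (i < count p (snd (trunc n (I i))))%nat; [|lia].
        rewrite count_spec by auto; destruct (I i); simpl in *; lia. }
      rewrite E1; destruct (inF_dec F (S i)) as [HS|HS].
      - assert (E3 : ~ (S i < count p (snd (trunc n (I i))))%nat).
        { assert (A1 := imin_le _ _ (HpI (S i) HS)).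
          assert (A2 := proj2 (proj2 HF) i HS).
          rewrite count_spec by auto; destruct (I i); simpl in *; [lia|tauto]. }
        replace (count p (snd (trunc n (I i)))) with (S i) by lia.
        rewrite psum_S; ring.
      (* The last interval may contain further positions, with indices outside [F]; their
         coefficients vanish. *)
      - rewrite (psum_const al (S i)).
        + rewrite psum_S; ring.
        + lia.
        + intros k Hk; apply coef_out; intros Hk'; apply HS, (inF_le _ _ _ Hk'); lia. }
    apply is_lim_seq_unique in L'; rewrite L in L'; now injection L'. }
  assert (E : is_lim_seq (psum (sqs al)) (f (spread p al))).
  { apply is_lim_seq_ext with (2 := K); intros n; apply psum_ext; intros i _; unfold sqs.
    destruct (inF_dec F i) as [Hi|Hi]; [rewrite HI by auto; ring|].
    unfold al; rewrite coef_out by auto; ring. }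
  apply is_lim_seq_unique in E; rewrite (is_lim_seq_unique _ _ (proj2 Hu)) in E.
  injection E; auto.
Qed.

(** Indices beyond a finite [F] carry zero coefficients; their positions only have to be increasing.
    They start at [m], so index [k] can be put at a prescribed point. *)
Definition extend (F : option nat) (q : nat -> nat) (m : nat) : nat -> nat :=
  fun j => match F with
           | Some k => if Nat.ltb j k then q j else (m + (j - k))%nat
           | None => q j
           end.

Lemma extend_in F q m j : inF F j -> extend F q m j = q j.
Proof. unfold extend; destruct F; simpl; auto; intros H; now apply Nat.ltb_lt in H as ->. Qed.

Lemma extend_increasing F I q m : interval_family F I ->
  (forall i, inF F i -> in_interval (I i) (q i)) -> (forall i, inF F i -> (q i < m)%nat \/ F = None) ->
  pos_increasing (extend F q m).
Proof.
  intros HF Hq Hm i; destruct (inF_dec F (S i)) as [Hi|Hi].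
  - assert (Hi' := inF_le _ i _ Hi ltac:(lia)); rewrite !extend_in by auto.
    assert (A := family_lt F I i (S i) (q i) HF Hi ltac:(lia) (Hq i Hi')).
    assert (B := imin_le _ _ (Hq _ Hi)); lia.
  - destruct F as [k|]; [|simpl in Hi; tauto]; unfold extend; simpl in Hi.
    destruct (Nat.ltb_spec (S i) k); [lia|]; destruct (Nat.ltb_spec i k); [|lia].
    destruct (Hm i) as [A|A]; [simpl; lia|lia|discriminate].
Qed.

Lemma imin_in I : is_interval I -> in_interval I (imin I).
Proof. destruct I; simpl; lia. Qed.

Lemma represents_extreme f F I a : in_Jdual f -> interval_family F I ->
  (forall i, inF F i -> a i <> 0) -> represents f F I a -> extreme_BJ (coef_seq F a) ->
  union_is_interval F I -> extreme_BJdual f.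
Proof.
  intros Hf HF Hnz Hr Hext HU.
  assert (Hu : l2unit (coef_seq F a)).
  { split; [apply BJ_normle, Hext|now apply extreme_BJ_l2]. }
  split; [apply (represents_BJdual f F I a); auto; intros; apply sqs_psum_le1, Hu|].
  intros g h t Hg Hh Ht E.
  assert (HB : forall n, f (basis n) = t * g (basis n) + (1 - t) * h (basis n))
    by (intros n; apply E, inJ_basis).
  apply eqJ_basis; [apply Hg|apply Hh|]; intros n.
  assert (H0 : inF F 0) by (destruct F; simpl in *; auto; apply HF).
  pose (q := fun i => imin (I i)).
  assert (Hq : forall i, inF F i -> in_interval (I i) (q i))
    by (intros i Hi; apply imin_in, (proj1 (proj2 HF)), Hi).
  assert (Hmax : forall q' : nat -> nat, exists m, forall i, inF F i -> (q' i < m)%nat \/ F = None).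
  { intros q'; destruct F as [k|]; [|exists O; auto].
    assert (L : exists m, forall i, (i < k)%nat -> (q' i < m)%nat).
    { clear; induction k as [|k [m IH]]; [exists O; lia|].
      exists (S (Nat.max m (q' k))); intros i Hi.
      destruct (Nat.eq_dec i k) as [->|]; [lia|]; specialize (IH i ltac:(lia)); lia. }
    destruct L as [m Hm]; exists m; auto. }
  destruct (excluded_middle_informative (exists i, inF F i /\ in_interval (I i) n)) as [[i [Hi Hn]]|Hno].
  (* With [n] itself as the position in [I i], [basis n] is the spread of [basis i]. *)
  - pose (qn := fun j => if Nat.eqb j i then n else q j).
    assert (Hqn : forall j, inF F j -> in_interval (I j) (qn j)).
    { intros j Hj; unfold qn; destruct (Nat.eqb_spec j i) as [->|]; auto. }
    destruct (Hmax qn) as [m Hm]; pose (p := extend F qn m).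
    assert (Hp : pos_increasing p) by (apply (extend_increasing F I); auto).
    assert (HpI : forall j, inF F j -> in_interval (I j) (p j)).
    { intros j Hj; unfold p; rewrite extend_in; auto. }
    assert (Epi : p i = n).
    { unfold p; rewrite extend_in by auto; unfold qn; now rewrite Nat.eqb_refl. }
    assert (Hf1 := represents_spread f F I a p Hf HF Hr Hu Hp HpI).
    rewrite <- Epi, <- spread_basis by auto.
    apply (pair_basis_eq (coef_seq F a) (fun x => g (spread p x)) (fun x => h (spread p x)) t i);
      auto using BJdual_spread.
    + rewrite <- (E (spread p (coef_seq F a))); [exact Hf1|].
      apply (normle_inJ _ 1), normle_spread, Hu.
    + intros j Hj; rewrite coef_in by (apply (inF_le _ _ _ Hi Hj)).
      apply Hnz, (inF_le _ _ _ Hi Hj).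
    + intros j Hj; assert (Hj' := inF_le _ _ _ Hi Hj).
      rewrite !spread_basis by auto; rewrite <- HB, coef_in by auto.
      apply (represents_basis f F I a); auto.
  - assert (Hfn : f (basis n) = 0).
    { apply (represents_basis_out f F I a); auto; intros i Hi Hn; apply Hno; eauto. }
    (* A point outside an interval has all of it on one side. *)
    assert (Hside : (forall i k, inF F i -> in_interval (I i) k -> (n < k)%nat) \/
      (forall i k, inF F i -> in_interval (I i) k -> (k < n)%nat)).
    { destruct HU as [J [HJ HU]].
      assert (HnJ : ~ in_interval J n) by (rewrite HU; auto).
      assert (HK : forall i k, inF F i -> in_interval (I i) k -> in_interval J k)
        by (intros i k Hi Hk; apply HU; eauto).
      destruct J as [lo hi|lo]; simpl in HnJ.
      - destruct (Nat.lt_ge_cases n lo); [left|right]; intros i k Hi Hk;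
          specialize (HK i k Hi Hk); simpl in HK; lia.
      - left; intros i k Hi Hk; specialize (HK i k Hi Hk); simpl in HK; lia. }
    destruct Hside as [Hside|Hside].
    + destruct (Hmax q) as [m Hm]; pose (p := extend F q m).
      assert (Hp : pos_increasing p) by (apply (extend_increasing F I); auto).
      assert (HpI : forall j, inF F j -> in_interval (I j) (p j)).
      { intros j Hj; unfold p; rewrite extend_in; auto. }
      assert (Hf1 := represents_spread f F I a p Hf HF Hr Hu Hp HpI).
      assert (Hnp : (n < p 0)%nat) by (apply (Hside 0%nat); auto).
      (* The point [n] becomes a new first position with coefficient zero; the spread vector itself
         does not change. *)
      pose (p' := fun j => match j with O => n | S j => p j end).
      assert (Hp' : pos_increasing p') by (intros [|j]; simpl; auto).
      assert (Esp : spread p' (cons0 (coef_seq F a)) = spread p (coef_seq F a)).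
      { apply functional_extensionality; intros k.
        destruct (excluded_middle_informative (exists j, p j = k)) as [[j <-]|Hk].
        - rewrite spread_at by auto.
          change (p j) with (p' (S j)); now rewrite spread_at.
        - rewrite (spread_off p) by (intros j Hj; apply Hk; eauto).
          destruct (Nat.eq_dec k n) as [->|Hkn].
          + change n with (p' 0%nat); now rewrite spread_at.
          + apply spread_off; intros [|j] Hj; simpl in Hj; [auto|apply Hk; eauto]. }
      change n with (p' 0%nat); rewrite <- spread_basis by auto.
      apply (pair_good_basis (cons0 (coef_seq F a)) (fun x => g (spread p' x))
        (fun x => h (spread p' x)) t 0 (cons0 (coef_seq F a) 1%nat));
        auto using BJdual_spread, l2unit_cons0.
      * rewrite Esp; rewrite <- (E (spread p (coef_seq F a))); [exact Hf1|].
        apply (normle_inJ _ 1), normle_spread, Hu.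
      * apply good_left; auto using l2unit_cons0; simpl; rewrite coef_in; auto.
      * rewrite spread_basis by auto; rewrite <- HB; exact Hfn.
    + destruct F as [k|].
      (* Infinitely many intervals leave no room on their right, since [q n >= n]. *)
      2:{ specialize (Hside n (q n) Logic.I (Hq n Logic.I)).
          assert (Hp : pos_increasing q).
          { intros i; assert (A := family_lt None I i (S i) (q i) HF Logic.I ltac:(lia) (Hq i Logic.I)).
            exact A. }
          assert (A := increasing_ge q n Hp); lia. }
      pose (p := extend (Some k) q n).
      assert (Hp : pos_increasing p).
      { apply (extend_increasing _ I); auto; intros i Hi; left; apply (Hside i); auto. }
      assert (HpI : forall j, inF (Some k) j -> in_interval (I j) (p j)).
      { intros j Hj; unfold p; rewrite extend_in; auto. }
      assert (Hk : (1 <= k)%nat) by apply HF.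
      assert (Epk : p k = n).
      { unfold p, extend; destruct (Nat.ltb_spec k k); lia. }
      assert (Hf1 := represents_spread f _ I a p Hf HF Hr Hu Hp HpI).
      rewrite <- Epk, <- spread_basis by auto.
      assert (Hck : coef_seq (Some k) a k = 0) by (apply coef_out; simpl; lia).
      apply (pair_good_basis (coef_seq (Some k) a) (fun x => g (spread p x))
        (fun x => h (spread p x)) t k (coef_seq (Some k) a (pred k))); auto using BJdual_spread.
      * rewrite <- (E (spread p (coef_seq (Some k) a))); [exact Hf1|].
        apply (normle_inJ _ 1), normle_spread, Hu.
      * assert (G := good_right (coef_seq (Some k) a) (pred k) Hu).
        replace (S (pred k)) with k in G by lia; apply G.
        -- rewrite coef_in by (simpl; lia); apply Hnz; simpl; lia.
        -- intros j Hj; apply coef_out; simpl; lia.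
      * rewrite spread_basis, Epk by auto; rewrite <- HB; exact Hfn.
Qed.

(** * A Hahn-Banach extension theorem for bounded functions *)

Definition bounded_on (T : Type) (C : T -> Prop) (u : T -> R) : Prop :=
  exists M, forall k, C k -> Rabs (u k) <= M.

(** Partial linear functionals are kept as graphs, which are easily joined along a chain; together
    with [dom_graph], linearity forces single values. *)
Definition lin_graph (T : Type) (G : (T -> R) -> R -> Prop) : Prop :=
  G (fun _ => 0) 0 /\
  forall u v r s a b, G u r -> G v s -> G (fun k => a * u k + b * v k) (a * r + b * s).

(** Domination by the sublinear functional [sup] over [C]. *)
Definition dom_graph (T : Type) (C : T -> Prop) (G : (T -> R) -> R -> Prop) : Prop :=
  forall u r c, G u r -> (forall k, C k -> u k <= c) -> r <= c.

Lemma graph_extend (T : Type) (C : T -> Prop) (G : (T -> R) -> R -> Prop) w :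
  lin_graph T G -> dom_graph T C G -> bounded_on T C w ->
  exists m, dom_graph T C (fun u r => exists u' r' s, G u' r' /\
    u = (fun k => u' k + s * w k) /\ r = r' + s * m).
Proof.
  intros [G0 GL] GD [M HM].
  (* The value [m] at [w] must lie above all of [E], for negative multiples of [w], and below every
     [c1 - r1], for positive ones; [Hup] shows the two demands compatible. *)
  pose (E := fun r => exists u r0 c, G u r0 /\ (forall k, C k -> u k - w k <= c) /\ r = r0 - c).
  assert (Hup : forall u1 r1 c1, G u1 r1 -> (forall k, C k -> u1 k + w k <= c1) ->
    is_upper_bound E (c1 - r1)).
  { intros u1 r1 c1 H1 Hc1 r [u [r0 [c [H [Hc ->]]]]].
    assert (K : 1 * r0 + 1 * r1 <= c + c1).
    { apply (GD _ _ _ (GL _ _ _ _ 1 1 H H1)).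
      intros k Hk; specialize (Hc k Hk); specialize (Hc1 k Hk); lra. }
    lra. }
  destruct (completeness E) as [m [Hm1 Hm2]].
  - exists (M - 0); apply (Hup (fun _ => 0)); auto.
    intros k Hk; specialize (HM k Hk); apply Rabs_le_between in HM; lra.
  - exists (0 - M), (fun _ => 0), 0, M; repeat split; auto.
    intros k Hk; specialize (HM k Hk); apply Rabs_le_between in HM; lra.
  - exists m; intros u r c [u' [r' [s [HG [-> ->]]]]] Hc.
    destruct (Rtotal_order s 0) as [Hs|[->|Hs]].
    + assert (Hi : 0 < / - s) by (apply Rinv_0_lt_compat; lra).
      assert (K : / - s * r' + 0 * r' - / - s * c <= m).
      { apply Hm1; exists (fun k => / - s * u' k + 0 * u' k), (/ - s * r' + 0 * r'), (/ - s * c).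
        split; [apply GL; auto|split; [|ring]]; intros k Hk; specialize (Hc k Hk); cbv beta in Hc.
        replace (/ - s * u' k + 0 * u' k - w k) with (/ - s * (u' k + s * w k)) by (field; lra).
        apply Rmult_le_compat_l; lra. }
      apply (Rmult_le_compat_l (- s)) in K; [|lra].
      replace (- s * (/ - s * r' + 0 * r' - / - s * c)) with (r' - c) in K by (field; lra). lra.
    + rewrite Rmult_0_l, Rplus_0_r; apply (GD u'); auto.
      intros k Hk; specialize (Hc k Hk); cbv beta in Hc; lra.
    + assert (Hi : 0 < / s) by (apply Rinv_0_lt_compat; lra).
      assert (K : m <= / s * c - (/ s * r' + 0 * r')).
      { apply Hm2, (Hup (fun k => / s * u' k + 0 * u' k)); [apply GL; auto|].
        intros k Hk; specialize (Hc k Hk); cbv beta in Hc.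
        replace (/ s * u' k + 0 * u' k + w k) with (/ s * (u' k + s * w k)) by (field; lra).
        apply Rmult_le_compat_l; lra. }
      apply (Rmult_le_compat_l s) in K; [|lra].
      replace (s * (/ s * c - (/ s * r' + 0 * r'))) with (c - r') in K by (field; lra). lra.
Qed.

Lemma hahn_banach_bounded (T : Type) (C : T -> Prop) (G : (T -> R) -> R -> Prop) :
  lin_graph T G -> dom_graph T C G ->
  exists Phi : (T -> R) -> R,
    (forall u v a b, bounded_on T C u -> bounded_on T C v ->
       Phi (fun k => a * u k + b * v k) = a * Phi u + b * Phi v) /\
    (forall u c, bounded_on T C u -> (forall k, C k -> u k <= c) -> Phi u <= c) /\
    (forall u r, G u r -> bounded_on T C u -> Phi u = r).
Proof.
  intros GL GD.
  (* The sets under Zorn's lemma hold the added pairs only; joining [G] afterwards makes the union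
     of the empty chain admissible. *)
  pose (ext := fun (A : (T -> R) * R -> Prop) u r => A (u, r) \/ G u r).
  pose (P := fun A => lin_graph T (ext A) /\ dom_graph T C (ext A)).
  destruct (@classical_sets.Zorn_bigcup ((T -> R) * R)%type P) as [A [[AL AD] Amax]].
  { intros F FP Ftot; split; [split|].
    - right; apply GL.
    - intros u v r s a b Hu Hv.
      assert (Hcases : (exists X, F X /\ ext X u r /\ ext X v s) \/ (G u r /\ G v s)).
      { destruct Hu as [[X FX Hu]|Hu], Hv as [[Y FY Hv]|Hv].
        - destruct (Ftot X Y FX FY) as [XY|YX]; left.
          + exists Y; repeat split; auto; left; auto.
          + exists X; repeat split; auto; left; auto.
        - left; exists X; repeat split; auto; [left|right]; auto.
        - left; exists Y; repeat split; auto; [right|left]; auto.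
        - right; auto. }
      destruct Hcases as [[X [FX [HuX HvX]]]|[Hu' Hv']].
      + destruct (proj2 (proj1 (FP X FX)) u v r s a b HuX HvX) as [H|H];
          [left; exists X; auto|right; auto].
      + right; apply GL; auto.
    - intros u r c [[X FX Hu]|Hu] Hc; [|apply (GD u); auto].
      apply (proj2 (FP X FX) u); [left|]; auto. }
  assert (Htot : forall w, bounded_on T C w -> exists m, ext A w m).
  { intros w Hw; destruct (graph_extend T C (ext A) w AL AD Hw) as [m Hm].
    apply NNPP; intros Hn.
    pose (A' := fun q : (T -> R) * R => exists u' r' s, ext A u' r' /\
      fst q = (fun k => u' k + s * w k) /\ snd q = r' + s * m).
    assert (HA' : forall u r, ext A u r -> A' (u, r)).
    { intros u r H; exists u, r, 0; split; [auto|split; simpl; [|ring]].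
      apply functional_extensionality; intros; ring. }
    assert (HAw : A' (w, m)).
    { exists (fun _ => 0), 0, 1; split; [apply AL|split; simpl; [|ring]].
      apply functional_extensionality; intros; ring. }
    assert (Hext : forall u r, ext A' u r -> A' (u, r)).
    { intros u r [H|H]; auto; apply HA'; right; auto. }
    refine (Amax A' _ _).
    - split.
      + intros [u r] H; apply HA'; left; auto.
      + intros HS; apply Hn; exists m; left; apply HS; auto.
    - split; [split|].
      + right; apply GL.
      + intros u v r s a b Hu Hv; apply Hext in Hu; apply Hext in Hv.
        destruct Hu as [u' [r' [t [H1 [H2 H3]]]]], Hv as [v' [s' [t' [H4 [H5 H6]]]]].
        simpl in *; subst; left.
        exists (fun k => a * u' k + b * v' k), (a * r' + b * s'), (a * t + b * t').
        split; [apply AL; auto|split; simpl; [|ring]].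
        apply functional_extensionality; intros; ring.
      + intros u r c Hu; apply Hext in Hu; apply Hm; exact Hu. }
  pose (Phi := fun u => epsilon (inhabits 0) (fun m => ext A u m)).
  assert (HPhi : forall u, bounded_on T C u -> ext A u (Phi u)).
  { intros u Hu; apply epsilon_spec; auto. }
  assert (Huniq : forall u r s, ext A u r -> ext A u s -> r = s).
  { intros u r s H1 H2.
    assert (K1 := AD _ _ 0 (proj2 AL _ _ _ _ 1 (-1) H1 H2) ltac:(intros; simpl; lra)).
    assert (K2 := AD _ _ 0 (proj2 AL _ _ _ _ (-1) 1 H1 H2) ltac:(intros; simpl; lra)).
    lra. }
  exists Phi; split; [|split].
  - intros u v a b Hu Hv; apply (Huniq (fun k => a * u k + b * v k)).
    + apply HPhi; destruct Hu as [M HM], Hv as [M' HM'].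
      exists (Rabs a * M + Rabs b * M'); intros k Hk.
      apply Rle_trans with (1 := Rabs_triang _ _); rewrite !Rabs_mult.
      apply Rplus_le_compat; apply Rmult_le_compat_l; auto using Rabs_pos.
    + apply AL; auto.
  - intros u c Hu Hc; apply (AD u); auto.
  - intros u r H Hu; apply (Huniq u); auto; right; auto.
Qed.

(** * The extreme point is dominated by small sets of step functionals *)

Definition step := list ((nat * nat) * R).

Definition ev (k : step) (x : seqR) : R :=
  fold_right (fun q acc => snd q * inc x (fst q) + acc) 0 k.

Definition cost (k : step) : R := fold_right (fun q acc => snd q ^ 2 + acc) 0 k.

Definition unit_step (k : step) : Prop := segfam (map fst k) /\ cost k <= 1.

(** For [f] in the dual this is, by Hahn-Banach, membership in the weak-star closed convex hull of
    the functionals [ev k] with [C k]. *)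
Definition dominated (C : step -> Prop) (f : seqR -> R) : Prop :=
  forall x c, inJ x -> (forall k, C k -> ev k x <= c) -> f x <= c.

Lemma ev_cons q k x : ev (q :: k) x = snd q * inc x (fst q) + ev k x.
Proof. reflexivity. Qed.

Lemma cost_cons q k : cost (q :: k) = snd q ^ 2 + cost k.
Proof. reflexivity. Qed.

Lemma ev_lin k x y a b : ev k (fun n => a * x n + b * y n) = a * ev k x + b * ev k y.
Proof.
  induction k as [|q k IH]; simpl; [lra|]; rewrite IH; unfold inc; rewrite !psum_lin; lra.
Qed.

Lemma ev_le_cost k x th : 0 < th ->
  2 * Rabs (ev k x) <= th * cost k + / th * sqinc x (map fst k).
Proof.
  intros Hth; induction k as [|q k IH]; simpl map; simpl ev; simpl cost.
  - rewrite Rabs_R0; simpl; lra.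
  - rewrite sqinc_cons; fold (ev k x); fold (cost k); set (u := inc x (fst q)).
    assert (H := Rabs_triang (snd q * u) (ev k x)).
    assert (K : 2 * Rabs (snd q * u) <= th * snd q ^ 2 + / th * u ^ 2).
    { rewrite Rabs_mult, <- (pow2_abs (snd q)), <- (pow2_abs u).
      set (s := Rabs (snd q)); set (v := Rabs u).
      assert (0 <= / th * (th * s - v) ^ 2).
      { apply Rmult_le_pos; [left; now apply Rinv_0_lt_compat|apply pow2_ge_0]. }
      replace (/ th * (th * s - v) ^ 2) with (th * s ^ 2 - 2 * (s * v) + / th * v ^ 2) in H0
        by (field; lra).
      lra. }
    simpl in *; lra.
Qed.

Lemma ev_normle k x c : unit_step k -> normle x c -> Rabs (ev k x) <= c.
Proof.
  intros [H1 H2] Hx.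
  assert (K : forall d, 0 < d -> normle x d -> Rabs (ev k x) <= d).
  { intros d Hd [_ H]; assert (E := ev_le_cost k x d Hd); specialize (H _ H1).
    assert (/ d * sqinc x (map fst k) <= d).
    { apply Rmult_le_reg_l with d; [auto|]; rewrite <- Rmult_assoc, Rinv_r by lra; lra. }
    assert (d * cost k <= d * 1) by (apply Rmult_le_compat_l; lra). lra. }
  apply Rnot_lt_le; intros Hlt; assert (Hc := proj1 Hx).
  assert (Rabs (ev k x) <= (c + Rabs (ev k x)) / 2); [|lra].
  apply K; [lra|]; apply normle_le with (1 := Hx); lra.
Qed.

(** For a family [L], coefficients proportional to the increments of [x] give a step functional of
    cost 1 whose value at [x] is [sqrt (sqinc x L)]. A bound on all unit step functionals is
    therefore a bound on the norm of [x]. *)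
Lemma dominated_all f : BJdual f -> dominated unit_step f.
Proof.
  intros Hf x c Hx Hc.
  assert (Hc0 : 0 <= c).
  { apply (Hc nil); split; [apply segfam_nil|simpl; lra]. }
  apply Rle_trans with (1 := Rle_abs _), BJdual_normle; auto; split; auto; intros L HL.
  destruct (Rle_lt_or_eq_dec 0 _ (sqinc_ge0 x L)) as [Hs|Hs]; [|rewrite <- Hs; apply pow2_ge_0].
  set (s := sqrt (sqinc x L)); assert (Hs' : 0 < s) by now apply sqrt_lt_R0.
  assert (Hss : s ^ 2 = sqinc x L) by (unfold s; rewrite pow2_sqrt; lra).
  clearbody s.
  pose (k := map (fun p => (p, / s * inc x p)) L).
  assert (Hk : map fst k = L) by (unfold k; rewrite map_map; apply map_id).
  assert (Hcost : cost k = / s ^ 2 * sqinc x L).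
  { unfold k; clear; induction L as [|p L IH]; simpl map; [simpl; lra|].
    rewrite sqinc_cons, cost_cons, IH; unfold snd; rewrite Rpow_mult_distr, pow_inv; ring. }
  assert (Hev : ev k x = / s * sqinc x L).
  { unfold k; clear; induction L as [|p L IH]; simpl map; [simpl; lra|].
    rewrite sqinc_cons, ev_cons, IH; simpl fst; simpl snd; ring. }
  assert (K : ev k x <= c).
  { apply Hc; split; [rewrite Hk; auto|]; rewrite Hcost, <- Hss; right; field; lra. }
  rewrite Hev, <- Hss in K; rewrite <- Hss; apply pow_incr; split; [lra|].
  replace s with (/ s * s ^ 2) by (field; lra); auto.
Qed.

(* A finitely additive Milman theorem: extending [f] to all bounded functions on [C] gives a mean
   [Phi]; restricting the mean to [A] and to its complement writes [f] as a convex combination. *)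
Lemma dominated_split f (C A : step -> Prop) : extreme_BJdual f ->
  (forall k, C k -> unit_step k) -> dominated C f ->
  dominated (fun k => C k /\ A k) f \/ dominated (fun k => C k /\ ~ A k) f.
Proof.
  intros [Hf Hext] HC Hdom.
  assert (Hlin : lin_on_J f) by exact (proj1 (proj1 Hf)).
  (* Constants are included with their own value, so the extension [Phi] has total mass 1. *)
  pose (G := fun (u : step -> R) r => exists x c, inJ x /\
    u = (fun k => ev k x + c) /\ r = f x + c).
  destruct (hahn_banach_bounded step C G) as [Phi [PL [PD PG]]].
  { split.
    - exists (fun _ => 0), 0; split; [apply (normle_inJ _ 0), normle_zero; lra|].
      split; [|rewrite lin_zero by auto; ring].
      apply functional_extensionality; intros k.
      replace (fun _ : nat => 0) with (fun _ : nat => 0 * 0 + 0 * 0)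
        by (apply functional_extensionality; intros; ring).
      rewrite (ev_lin k (fun _ => 0) (fun _ => 0)); ring.
    - intros u v r s a b [x [c [Hx [-> ->]]]] [y [d [Hy [-> ->]]]].
      exists (fun n => a * x n + b * y n), (a * c + b * d); split; [now apply inJ_lin|].
      split; [|rewrite Hlin by auto; ring].
      apply functional_extensionality; intros k; rewrite ev_lin; ring. }
  { intros u r c [x [d [Hx [-> ->]]]] Hc.
    assert (f x <= c - d); [|lra]; apply Hdom; auto; intros k Hk; specialize (Hc k Hk); simpl in Hc; lra. }
  pose (chi := fun (B : step -> Prop) k => if excluded_middle_informative (B k) then 1 else 0).
  assert (Bev : forall B x c, inJ x -> bounded_on step C (fun k => chi B k * (ev k x + c))).
  { intros B x c Hx; exists (real (Jnorm x) + Rabs c); intros k Hk.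
    assert (H1 := ev_normle k x _ (HC k Hk) (inJ_normle x Hx)).
    assert (H2 := Rabs_triang (ev k x) c); assert (H3 := Rabs_pos (ev k x + c)).
    unfold chi; destruct (excluded_middle_informative (B k)); rewrite Rabs_mult;
      [rewrite Rabs_R1|rewrite Rabs_R0]; lra. }
  assert (J0 : inJ (fun _ => 0)) by (apply (normle_inJ _ 0), normle_zero; lra).
  (* [W B] is the part of [f] carried by [B], and [lam B] is its mass. The idle [+ 0] and
     [ev k (fun _ => 0)] give both the shape covered by [Bev]. *)
  pose (W := fun B x => Phi (fun k => chi B k * (ev k x + 0))).
  pose (lam := fun B => Phi (fun k => chi B k * (ev k (fun _ => 0) + 1))).
  assert (ev0 : forall k, ev k (fun _ => 0) = 0).
  { intros k; induction k as [|q k IH]; [reflexivity|]; rewrite ev_cons, IH.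
    unfold inc; rewrite !psum_0 by auto; ring. }
  assert (WL : forall B, lin_on_J (W B)).
  { intros B x y a b Hx Hy; unfold W; rewrite <- PL by (apply Bev; auto).
    f_equal; apply functional_extensionality; intros k; rewrite ev_lin; ring. }
  assert (WD : forall B x c, inJ x -> (forall k, C k /\ B k -> ev k x <= c) -> W B x <= c * lam B).
  { intros B x c Hx Hc; unfold W, lam.
    assert (K : Phi (fun k => 1 * (chi B k * (ev k x + 0)) +
      (- c) * (chi B k * (ev k (fun _ => 0) + 1))) <= 0).
    { apply PD.
      - destruct (Bev B x (- c) Hx) as [M HM]; exists M; intros k Hk; specialize (HM k Hk).
        rewrite ev0; replace (1 * (chi B k * (ev k x + 0)) + - c * (chi B k * (0 + 1)))
          with (chi B k * (ev k x + - c)) by ring; auto.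
      - intros k Hk; rewrite ev0; unfold chi; destruct (excluded_middle_informative (B k)); [|lra].
        specialize (Hc k (conj Hk b)); lra. }
    rewrite PL in K by (apply Bev; auto); lra. }
  assert (WC : forall x, inJ x -> W A x + W (fun k => ~ A k) x = f x).
  { intros x Hx; unfold W.
    rewrite <- (PG (fun k => 1 * (chi A k * (ev k x + 0)) + 1 * (chi (fun k => ~ A k) k * (ev k x + 0)))
      (f x)).
    - rewrite PL by (apply Bev; auto); ring.
    - exists x, 0; split; [auto|split; [|ring]]; apply functional_extensionality; intros k.
      unfold chi; destruct (excluded_middle_informative (A k)), (excluded_middle_informative (~ A k));
        try tauto; ring.
    - destruct (Bev (fun _ => True) x 0 Hx) as [M HM]; exists M; intros k Hk; specialize (HM k Hk).
      revert HM; unfold chi.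
      destruct (excluded_middle_informative True); [|tauto].
      destruct (excluded_middle_informative (A k)), (excluded_middle_informative (~ A k)); try tauto;
        intros HM; [replace (1 * (1 * (ev k x + 0)) + 1 * (0 * (ev k x + 0))) with (1 * (ev k x + 0)) by ring
        |replace (1 * (0 * (ev k x + 0)) + 1 * (1 * (ev k x + 0))) with (1 * (ev k x + 0)) by ring]; auto. }
  assert (lam0 : forall B, 0 <= lam B).
  { intros B; unfold lam.
    assert (K : Phi (fun k => (-1) * (chi B k * (ev k (fun _ => 0) + 1)) +
      0 * (chi B k * (ev k (fun _ => 0) + 1))) <= 0).
    { apply PD.
      - destruct (Bev B (fun _ => 0) 1 J0) as [M HM]; exists M; intros k Hk; specialize (HM k Hk).
        rewrite <- Rabs_Ropp in HM.
        replace (-1 * (chi B k * (ev k (fun _ => 0) + 1)) + 0 * (chi B k * (ev k (fun _ => 0) + 1)))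
          with (- (chi B k * (ev k (fun _ => 0) + 1))) by ring; auto.
      - intros k Hk; rewrite ev0; unfold chi; destruct (excluded_middle_informative (B k)); lra. }
    rewrite PL in K by (apply Bev; auto); lra. }
  assert (lam1 : lam A + lam (fun k => ~ A k) = 1).
  { unfold lam.
    transitivity (Phi (fun k => 1 * (chi A k * (ev k (fun _ => 0) + 1)) +
      1 * (chi (fun k => ~ A k) k * (ev k (fun _ => 0) + 1)))); [|apply PG].
    - rewrite PL by (apply Bev; auto); ring.
    - exists (fun _ => 0), 1; split; [auto|split; [|rewrite lin_zero by auto; ring]].
      apply functional_extensionality; intros k.
      unfold chi; destruct (excluded_middle_informative (A k)), (excluded_middle_informative (~ A k));
        try tauto; ring.
    - exists 1; intros k Hk; rewrite ev0; unfold chi.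
      destruct (excluded_middle_informative (A k)), (excluded_middle_informative (~ A k)); try tauto;
        rewrite Rabs_right; lra. }
  assert (W0 : forall B, lam B = 0 -> forall x, inJ x -> W B x = 0).
  { intros B HB.
    assert (Hle : forall x, inJ x -> W B x <= 0).
    { intros x Hx; assert (K : W B x <= real (Jnorm x) * lam B); [|rewrite HB in K; lra].
      apply WD; auto; intros k [Hk _].
      apply Rle_trans with (1 := Rle_abs _), ev_normle; auto using inJ_normle. }
    intros x Hx; assert (K1 := Hle x Hx); assert (K2 := Hle _ (inJ_lin x x (-1) 0 Hx Hx)).
    rewrite WL in K2 by auto; lra. }
  assert (Hhalf : forall B B', (forall x, inJ x -> W B x + W B' x = f x) -> lam B' = 0 ->
    lam B = 1 -> dominated (fun k => C k /\ B k) f).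
  { intros B B' Hs H0 H1 x c Hx Hc; rewrite <- Hs, (W0 B'), Rplus_0_r by auto.
    rewrite <- (Rmult_1_r c), <- H1; auto. }
  assert (lA := lam0 A); assert (lA' := lam0 (fun k => ~ A k)).
  destruct (Req_dec (lam A) 0) as [E|E].
  { right; apply (Hhalf _ A); auto; [|lra]; intros x Hx; rewrite <- WC by auto; ring. }
  destruct (Req_dec (lam (fun k => ~ A k)) 0) as [E'|E'].
  { left; apply (Hhalf _ (fun k => ~ A k)); auto; lra. }
  (* With both masses positive, extremality makes the two normalised parts equal, hence equal to
     [f]; either alternative could be proved. *)
  left.
  assert (HB : forall B, 0 < lam B -> BJdual (fun x => / lam B * W B x)).
  { intros B HB; apply BJdual_intro.
    - intros x y a b Hx Hy; rewrite WL by auto; ring.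
    - assert (Hle : forall x c, normle x c -> W B x <= c * lam B).
      { intros x c Hx; apply WD; [apply (normle_inJ x c Hx)|]; intros k [Hk _].
        apply Rle_trans with (1 := Rle_abs _), ev_normle; auto. }
      intros x c Hx; assert (K1 := Hle x c Hx).
      assert (Hx' : normle (fun n => -1 * x n) c).
      { replace c with (Rabs (-1) * c) by (rewrite Rabs_left by lra; ring); now apply normle_scal. }
      assert (K2 := Hle _ c Hx').
      assert (HJ := proj1 (normle_inJ x c Hx)).
      replace (fun n => -1 * x n) with (fun n => -1 * x n + 0 * x n) in K2
        by (apply functional_extensionality; intros; ring).
      rewrite WL in K2 by auto.
      apply Rabs_le; split; apply Rmult_le_reg_l with (lam B); auto;
        rewrite <- ?Rmult_assoc, Rinv_r by lra; lra. }
  assert (Heq : eqJ (fun x => / lam A * W A x)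
    (fun x => / lam (fun k => ~ A k) * W (fun k => ~ A k) x)).
  { apply (Hext _ _ (lam A)); [apply HB; lra|apply HB; lra|lra|].
    intros x Hx; replace (1 - lam A) with (lam (fun k => ~ A k)) by lra.
    rewrite <- WC by auto; field; auto. }
  intros x c Hx Hc; assert (K := WD A x c Hx Hc).
  specialize (Heq x Hx); simpl in Heq.
  assert (Ef : f x = / lam A * W A x).
  { rewrite <- WC by auto.
    replace (W (fun k => ~ A k) x) with
      (lam (fun k => ~ A k) * (/ lam (fun k => ~ A k) * W (fun k => ~ A k) x)) by (field; auto).
    rewrite <- Heq; replace (lam (fun k => ~ A k)) with (1 - lam A) by lra; field; auto. }
  rewrite Ef; apply Rmult_le_reg_l with (lam A); [lra|].
  rewrite <- Rmult_assoc, Rinv_r by auto; lra.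
Qed.

(** * Coefficient sequences of functionals *)

(** The default 0 before position 0 means that leading zeros do not count as a run. *)
Definition prev (x : seqR) (j : nat) : R := match j with O => 0 | S i => x i end.

Definition brk (x : seqR) (j : nat) : Prop := x j <> prev x j.

(* Supported on the first indices of the runs of constancy of [x]. *)
Definition runval (x : seqR) : seqR := fun j => if Req_dec_T (x j) (prev x j) then 0 else x j.
Definition runsq (x : seqR) : seqR := fun j => if Req_dec_T (x j) (prev x j) then 0 else x j ^ 2.

(** Not a convex condition: [(1, 0, 0, ...)] and [(1, 1, 0, ...)] satisfy it, their midpoint does
    not. Every competitor built below has to be checked against it separately. *)
Definition runs_le1 (x : seqR) : Prop := forall N, psum (runsq x) N <= 1.

Definition coefs (f : seqR -> R) : seqR := fun n => f (basis n).

Lemma runsq_ge0 x j : 0 <= runsq x j.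
Proof. unfold runsq; destruct (Req_dec_T _ _); [lra|apply pow2_ge_0]. Qed.

Lemma runsq_brk x j : brk x j -> runsq x j = x j ^ 2.
Proof. unfold brk, runsq; destruct (Req_dec_T _ _); tauto. Qed.

Lemma runsq_nobrk x j : ~ brk x j -> runsq x j = 0.
Proof. unfold brk, runsq; destruct (Req_dec_T _ _); tauto. Qed.

Lemma runsq_le x j : runsq x j <= x j ^ 2.
Proof. unfold runsq; destruct (Req_dec_T _ _); [apply pow2_ge_0|lra]. Qed.

Lemma runval_brk x j : brk x j -> runval x j = x j.
Proof. unfold brk, runval; destruct (Req_dec_T _ _); tauto. Qed.

Lemma runval_nobrk x j : ~ brk x j -> runval x j = 0.
Proof. unfold brk, runval; destruct (Req_dec_T _ _); tauto. Qed.

Lemma nobrk_eq x j : ~ brk x j -> x j = prev x j.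
Proof. unfold brk; destruct (Req_dec_T (x j) (prev x j)); tauto. Qed.

Lemma brk_dec x j : brk x j \/ ~ brk x j.
Proof. unfold brk; destruct (Req_dec_T (x j) (prev x j)); tauto. Qed.

Lemma inc_basis j p : (fst p < snd p)%nat ->
  inc (basis j) p = if (Nat.leb (fst p) j && Nat.ltb j (snd p))%bool then 1 else 0.
Proof.
  intros H; unfold inc; rewrite !psum_basis.
  destruct (Nat.ltb_spec j (snd p)), (Nat.ltb_spec j (fst p)), (Nat.leb_spec (fst p) j);
    simpl; try lia; lra.
Qed.

Lemma ev_basis_out k j : segfam (map fst k) ->
  (forall q, In q k -> (snd (fst q) <= j \/ j < fst (fst q))%nat) -> ev k (basis j) = 0.
Proof.
  induction k as [|q k IH]; intros HF H; [reflexivity|]; rewrite ev_cons.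
  simpl in HF; apply segfam_cons in HF; destruct HF as [A [B C]].
  rewrite IH by (auto; intros; apply H; now right).
  specialize (H q (or_introl eq_refl)); rewrite inc_basis by auto.
  destruct (Nat.leb_spec (fst (fst q)) j), (Nat.ltb_spec j (snd (fst q))); simpl; try lia; lra.
Qed.

Lemma ev_basis_in k q j : segfam (map fst k) -> In q k ->
  (fst (fst q) <= j < snd (fst q))%nat -> ev k (basis j) = snd q.
Proof.
  induction k as [|q' k IH]; intros HF Hq Hj; [destruct Hq|]; rewrite ev_cons.
  simpl in HF; apply segfam_cons in HF; destruct HF as [A [B C]]; rewrite inc_basis by auto.
  destruct Hq as [->|Hq].
  - rewrite ev_basis_out; auto.
    + destruct (Nat.leb_spec (fst (fst q)) j), (Nat.ltb_spec j (snd (fst q))); simpl; try lia; lra.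
    + intros q' Hq'; specialize (B (fst q') (in_map fst _ _ Hq')); unfold segdisj in B; lia.
  - rewrite IH by auto; specialize (B (fst q) (in_map fst _ _ Hq)); unfold segdisj in B.
    destruct (Nat.leb_spec (fst (fst q')) j), (Nat.ltb_spec j (snd (fst q'))); simpl; try lia; lra.
Qed.

(** The cost of [k], distributed over the left endpoints of its segments. *)
Definition startcost (k : step) (j : nat) : R :=
  fold_right (fun q acc => (if Nat.eqb (fst (fst q)) j then snd q ^ 2 else 0) + acc) 0 k.

Lemma startcost_cons q k j :
  startcost (q :: k) j = (if Nat.eqb (fst (fst q)) j then snd q ^ 2 else 0) + startcost k j.
Proof. reflexivity. Qed.

Lemma startcost_ge0 k j : 0 <= startcost k j.
Proof.
  induction k as [|q k IH]; [simpl; lra|]; rewrite startcost_cons.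
  destruct (Nat.eqb (fst (fst q)) j); [pose proof (pow2_ge_0 (snd q))|]; lra.
Qed.

Lemma startcost_in k q : In q k -> snd q ^ 2 <= startcost k (fst (fst q)).
Proof.
  induction k as [|q' k IH]; intros Hq; [destruct Hq|]; rewrite startcost_cons.
  destruct Hq as [->|Hq].
  - rewrite Nat.eqb_refl; pose proof (startcost_ge0 k (fst (fst q))); lra.
  - specialize (IH Hq).
    destruct (Nat.eqb (fst (fst q')) _); [pose proof (pow2_ge_0 (snd q'))|]; lra.
Qed.

Lemma psum_startcost k N : psum (startcost k) N <= cost k.
Proof.
  induction k as [|q k IH]; [simpl; rewrite psum_0 by auto; lra|]; rewrite cost_cons.
  rewrite (psum_ext _ (fun j => snd q ^ 2 * basis (fst (fst q)) j + 1 * startcost k j)).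
  - rewrite psum_lin, psum_basis; pose proof (pow2_ge_0 (snd q)).
    destruct (Nat.ltb _ _); lra.
  - intros j _; rewrite startcost_cons; unfold basis; rewrite (Nat.eqb_sym j).
    destruct (Nat.eqb _ _); lra.
Qed.

(** Coefficients are constant inside a segment, so a break with nonzero value is the start of a
    segment and is paid for by [startcost]. Adjacent segments with equal coefficients merge into one
    run, which only lowers the left side. *)
Lemma runsq_step k N : unit_step k -> psum (runsq (coefs (ev k))) N <= 1.
Proof.
  intros [HF Hc]; apply Rle_trans with (2 := Hc), Rle_trans with (2 := psum_startcost k N).
  apply psum_le; intros j _.
  destruct (excluded_middle_informative
    (exists q, In q k /\ (fst (fst q) <= j < snd (fst q))%nat)) as [[q [Hq Hj]]|Hno].
  - destruct (Nat.eq_dec (fst (fst q)) j) as [Ej|Ej].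
    + apply Rle_trans with (1 := runsq_le _ j); unfold coefs.
      rewrite (ev_basis_in k q j) by auto; rewrite <- Ej; now apply startcost_in.
    + rewrite runsq_nobrk; [apply startcost_ge0|]; unfold brk; intros Hb; apply Hb.
      destruct j as [|j]; [lia|]; simpl; unfold coefs.
      rewrite !(ev_basis_in k q) by (auto; lia); auto.
  - apply Rle_trans with (1 := runsq_le _ j); unfold coefs.
    rewrite ev_basis_out; auto; [rewrite pow_i by lia; apply startcost_ge0|].
    intros q Hq; destruct (Nat.le_gt_cases (snd (fst q)) j); auto.
    destruct (Nat.lt_ge_cases j (fst (fst q))); auto; exfalso; eauto.
Qed.

(** At each break of [f] the dominating set is split. The half without a break there cannot
    dominate: the linear equation between two neighbouring coefficients, tested with both signs,
    would pass to [f]. *)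
Lemma dominated_runs f N : extreme_BJdual f ->
  dominated (fun k => unit_step k /\
    forall j, (j < N)%nat -> brk (coefs f) j -> brk (coefs (ev k)) j) f.
Proof.
  intros Hf; induction N.
  - intros x c Hx Hc; apply (dominated_all f (proj1 Hf)); auto.
    intros k Hk; apply Hc; split; auto; intros; lia.
  - assert (Hmono : forall C C' : step -> Prop, (forall k, C k -> C' k) ->
      dominated C f -> dominated C' f).
    { intros C C' HC H x c Hx Hc; apply H; auto. }
    destruct (brk_dec (coefs f) N) as [Hb|Hb].
    + destruct (dominated_split f _ (fun k => brk (coefs (ev k)) N) Hf (fun k H => proj1 H) IHN)
        as [H|H].
      * revert H; apply Hmono; intros k [[H1 H2] H3]; split; auto; intros j Hj Hbj.
        destruct (Nat.eq_dec j N) as [->|]; auto; apply H2; auto; lia.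
      * exfalso; apply Hb.
        assert (HL : lin_on_J f) by exact (proj1 (proj1 (proj1 Hf))).
        pose (z := fun n => match N with O => 0 | S i => basis i n end).
        assert (Hz : inJ z).
        { unfold z; destruct N; [apply (normle_inJ _ 0), normle_zero; lra|apply inJ_basis]. }
        assert (Hfz : forall g, lin_on_J g -> g z = prev (coefs g) N).
        { intros g Hg; unfold z; destruct N; [now apply lin_zero|reflexivity]. }
        assert (K : forall a, f (fun n => a * basis N n + (- a) * z n) <= 0).
        { intros a; apply H; [apply inJ_lin; auto using inJ_basis|].
          intros k [_ Hk]; apply nobrk_eq in Hk.
          rewrite ev_lin, (Hfz (ev k)) by (intros ? ? ? ? _ _; apply ev_lin).
          unfold coefs at 1 in Hk; rewrite Hk; lra. }
        assert (K1 := K 1); assert (K2 := K (-1)).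
        rewrite HL in K1, K2 by auto using inJ_basis; rewrite Hfz in K1, K2 by auto.
        unfold coefs at 1; lra.
    + revert IHN; apply Hmono; intros k [H1 H2]; split; auto; intros j Hj Hbj.
      destruct (Nat.eq_dec j N) as [->|]; [tauto|]; apply H2; auto; lia.
Qed.

(** Test with the run values of [f] placed at the run starts: [f] takes the value [S], the sum of
    squares. An admissible step functional breaks there too, so its coefficients at these points
    count in its own cost, and [2 u v <= u^2 + v^2] bounds its value by [(S + 1) / 2]. *)
Lemma extreme_runs_le1 f : extreme_BJdual f -> runs_le1 (coefs f).
Proof.
  intros Hf N; set (phi := coefs f).
  pose (x := headseq (runval phi) N).
  assert (Hx0 : forall n, (N <= n)%nat -> x n = 0).
  { intros n Hn; unfold x, headseq; destruct (Nat.ltb_spec n N); [lia|auto]. }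
  assert (HL : lin_on_J f) by exact (proj1 (proj1 (proj1 Hf))).
  assert (E : f x = psum (runsq phi) N).
  { rewrite (lin_head_eq f x N HL Hx0); apply psum_ext; intros n Hn.
    unfold x, headseq; apply Nat.ltb_lt in Hn as ->.
    change (f (basis n)) with (phi n); destruct (brk_dec phi n) as [Hb|Hb].
    - rewrite runval_brk, runsq_brk by auto; ring.
    - rewrite runval_nobrk, runsq_nobrk by auto; ring. }
  assert (K : f x <= (psum (runsq phi) N + 1) / 2); [|lra].
  apply (dominated_runs f N Hf); [apply inJ_head|]; intros k [Hk Hb].
  rewrite (lin_head_eq (ev k) x N (fun u v a b _ _ => ev_lin k u v a b) Hx0).
  apply Rle_trans with (psum (fun n => / 2 * runsq phi n + / 2 * runsq (coefs (ev k)) n) N).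
  - apply psum_le; intros n Hn; unfold x, headseq; assert (Hn' := Hn).
    apply Nat.ltb_lt in Hn as ->; change (ev k (basis n)) with (coefs (ev k) n).
    destruct (brk_dec phi n) as [Hbn|Hbn].
    + rewrite runval_brk, !runsq_brk by auto.
      assert (0 <= (coefs (ev k) n - phi n) ^ 2) by apply pow2_ge_0; lra.
    + rewrite runval_nobrk, runsq_nobrk by auto; pose proof (runsq_ge0 (coefs (ev k)) n); lra.
  - rewrite psum_lin; assert (H := runsq_step k N Hk); lra.
Qed.

(** [k] collects the runs completed before the current one; the run starting at [a] is kept apart
    because it may still grow. *)
Lemma runs_step x n : exists a k, (a <= n)%nat /\ segfam (map fst k) /\
  (forall p, In p (map fst k) -> (snd p <= a)%nat) /\
  cost k + x n ^ 2 = psum (runsq x) (S n) /\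
  forall y, ev k y + x n * (psum y (S n) - psum y a) = psum (fun i => x i * y i) (S n).
Proof.
  induction n as [|n [a [k [Ha [HF [Hk [Hc He]]]]]]].
  - exists O, nil; split; [lia|split; [apply segfam_nil|split; [simpl; tauto|split]]].
    + simpl cost; simpl psum; destruct (brk_dec x 0) as [Hb|Hb].
      * rewrite runsq_brk by auto; ring.
      * rewrite runsq_nobrk by auto; apply nobrk_eq in Hb; simpl in Hb; rewrite Hb; ring.
    + intros y; simpl; ring.
  - destruct (brk_dec x (S n)) as [Hb|Hb].
    + exists (S n), (((a, S n), x n) :: k); split; [lia|split; [|split; [|split]]].
      * simpl; apply segfam_cons; split; [simpl; lia|split; auto].
        intros p Hp; right; simpl; auto.
      * intros p [<-|Hp]; simpl; [lia|]; specialize (Hk p Hp); lia.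
      * rewrite cost_cons, psum_S, <- Hc, runsq_brk by auto; simpl snd; ring.
      * intros y; rewrite ev_cons, (psum_S (fun i => x i * y i) (S n)), <- He, (psum_S y (S n)).
        unfold inc; simpl fst; simpl snd; ring.
    + exists a, k; split; [lia|split; [auto|split; [auto|split]]].
      * rewrite psum_S, <- Hc, runsq_nobrk by auto; apply nobrk_eq in Hb; simpl in Hb; rewrite Hb; ring.
      * intros y; rewrite (psum_S (fun i => x i * y i) (S n)), <- He, (psum_S y (S n)).
        apply nobrk_eq in Hb; simpl in Hb; rewrite Hb; ring.
Qed.

Lemma runs_bound x y c N : runs_le1 x -> normle y c -> Rabs (psum (fun i => x i * y i) N) <= c.
Proof.
  intros Hx Hy; destruct N as [|n]; [simpl; rewrite Rabs_R0; apply Hy|].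
  destruct (runs_step x n) as [a [k [Ha [HF [Hk [Hc He]]]]]].
  rewrite <- He.
  replace (ev k y + x n * (psum y (S n) - psum y a)) with (ev (((a, S n), x n) :: k) y)
    by (rewrite ev_cons; unfold inc; simpl fst; simpl snd; ring).
  apply ev_normle; auto; split.
  - simpl; apply segfam_cons; split; [simpl; lia|split; auto].
    intros p Hp; right; simpl; auto.
  - rewrite cost_cons; simpl snd; specialize (Hx (S n)); lra.
Qed.

(** Applied to tails of [y], [runs_bound] shows that the partial sums are Cauchy, so their limit
    defines the functional. *)
Lemma runs_functional x : runs_le1 x -> exists g, BJdual g /\ coefs g = x.
Proof.
  intros Hx; pose (g := fun y => real (Lim_seq (psum (fun i => x i * y i)))).
  assert (Hlim : forall y, inJ y -> is_lim_seq (psum (fun i => x i * y i)) (g y)).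
  { intros y Hy; apply Lim_seq_correct', ex_lim_seq_cauchy_corr; intros eps.
    destruct (tail_small y _ (eps / 2) (inJ_normle y Hy)) as [N HN]; [destruct eps; simpl; lra|].
    assert (K : forall n m, (N <= n)%nat -> (n <= m)%nat ->
      Rabs (psum (fun i => x i * y i) m - psum (fun i => x i * y i) n) < eps).
    { intros n m Hn Hm.
      assert (HB := runs_bound x _ _ m Hx (HN n Hn)).
      assert (E : psum (fun i => x i * y i) m - psum (fun i => x i * y i) n =
        psum (fun i => x i * tailseq y n i) m).
      { rewrite (psum_diff_ext _ (fun i => x i * tailseq y n i) n m); auto.
        - rewrite (psum_0 (fun i => x i * tailseq y n i) n); [lra|].
          intros k Hk; unfold tailseq; apply Nat.ltb_lt in Hk as ->; ring.
        - intros k Hk; unfold tailseq; destruct (Nat.ltb_spec k n); [lia|auto]. }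
      rewrite E; destruct eps; simpl in *; lra. }
    exists N; intros n m Hn Hm.
    destruct (Nat.le_ge_cases n m); [rewrite Rabs_minus_sym|]; auto. }
  exists g; split; [apply BJdual_intro|].
  - intros u v a b Hu Hv.
    assert (H1 := Hlim _ (inJ_lin u v a b Hu Hv)); apply is_lim_seq_unique in H1.
    assert (H2 : is_lim_seq (psum (fun i => x i * (a * u i + b * v i))) (a * g u + b * g v)).
    { apply is_lim_seq_ext with
        (fun n => a * psum (fun i => x i * u i) n + b * psum (fun i => x i * v i) n).
      - intros n; rewrite <- psum_lin; apply psum_ext; intros; ring.
      - apply is_lim_seq_plus'; apply is_lim_seq_mult'; auto using is_lim_seq_const. }
    apply is_lim_seq_unique in H2; rewrite H1 in H2; now injection H2.
  - intros u c Hu; assert (H := Hlim u (proj1 (normle_inJ u c Hu))); apply is_lim_seq_abs in H.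
    change (Rbar_le (Rabs (g u)) c).
    apply (is_lim_seq_le (fun n => Rabs (psum (fun i => x i * u i) n)) (fun _ => c)); auto.
    + intros n; now apply runs_bound.
    + apply is_lim_seq_const.
  - apply functional_extensionality; intros n; unfold coefs.
    rewrite (psum_eventually_lim _ _ (S n) (Hlim _ (inJ_basis n))).
    + rewrite psum_S, psum_0; unfold basis; [rewrite Nat.eqb_refl; ring|].
      intros k Hk; destruct (Nat.eqb_spec k n); [lia|ring].
    + intros k Hk; unfold basis; destruct (Nat.eqb_spec k n); [lia|ring].
Qed.

(** * Consequences of extremality among sequences with bounded runs *)

Definition runs_extreme (x : seqR) : Prop :=
  runs_le1 x /\ forall y z t, runs_le1 y -> runs_le1 z -> 0 < t < 1 ->
    (forall n, x n = t * y n + (1 - t) * z n) -> forall n, y n = z n.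

Lemma extreme_runs_extreme f : extreme_BJdual f -> runs_extreme (coefs f).
Proof.
  intros Hf; split; [now apply extreme_runs_le1|]; intros y z t Hy Hz Ht E n.
  destruct (runs_functional y Hy) as [g [Hg <-]], (runs_functional z Hz) as [h [Hh <-]].
  apply (proj2 Hf g h t Hg Hh Ht); [|apply inJ_basis].
  apply eqJ_basis; [apply Hf| |exact E].
  split; [|exists 1].
  - intros u v a b Hu Hv; rewrite (proj1 (proj1 Hg)), (proj1 (proj1 Hh)) by auto; ring.
  - intros u Hu; assert (Kg := BJdual_normle g u _ Hg (inJ_normle u Hu)).
    assert (Kh := BJdual_normle h u _ Hh (inJ_normle u Hu)).
    apply Rabs_le_between in Kg; apply Rabs_le_between in Kh; apply Rabs_le; split; nra.
Qed.

Lemma runs_le1_compare x y a b : (a <= b)%nat -> runs_le1 x ->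
  (forall j, (j < a \/ b <= j)%nat -> runsq y j <= runsq x j) ->
  inc (runsq y) (a, b) <= inc (runsq x) (a, b) -> runs_le1 y.
Proof.
  intros Hab Hx Hout Hin N.
  apply Rle_trans with (psum (runsq y) (Nat.max N b)); [apply psum_mono; [apply runsq_ge0|lia]|].
  apply Rle_trans with (2 := Hx (Nat.max N b)); unfold inc in Hin; simpl in Hin.
  assert (H1 : psum (runsq y) a <= psum (runsq x) a) by (apply psum_le; intros; apply Hout; lia).
  assert (H2 : forall n, (b <= n)%nat ->
    psum (runsq y) n - psum (runsq y) b <= psum (runsq x) n - psum (runsq x) b).
  { induction 1; [lra|]; rewrite !psum_S; specialize (Hout m ltac:(lia)); lra. }
  specialize (H2 (Nat.max N b) ltac:(lia)); lra.
Qed.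

Lemma inc_ext x y a b : (a <= b)%nat -> (forall k, (a <= k < b)%nat -> x k = y k) ->
  inc x (a, b) = inc y (a, b).
Proof. apply psum_diff_ext. Qed.

Lemma inc_le x y a b : (a <= b)%nat -> (forall k, (a <= k < b)%nat -> x k <= y k) ->
  inc x (a, b) <= inc y (a, b).
Proof.
  unfold inc; simpl; induction 1 as [|m Hm IH]; intros H; [lra|]; simpl.
  specialize (H m) as Hm'; specialize (IH ltac:(intros; apply H; lia)).
  specialize (Hm' ltac:(lia)); lra.
Qed.

Lemma inc_scal_basis c a b : (a < b)%nat -> inc (fun k => c * basis a k) (a, b) = c.
Proof.
  intros H; unfold inc; simpl.
  rewrite !(psum_ext (fun k => c * basis a k) (fun k => c * basis a k + 0 * 0)) by (intros; ring).
  rewrite !(psum_lin _ (fun _ => 0)), !psum_basis.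
  destruct (Nat.ltb_spec a b), (Nat.ltb_spec a a); try lia; lra.
Qed.

(** With room left, [x] is a convex combination of [x / rho] and 0, which forces [x = 0]; but 0 is
    the midpoint of [basis 0] and its negative. *)
Lemma runs_extreme_l2 x : runs_extreme x -> is_lim_seq (psum (runsq x)) 1.
Proof.
  intros [Hx Hext].
  assert (Hsc : forall c N, psum (runsq (fun n => c * x n)) N <= c ^ 2 * psum (runsq x) N).
  { intros c; induction N; [simpl; lra|]; rewrite !psum_S.
    assert (runsq (fun n => c * x n) N <= c ^ 2 * runsq x N); [|nra].
    destruct (brk_dec x N) as [Hb|Hb].
    - apply Rle_trans with (1 := runsq_le _ _); rewrite (runsq_brk x) by auto; nra.
    - rewrite runsq_nobrk; [pose proof (runsq_ge0 x N); pose proof (pow2_ge_0 c); nra|].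
      apply nobrk_eq in Hb; unfold brk; intros K; apply K.
      rewrite Hb; destruct N; simpl; ring. }
  assert (H0 : runs_le1 (basis 0)).
  { intros N; apply Rle_trans with (psum (basis 0) N).
    - apply psum_le; intros k _; apply Rle_trans with (1 := runsq_le _ _); unfold basis.
      destruct (Nat.eqb k 0); lra.
    - rewrite psum_basis; destruct (Nat.ltb 0 N); lra. }
  assert (Hz : runs_le1 (fun _ => 0)).
  { intros N; rewrite psum_0; [lra|]; intros k _.
    apply runsq_nobrk; intros K; apply K; destruct k; auto. }
  assert (K : forall d, 0 < d -> exists N, 1 - d < psum (runsq x) N).
  { intros d Hd; apply NNPP; intros Hn.
    (* The cap at [1 / 2] keeps [rho] positive when [d] is large. *)
    pose (d' := Rmin d (1 / 2)); assert (Hd' : 0 < d') by (apply Rmin_glb_lt; lra).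
    assert (d' <= 1 / 2) by apply Rmin_r; assert (d' <= d) by apply Rmin_l.
    assert (Hle : forall N, psum (runsq x) N <= 1 - d').
    { intros N; apply Rnot_lt_le; intros Hlt; apply Hn; exists N; lra. }
    pose (rho := sqrt (1 - d')).
    assert (Hr2 : rho ^ 2 = 1 - d') by (unfold rho; rewrite pow2_sqrt; lra).
    assert (Hr : 0 < rho) by (apply sqrt_lt_R0; lra).
    assert (Hr1 : rho < 1) by nra.
    assert (Hzero : forall n, x n = 0).
    { intros n.
      assert (E := Hext (fun n => / rho * x n) (fun _ => 0) rho).
      assert (E' : / rho * x n = 0).
      { apply E; auto.
        - intros N; apply Rle_trans with (1 := Hsc _ _); rewrite pow_inv, Hr2.
          apply Rmult_le_reg_l with (1 - d'); [lra|]; rewrite <- Rmult_assoc, Rinv_r by lra.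
          specialize (Hle N); lra.
        - intros m; field; lra. }
      apply Rmult_eq_reg_l with (/ rho); [lra|]; apply Rinv_neq_0_compat; lra. }
    assert (E : basis 0 0%nat = -1 * basis 0 0%nat).
    { apply (Hext (basis 0) (fun n => -1 * basis 0 n) (1 / 2)); auto; [|lra|].
      - intros N; apply Rle_trans with (psum (basis 0) N).
        + apply psum_le; intros k _; apply Rle_trans with (1 := runsq_le _ _); unfold basis.
          destruct (Nat.eqb k 0); lra.
        + rewrite psum_basis; destruct (Nat.ltb 0 N); lra.
      - intros n; rewrite Hzero; lra. }
    unfold basis in E; simpl in E; lra. }
  apply is_lim_seq_spec; intros eps; simpl; destruct (K eps (cond_pos eps)) as [N HN].
  exists N; intros n Hn; specialize (Hx n).
  assert (psum (runsq x) N <= psum (runsq x) n) by (apply psum_mono; auto using runsq_ge0).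
  rewrite Rabs_left1; lra.
Qed.

(* If the run values [v_i] over [a, b) satisfied [(sum v_i)^2 > sum v_i^2 = p^2], then on [a, b) one
   could write [x = t p + (1 - t) h] with [p] constant and [h] of cost at most [p^2] for small [t]. *)
Lemma runs_extreme_group x a b : runs_extreme x -> (a < b)%nat -> brk x a ->
  (brk x b \/ forall j, (b <= j)%nat -> ~ brk x j) ->
  inc (runval x) (a, b) ^ 2 <= inc (runsq x) (a, b).
Proof.
  intros [Hx Hext] Hab Ha Hb; apply Rnot_lt_le; intros Hlt.
  set (s := inc (runval x) (a, b)) in *; set (P := inc (runsq x) (a, b)) in *.
  assert (HP0 : 0 <= P).
  { unfold P, inc; simpl; assert (K := psum_mono (runsq x) a b (runsq_ge0 x) ltac:(lia)); lra. }
  assert (HP : 0 < P).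
  { destruct (Rle_lt_or_eq_dec _ _ HP0) as [|E]; auto; exfalso.
    assert (Hz : forall j, (a <= j < b)%nat -> runval x j = 0).
    { intros j Hj.
      assert (K1 := psum_mono (runsq x) a j (runsq_ge0 x) ltac:(lia)).
      assert (K2 := psum_mono (runsq x) (S j) b (runsq_ge0 x) ltac:(lia)).
      assert (K3 := runsq_ge0 x j); rewrite psum_S in K2; unfold P, inc in E; simpl in E.
      assert (E0 : runsq x j = 0) by lra.
      destruct (brk_dec x j) as [Hj'|Hj']; [|now apply runval_nobrk].
      rewrite runsq_brk in E0 by auto; rewrite runval_brk by auto.
      apply Rsqr_0_uniq; unfold Rsqr; lra. }
    assert (s = 0); [|nra].
    unfold s; rewrite (inc_ext _ (fun _ => 0)) by (auto; lia); unfold inc; rewrite !psum_0 by auto; lra. }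
  (* A single run of value [p] costs exactly [P]; with the sign of [s], the assumption [P < s ^ 2]
     becomes [P < p s]. *)
  pose (p := sgn s * sqrt P).
  assert (HsP : 0 < sqrt P) by now apply sqrt_lt_R0.
  assert (Hsq : sqrt P * sqrt P = P) by (apply sqrt_sqrt; lra).
  assert (Hp2 : p ^ 2 = P).
  { transitivity (sqrt P * sqrt P); [|auto].
    unfold p; destruct (sgn_cases s) as [->| ->]; ring. }
  assert (Hps : P < p * s).
  { unfold p; replace (sgn s * sqrt P * s) with (sqrt P * (sgn s * s)) by ring; rewrite sgn_mul.
    apply Rle_lt_trans with (sqrt P * sqrt P); [lra|]; apply Rmult_lt_compat_l; auto.
    rewrite <- sqrt_pow2 with (1 := Rabs_pos s), pow2_abs; apply sqrt_lt_1_alt; lra. }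
  pose (ind := fun j => if Req_dec_T (x j) (prev x j) then 0 else 1).
  set (n := inc ind (a, b)).
  assert (Hn : 0 <= n).
  { unfold n, inc; simpl.
    assert (K := psum_mono ind a b ltac:(intros k; unfold ind; destruct (Req_dec_T _ _); lra) ltac:(lia)).
    lra. }
  (* With [n] breaks in [[a, b)], the cost of [h] there is at most
     [(P - 2 t p s + t^2 n P) / (1 - t)^2], and this is at most [P] once
     [t (n P - P) <= 2 (p s - P)]. *)
  pose (t := Rmin (1 / 2) (2 * (p * s - P) / (n * P + 1))).
  assert (Hden : 0 < n * P + 1) by nra.
  assert (Ht2 : 0 < 2 * (p * s - P) / (n * P + 1)) by (apply Rdiv_lt_0_compat; lra).
  assert (Ht0 : 0 < t) by (apply Rmin_glb_lt; lra).
  assert (Ht1 : t <= 1 / 2) by apply Rmin_l.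
  assert (Htn : t * (n * P + 1) <= 2 * (p * s - P)).
  { apply Rle_trans with (2 * (p * s - P) / (n * P + 1) * (n * P + 1)); [|right; field; lra].
    apply Rmult_le_compat_r; [lra|apply Rmin_r]. }
  (* If [b] is not a break, the last run goes on for ever. The window then extends to infinity, so
     that the change of values creates no break at [b]. *)
  pose (inW := fun j => if excluded_middle_informative (a <= j /\ (j < b \/ ~ brk x b))%nat
    then true else false).
  assert (HW1 : forall j, (a <= j < b)%nat -> inW j = true).
  { intros j Hj; unfold inW; destruct (excluded_middle_informative _) as [|K]; auto.
    exfalso; apply K; lia. }
  assert (HW0 : forall j, (j < a)%nat -> inW j = false).
  { intros j Hj; unfold inW; destruct (excluded_middle_informative _); auto; lia. }
  pose (g := fun j => if inW j then p else x j).
  pose (h := fun j => if inW j then (x j - t * p) / (1 - t) else x j).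
  assert (Hgen : forall phi : R -> R,
    forall j, (j < a \/ b <= j)%nat ->
      runsq (fun j => if inW j then phi (x j) else x j) j <= runsq x j).
  { intros phi j Hj; set (y := fun j => if inW j then phi (x j) else x j).
    assert (Hsame : y j = x j -> (brk y j -> brk x j) -> runsq y j <= runsq x j).
    { intros E Hbb; destruct (brk_dec y j) as [K|K].
      - rewrite !runsq_brk by auto; rewrite E; lra.
      - rewrite runsq_nobrk by auto; apply runsq_ge0. }
    destruct Hj as [Hj|Hj].
    - apply Hsame; [unfold y; now rewrite HW0|]; unfold brk.
      replace (prev y j) with (prev x j) by (destruct j; simpl; unfold y; [|rewrite HW0 by lia]; auto).
      unfold y; now rewrite HW0.
    - destruct (brk_dec x b) as [Hbb|Hbb].
      + assert (HW2 : forall i, (b <= i)%nat -> inW i = false).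
        { intros i Hi; unfold inW; destruct (excluded_middle_informative _) as [K|]; auto.
          destruct K as [_ [K|K]]; [lia|tauto]. }
        apply Hsame; [unfold y; now rewrite HW2|]; unfold brk.
        destruct (Nat.eq_dec j b) as [->|Hne]; [auto|].
        destruct j as [|j]; [lia|]; simpl; unfold y; rewrite !HW2 by lia; auto.
      + destruct Hb as [Hb|Hb]; [tauto|].
        assert (HW2 : forall i, (a <= i)%nat -> inW i = true).
        { intros i Hi; unfold inW; destruct (excluded_middle_informative _) as [K|K]; auto. }
        assert (Hnj := nobrk_eq _ _ (Hb j Hj)).
        rewrite runsq_nobrk; [apply runsq_ge0|]; intros K; apply K.
        destruct j as [|j]; [lia|]; simpl in *; unfold y; rewrite !HW2 by lia; now rewrite Hnj. }
  assert (Hg : runs_le1 g).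
  { apply (runs_le1_compare x g a b); [lia|auto|apply (Hgen (fun _ => p))|].
    fold P; apply Rle_trans with (inc (fun k => P * basis a k) (a, b)).
    - apply inc_le; [lia|]; intros k Hk; unfold basis; destruct (Nat.eqb_spec k a) as [->|Hne].
      + apply Rle_trans with (1 := runsq_le _ _); unfold g; rewrite HW1 by lia; lra.
      + rewrite runsq_nobrk; [lra|]; intros K; apply K; destruct k as [|k]; [lia|]; simpl.
        unfold g; rewrite !HW1 by lia; auto.
    - rewrite inc_scal_basis by auto; lra. }
  assert (Hh : runs_le1 h).
  { apply (runs_le1_compare x h a b); [lia|auto|apply (Hgen (fun r => (r - t * p) / (1 - t)))|].
    fold P.
    pose (ch := fun k => / (1 - t) ^ 2 * runsq x k +
      1 * (/ (1 - t) ^ 2 * (- 2 * t * p) * runval x k + / (1 - t) ^ 2 * (t ^ 2 * P) * ind k)).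
    apply Rle_trans with (inc ch (a, b)).
    - apply inc_le; [lia|]; intros k Hk; unfold ch, ind.
      assert (Hk' : h k = (x k - t * p) / (1 - t)) by (unfold h; now rewrite HW1).
      destruct (brk_dec x k) as [Hbk|Hbk].
      + apply Rle_trans with (1 := runsq_le _ _); rewrite Hk', runsq_brk, runval_brk by auto.
        destruct (Req_dec_T (x k) (prev x k)); [contradiction|]; rewrite <- Hp2; right; field; lra.
      + rewrite (runsq_nobrk x), runval_nobrk by auto.
        destruct (Req_dec_T (x k) (prev x k)) as [Ek|Ek]; [|contradiction].
        rewrite runsq_nobrk; [lra|]; intros K; apply K.
        destruct k as [|k]; [assert (a = 0%nat) by lia; subst; tauto|]; simpl in *.
        destruct (Nat.eq_dec (S k) a) as [Eka|]; [rewrite <- Eka in Ha; tauto|].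
        unfold h; rewrite !HW1 by lia; now rewrite Ek.
    - assert (E : inc ch (a, b) = / (1 - t) ^ 2 * (P - 2 * t * p * s + t ^ 2 * P * n)).
      { unfold ch, inc; simpl fst; simpl snd.
        rewrite !(psum_lin (runsq x)), !(psum_lin (runval x)).
        unfold P, s, n, inc; simpl fst; simpl snd; ring. }
      rewrite E; assert (H1t : 0 < (1 - t) ^ 2) by (apply pow_lt; lra).
      apply Rmult_le_reg_l with ((1 - t) ^ 2); [auto|].
      rewrite <- Rmult_assoc, Rinv_r, Rmult_1_l by lra; nra. }
  assert (Heq : forall j, g j = h j).
  { apply (Hext g h t Hg Hh); [lra|]; intros j; unfold g, h; destruct (inW j); [field|]; lra. }
  assert (Hconst : forall j, (a <= j < b)%nat -> x j = p).
  { intros j Hj; specialize (Heq j); unfold g, h in Heq; rewrite HW1 in Heq by auto.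
    apply (f_equal (fun r => (1 - t) * r)) in Heq.
    replace ((1 - t) * ((x j - t * p) / (1 - t))) with (x j - t * p) in Heq by (field; lra); lra. }
  (* A constant [x] on [[a, b)] has [s = p], so [p s = P], contrary to [Hps]. *)
  assert (s = p); [|nra].
  unfold s; rewrite (inc_ext _ (fun k => p * basis a k)); [now apply inc_scal_basis|lia|].
  intros k Hk; unfold basis; destruct (Nat.eqb_spec k a) as [->|Hne].
  - rewrite runval_brk, Hconst by (auto; lia); ring.
  - rewrite runval_nobrk; [ring|]; intros K; apply K; destruct k as [|k]; [lia|]; simpl.
    rewrite !Hconst by lia; auto.
Qed.

(** Between values [u] and [v] of opposite signs, the zero on the gap is a convex combination of
    them. Filling the gap with [u] prolongs the run on its left and filling it with [v] lets the run
    on its right start earlier; neither raises the cost. *)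
Lemma runs_extreme_gap x a b : runs_extreme x -> (S a < b)%nat ->
  (forall j, (a < j < b)%nat -> x j = 0) -> 0 <= x a * x b.
Proof.
  intros [Hx Hext] Hab Hgap; apply Rnot_lt_le; intros Hlt.
  set (u := x a) in *; set (v := x b) in *.
  assert (Huv : u - v <> 0) by nra.
  assert (Hv : v <> 0) by nra.
  pose (G := fun j => (Nat.ltb a j && Nat.ltb j b)%bool).
  assert (G1 : forall j, (a < j < b)%nat -> G j = true).
  { intros j Hj; unfold G; destruct (Nat.ltb_spec a j), (Nat.ltb_spec j b); auto; lia. }
  assert (G0 : forall j, (j <= a \/ b <= j)%nat -> G j = false).
  { intros j Hj; unfold G; destruct (Nat.ltb_spec a j), (Nat.ltb_spec j b); auto; lia. }
  pose (y := fun w j => if G j then w else x j).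
  assert (Hbb : brk x b).
  { unfold brk; destruct b as [|b]; [lia|]; simpl; rewrite (Hgap b) by lia; auto. }
  assert (Hout : forall w j, (j <= a \/ b <= j)%nat -> runsq (y w) j <= runsq x j).
  { intros w j Hj.
    destruct (Nat.eq_dec j b) as [->|Hne].
    - rewrite (runsq_brk x) by auto; apply Rle_trans with (1 := runsq_le _ _); unfold y.
      rewrite G0 by lia; lra.
    - right; unfold runsq.
      assert (E : y w j = x j) by (unfold y; now rewrite G0 by lia).
      assert (E' : prev (y w) j = prev x j).
      { destruct j as [|j]; [auto|]; simpl; unfold y; now rewrite G0 by lia. }
      now rewrite E, E'. }
  assert (Hmid : forall w j, (S a < j < b)%nat -> runsq (y w) j = 0).
  { intros w j Hj; apply runsq_nobrk; intros K; apply K; destruct j as [|j]; [lia|]; simpl.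
    unfold y; rewrite !G1 by lia; auto. }
  assert (Hyu : runs_le1 (y u)).
  { apply (runs_le1_compare x _ (S a) b); [lia|auto|intros; apply Hout; lia|].
    apply inc_le; [lia|]; intros k Hk; destruct (Nat.eq_dec k (S a)) as [->|Hne].
    - rewrite runsq_nobrk; [apply runsq_ge0|]; intros K; apply K; simpl; unfold y.
      rewrite G1, G0 by lia; reflexivity.
    - rewrite Hmid by lia; apply runsq_ge0. }
  assert (Hyv : runs_le1 (y v)).
  { apply (runs_le1_compare x _ (S a) (S b)); [lia|auto|intros; apply Hout; lia|].
    apply Rle_trans with (inc (fun k => v ^ 2 * basis (S a) k) (S a, S b)).
    - apply inc_le; [lia|]; intros k Hk; unfold basis; destruct (Nat.eqb_spec k (S a)) as [->|Hne].
      + apply Rle_trans with (1 := runsq_le _ _); unfold y; rewrite G1 by lia; lra.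
      + destruct (Nat.eq_dec k b) as [->|Hkb]; [|rewrite Hmid by lia; lra].
        rewrite runsq_nobrk; [lra|]; intros K; apply K; destruct b as [|b]; [lia|]; simpl.
        unfold y; rewrite G0, G1 by lia; reflexivity.
    - rewrite inc_scal_basis by lia; unfold inc; simpl snd; rewrite psum_S, (runsq_brk x b) by auto.
      fold v; assert (K := psum_mono (runsq x) (S a) b (runsq_ge0 x) ltac:(lia)); simpl fst; lra. }
  assert (Ht : 0 < v / (v - u) < 1).
  { assert (E : v / (v - u) * (v - u) ^ 2 = v * (v - u)) by (field; lra).
    assert (0 < (v - u) ^ 2) by (assert (K := pow2_ge_0 (v - u)); nra).
    split; apply Rmult_lt_reg_r with ((v - u) ^ 2); auto; rewrite E; nra. }
  assert (E := Hext (y u) (y v) (v / (v - u)) Hyu Hyv Ht).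
  assert (E' : y u (S a) = y v (S a)).
  { apply E; intros j; unfold y; destruct (G j) eqn:HG; [|ring].
    rewrite Hgap; [field; lra|].
    revert HG; unfold G; destruct (Nat.ltb_spec a j), (Nat.ltb_spec j b); simpl; intros;
      try discriminate; lia. }
  unfold y in E'; rewrite G1 in E' by lia; lra.
Qed.

(** * Enumeration of the runs *)

(** When no break remains, the relation still has solutions, so the enumeration of positions never
    stops. *)
Definition next_brk (x : seqR) (n m : nat) : Prop :=
  (n <= m)%nat /\ (forall j, (n <= j < m)%nat -> ~ brk x j) /\
  (brk x m \/ forall j, (n <= j)%nat -> ~ brk x j).

Lemma next_brk_ex x n : exists m, next_brk x n m.
Proof.
  destruct (excluded_middle_informative (exists j, (n <= j)%nat /\ brk x j)) as [[j [Hj Hb]]|Hno].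
  - assert (H : forall d, (exists m, next_brk x n m) \/
      forall j, (n <= j < n + d)%nat -> ~ brk x j).
    { induction d as [|d [IH|IH]]; auto; [right; intros; lia|].
      destruct (brk_dec x (n + d)) as [Hd|Hd].
      - left; exists (n + d)%nat; split; [lia|split; auto].
      - right; intros i Hi; destruct (Nat.eq_dec i (n + d)) as [->|]; auto; apply IH; lia. }
    destruct (H (S j)) as [K|K]; auto; exfalso; apply (K j); auto; lia.
  - exists n; split; [lia|split; [intros; lia|right]]; intros j Hj Hb; eauto.
Qed.

(* After the last break (if any) the positions go on one by one and are no longer breaks. *)
Fixpoint runpos (x : seqR) (i : nat) : nat :=
  match i with
  | O => epsilon (inhabits O) (next_brk x 0)
  | S j => epsilon (inhabits O) (next_brk x (S (runpos x j)))
  end.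

Lemma runpos_0 x : next_brk x 0 (runpos x 0).
Proof. exact (epsilon_spec (inhabits O) _ (next_brk_ex x 0)). Qed.

Lemma runpos_S x i : next_brk x (S (runpos x i)) (runpos x (S i)).
Proof. exact (epsilon_spec (inhabits O) _ (next_brk_ex x (S (runpos x i)))). Qed.

Arguments runpos : simpl never.

Lemma runpos_increasing x : pos_increasing (runpos x).
Proof. intros i; destruct (runpos_S x i) as [H _]; lia. Qed.

Lemma runpos_brk x i : brk x (runpos x i) \/ forall j, (runpos x i <= j)%nat -> ~ brk x j.
Proof.
  assert (K : next_brk x (match i with O => O | S j => S (runpos x j) end) (runpos x i))
    by (destruct i; [apply runpos_0|apply runpos_S]).
  destruct K as [H1 [_ [H|H]]]; auto; right; intros j Hj; apply H; lia.
Qed.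

Lemma psum_runpos x w i : (forall j, ~ brk x j -> w j = 0) ->
  psum w (runpos x i) = psum (fun i => w (runpos x i)) i.
Proof.
  intros Hw; induction i.
  - apply psum_0; intros k Hk; apply Hw, (proj1 (proj2 (runpos_0 x))); lia.
  - destruct (runpos_S x i) as [H1 [H2 _]].
    rewrite (psum_const w (S (runpos x i))), !psum_S by
      (try lia; intros k Hk; apply Hw, H2; lia).
    rewrite IHi; reflexivity.
Qed.

Lemma constant_on x a b j : (forall k, (a < k <= b)%nat -> ~ brk x k) -> (a <= j <= b)%nat ->
  x j = x a.
Proof.
  intros H [H1 H2]; induction H1 as [|m Hm IH]; auto.
  rewrite (nobrk_eq x (S m)) by (apply H; lia); apply IH; lia.
Qed.

Lemma runpos_const x i j : (runpos x i <= j < runpos x (S i))%nat -> x j = x (runpos x i).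
Proof.
  intros Hj; apply (constant_on x (runpos x i) (pred (runpos x (S i)))); [|lia].
  intros k Hk; apply (proj1 (proj2 (runpos_S x i))); lia.
Qed.

Lemma runpos_before x j : (j < runpos x 0)%nat -> x j = 0.
Proof.
  intros Hj; assert (H := proj1 (proj2 (runpos_0 x))).
  rewrite (constant_on x 0 j j) by (try lia; intros; apply H; lia).
  apply (nobrk_eq x 0), H; lia.
Qed.

Definition runseq (x : seqR) : seqR := fun i => runval x (runpos x i).

Lemma runseq_brk x i : brk x (runpos x i) -> runseq x i = x (runpos x i).
Proof. apply runval_brk. Qed.

Lemma runseq_neq0 x i : runseq x i <> 0 -> brk x (runpos x i).
Proof.
  intros H; destruct (brk_dec x (runpos x i)) as [|Hb]; auto.
  exfalso; apply H; now apply runval_nobrk.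
Qed.

Lemma runseq_end x i j : ~ brk x (runpos x i) -> (i <= j)%nat -> runseq x j = 0.
Proof.
  intros Hi Hij; apply runval_nobrk.
  destruct (runpos_brk x i) as [H|H]; [tauto|]; apply H.
  destruct (Nat.eq_dec i j) as [->|]; auto.
  apply Nat.lt_le_incl, increasing_lt; [apply runpos_increasing|lia].
Qed.

Lemma psum_runseq x i : psum (runseq x) i = psum (runval x) (runpos x i).
Proof. symmetry; apply psum_runpos, runval_nobrk. Qed.

Lemma psum_sqs_runseq x i : psum (sqs (runseq x)) i = psum (runsq x) (runpos x i).
Proof.
  rewrite (psum_runpos x (runsq x)) by apply runsq_nobrk.
  apply psum_ext; intros k _; unfold sqs, runseq.
  destruct (brk_dec x (runpos x k)) as [H|H].
  - rewrite runval_brk, runsq_brk by auto; reflexivity.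
  - rewrite runval_nobrk, runsq_nobrk by auto; ring.
Qed.

Lemma runseq_group x a b : runs_extreme x -> (a < b)%nat ->
  inc (runseq x) (a, b) ^ 2 <= inc (sqs (runseq x)) (a, b).
Proof.
  intros Hx Hab; destruct (brk_dec x (runpos x a)) as [Ha|Ha].
  - unfold inc; simpl fst; simpl snd; rewrite !psum_runseq, !psum_sqs_runseq.
    apply (runs_extreme_group x (runpos x a) (runpos x b)); auto using runpos_brk.
    now apply increasing_lt; [apply runpos_increasing|].
  - rewrite (inc_ext (runseq x) (fun _ => 0)) by
      (try lia; intros; apply (runseq_end x a); auto; lia).
    unfold inc at 1; rewrite !psum_0 by auto; simpl fst; simpl snd.
    unfold inc; simpl fst; simpl snd.
    assert (K := psum_mono (sqs (runseq x)) a b (sqs_ge0 _) ltac:(lia)); lra.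
Qed.

(** By [runseq_group], replacing each segment by its singletons does not lower the sum of squares,
    and the sum over all singletons is at most 1. *)
Lemma runseq_l2unit x : runs_extreme x -> l2unit (runseq x).
Proof.
  intros Hx; split; [split; [lra|]|].
  - intros L HL; destruct (segfam_bounded L) as [N HN].
    apply Rle_trans with (suminc (sqs (runseq x)) L).
    + clear - HL Hx; induction L as [|p L IH]; [simpl; lra|].
      apply segfam_cons in HL; destruct HL as [A [_ C]]; rewrite sqinc_cons.
      change (suminc (sqs (runseq x)) (p :: L)) with
        (inc (sqs (runseq x)) p + suminc (sqs (runseq x)) L).
      assert (K := runseq_group x _ _ Hx A); rewrite <- surjective_pairing in K.
      specialize (IH C); lra.
    + apply Rle_trans with (psum (sqs (runseq x)) N).
      * apply suminc_le; auto using sqs_ge0.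
      * rewrite psum_sqs_runseq, pow1; apply Hx.
  - apply is_lim_seq_ext with (fun i => psum (runsq x) (runpos x i));
      [intros; now rewrite psum_sqs_runseq|].
    apply (is_lim_seq_subseq (psum (runsq x)) 1 (runpos x)).
    + apply eventually_subseq, runpos_increasing.
    + now apply runs_extreme_l2.
Qed.

Lemma runseq_0 x : runs_extreme x -> runseq x 0%nat <> 0.
Proof.
  intros Hx; destruct (brk_dec x (runpos x 0)) as [Hb|Hb].
  - rewrite runseq_brk by auto; intros E; apply Hb; rewrite E.
    destruct (runpos x 0) eqn:Ep; [reflexivity|]; simpl; symmetry; apply runpos_before; lia.
  - exfalso; assert (H := proj2 (runseq_l2unit x Hx)).
    assert (E := psum_eventually_lim _ _ 0 H).
    simpl in E; assert (1 = 0); [|lra]; apply E.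
    intros n Hn; unfold sqs; rewrite (runseq_end x 0) by auto; ring.
Qed.

(* A zero run between two breaks is excluded by [runs_extreme_gap] (neighbours of opposite signs)
   and by [runs_extreme_group] (neighbours of the same sign). *)
Lemma runseq_zero x k : runs_extreme x -> (forall i, (i < k)%nat -> runseq x i <> 0) ->
  runseq x k = 0 -> ~ brk x (runpos x (S k)).
Proof.
  intros Hx Hnz Hk Hb.
  destruct k as [|k]; [now apply (runseq_0 x)|].
  assert (Hbk : brk x (runpos x (S k))).
  { destruct (runpos_brk x (S k)) as [|H]; auto; exfalso.
    revert Hb; apply H, Nat.lt_le_incl, runpos_increasing. }
  assert (Hk0 : x (runpos x (S k)) = 0) by (rewrite <- runseq_brk; auto).
  assert (Hnk := Hnz k ltac:(lia)); assert (Hbk0 := runseq_neq0 x k Hnk).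
  assert (I1 := runpos_increasing x k); assert (I2 := runpos_increasing x (S k)).
  assert (Hn2 : runseq x (S (S k)) <> 0).
  { rewrite runseq_brk by auto; intros E; apply Hb; rewrite E.
    destruct (runpos x (S (S k))) as [|m] eqn:Em; [lia|]; simpl.
    rewrite (runpos_const x (S k) m) by lia; auto. }
  assert (G := runs_extreme_gap x (pred (runpos x (S k))) (runpos x (S (S k))) Hx ltac:(lia)).
  rewrite (runpos_const x k) in G by lia.
  assert (G' : 0 <= runseq x k * runseq x (S (S k))).
  { rewrite !runseq_brk by auto; apply G; intros j Hj; rewrite (runpos_const x (S k)) by lia; auto. }
  (* Over three consecutive runs with the middle one zero, the inequality makes the product of the
     outer values at most 0, while [G'] makes it at least 0. *)
  assert (Q := runseq_group x k (S (S (S k))) Hx ltac:(lia)).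
  unfold inc in Q; simpl fst in Q; simpl snd in Q; rewrite !psum_sqs_S, !psum_S, Hk in Q.
  assert (runseq x k * runseq x (S (S k)) = 0) by nra.
  apply Rmult_integral in H; tauto.
Qed.

(** [F] stops at the first zero of [runseq x]. By [runseq_zero] no break follows it, so all later
    entries vanish as well. *)
Lemma runs_support x : runs_extreme x -> exists F, valid_F F /\
  (forall i, inF F i -> runseq x i <> 0) /\
  (forall i, ~ inF F i -> runseq x i = 0) /\
  (forall k, F = Some k -> runseq x k = 0).
Proof.
  intros Hx.
  destruct (excluded_middle_informative (exists k, runseq x k = 0)) as [[k Hk]|Hno].
  - assert (Hmin : exists k, runseq x k = 0 /\ forall i, (i < k)%nat -> runseq x i <> 0).
    { revert Hk; induction k as [k IH] using lt_wf_ind; intros Hk.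
      destruct (excluded_middle_informative (exists i, (i < k)%nat /\ runseq x i = 0))
        as [[i [Hi Hi0]]|Hno]; [now apply (IH i)|].
      exists k; split; auto; intros i Hi E; apply Hno; eauto. }
    clear k Hk; destruct Hmin as [k [Hk Hnz]]; exists (Some k); split; [|split; [|split]].
    + simpl; destruct k; [exfalso; now apply (runseq_0 x)|lia].
    + exact Hnz.
    + intros i Hi; simpl in Hi; destruct (Nat.eq_dec i k) as [->|]; auto.
      apply (runseq_end x (S k)); [now apply runseq_zero|lia].
    + intros k' E; injection E as <-; auto.
  - exists None; split; [exact I|split; [|split]]; try discriminate.
    + intros i _ E; apply Hno; eauto.
    + intros i Hi; exfalso; apply Hi; exact I.
Qed.

Definition runint (x : seqR) (i : nat) : interval :=
  if excluded_middle_informative (brk x (runpos x (S i)))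
  then IFin (runpos x i) (pred (runpos x (S i))) else IInf (runpos x i).

Lemma in_runint x i n : in_interval (runint x i) n <->
  (runpos x i <= n /\ (brk x (runpos x (S i)) -> n < runpos x (S i)))%nat.
Proof.
  assert (K := runpos_increasing x i); unfold runint.
  destruct (excluded_middle_informative _) as [H|H]; simpl; split.
  - intros Hn; split; [lia|intros; lia].
  - intros [H1 H2]; specialize (H2 H); lia.
  - intros Hn; split; [lia|tauto].
  - tauto.
Qed.

Lemma runint_family x F : valid_F F -> (forall i, inF F i -> runseq x i <> 0) ->
  interval_family F (runint x).
Proof.
  intros HF Hnz; split; [auto|split]; intros i Hi; assert (K := runpos_increasing x i).
  - unfold runint; destruct (excluded_middle_informative _); simpl; [lia|auto].
  - assert (Hb := runseq_neq0 x (S i) (Hnz (S i) Hi)).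
    unfold runint at 1; destruct (excluded_middle_informative _) as [|Hb']; [|tauto].
    unfold runint; destruct (excluded_middle_informative _); simpl; simpl in K; lia.
Qed.

Lemma runpos_locate x n : (runpos x 0 <= n)%nat ->
  exists i, (runpos x i <= n < runpos x (S i))%nat.
Proof.
  intros Hn; assert (C := count_spec _ (runpos_increasing x) (S n)).
  assert (0 < count (runpos x) (S n))%nat by (apply C; lia).
  exists (pred (count (runpos x) (S n))).
  assert (A := C (pred (count (runpos x) (S n)))).
  assert (B := C (S (pred (count (runpos x) (S n))))). lia.
Qed.

Lemma runpos_le x i j : (i <= j)%nat -> (runpos x i <= runpos x j)%nat.
Proof.
  intros H; destruct (Nat.eq_dec i j) as [->|]; auto.
  apply Nat.lt_le_incl, increasing_lt; [apply runpos_increasing|lia].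
Qed.

(** Consecutive runs are adjacent, so only the right end is in question: for [F = Some k] the union
    stops just before [runpos x k] if that is a break, and is infinite otherwise. *)
Lemma runint_union x F : valid_F F -> (forall i, inF F i -> runseq x i <> 0) ->
  union_is_interval F (runint x).
Proof.
  intros HF Hnz; destruct F as [k|].
  - simpl in HF.
    assert (Hin : forall i n, (i < k)%nat -> in_interval (runint x i) n ->
      (runpos x 0 <= n /\ (brk x (runpos x k) -> n < runpos x k))%nat).
    { intros i n Hi Hn; apply in_runint in Hn; destruct Hn as [H1 H2].
      assert (K := runpos_le x 0 i ltac:(lia)); split; [lia|]; intros Hb.
      assert (K' := runpos_le x (S i) k ltac:(lia)).
      assert (Hbi : brk x (runpos x (S i))).
      { destruct (Nat.eq_dec (S i) k) as [->|]; auto; apply runseq_neq0, Hnz; simpl; lia. }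
      specialize (H2 Hbi); lia. }
    assert (Hex : forall n, (runpos x 0 <= n)%nat -> (brk x (runpos x k) -> n < runpos x k)%nat ->
      exists i, inF (Some k) i /\ in_interval (runint x i) n).
    { intros n H0 Hk; destruct (Nat.lt_ge_cases n (runpos x k)) as [Hlt|Hge].
      - destruct (runpos_locate x n H0) as [i Hi]; exists i; split.
        + simpl; destruct (Nat.lt_ge_cases i k) as [|H]; auto.
          assert (K := runpos_le x k i H); lia.
        + apply in_runint; split; [lia|intros; lia].
      - exists (pred k); split; [simpl; lia|]; apply in_runint.
        replace (S (pred k)) with k by lia; split; [|exact Hk].
        assert (K := runpos_le x (pred k) k ltac:(lia)); lia. }
    assert (Hpos : (runpos x 0 < runpos x k)%nat)
      by (apply increasing_lt; [apply runpos_increasing|lia]).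
    destruct (brk_dec x (runpos x k)) as [Hb|Hb].
    + exists (IFin (runpos x 0) (pred (runpos x k))); split; [simpl; lia|]; intros n; simpl; split.
      * intros Hn; apply Hex; [lia|intros; lia].
      * intros [i [Hi Hn]]; destruct (Hin i n Hi Hn) as [H1 H2]; specialize (H2 Hb); lia.
    + exists (IInf (runpos x 0)); split; [exact I|]; intros n; simpl; split.
      * intros Hn; apply Hex; [auto|tauto].
      * intros [i [Hi Hn]]; apply (Hin i n Hi Hn).
  - exists (IInf (runpos x 0)); split; [exact I|]; intros n; simpl; split.
    + intros Hn; destruct (runpos_locate x n Hn) as [i Hi]; exists i; split; auto.
      apply in_runint; split; [lia|intros; lia].
    + intros [i [_ Hn]]; apply in_runint in Hn; assert (K := runpos_le x 0 i ltac:(lia)); lia.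
Qed.

Lemma Isum_runint x y i : brk x (runpos x (S i)) ->
  Isum y (runint x i) = psum y (runpos x (S i)) - psum y (runpos x i).
Proof.
  intros Hb; assert (K := runpos_increasing x i); unfold runint.
  destruct (excluded_middle_informative _) as [_|]; [|tauto]; simpl Isum.
  rewrite sum_n_m_psum by lia; now replace (S (pred (runpos x (S i)))) with (runpos x (S i)) by lia.
Qed.

Lemma Isum_IInf y a : inJ y -> is_lim_seq (fun n => psum y n - psum y a) (Isum y (IInf a)).
Proof.
  intros Hy; destruct (normle_cv _ _ (inJ_normle y Hy)) as [l Hl].
  assert (E := psum_cv_shift y l a Hl); apply is_series_unique in E; simpl; rewrite E.
  apply is_lim_seq_minus'; [auto|apply is_lim_seq_const].
Qed.

Lemma psum_mul_const x y a b c : (a <= b)%nat -> (forall j, (a <= j < b)%nat -> x j = c) ->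
  psum (fun j => x j * y j) b - psum (fun j => x j * y j) a = c * (psum y b - psum y a).
Proof.
  induction 1 as [|m Hm IH]; intros H; [ring|].
  assert (E : psum (fun j => x j * y j) m - psum (fun j => x j * y j) a = c * (psum y m - psum y a))
    by (apply IH; intros; apply H; lia).
  rewrite !psum_S, (H m) by lia; lra.
Qed.

Lemma runs_partial_sum x y m : (forall i, (i < m)%nat -> brk x (runpos x i) /\ brk x (runpos x (S i))) ->
  psum (fun i => runseq x i * Isum y (runint x i)) m = psum (fun j => x j * y j) (runpos x m).
Proof.
  induction m; intros H.
  - simpl psum at 1; symmetry; apply psum_0; intros k Hk; rewrite runpos_before by auto; ring.
  - rewrite psum_S, IHm by (intros; apply H; lia); destruct (H m ltac:(lia)) as [H1 H2].
    rewrite Isum_runint, runseq_brk by auto.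
    rewrite <- (psum_mul_const x y (runpos x m) (runpos x (S m)) (x (runpos x m))); [ring| |].
    + apply Nat.lt_le_incl, runpos_increasing.
    + intros j Hj; now apply runpos_const.
Qed.

Lemma runs_represents f x F : in_Jdual f -> coefs f = x -> runs_extreme x -> valid_F F ->
  (forall i, inF F i -> runseq x i <> 0) -> (forall k, F = Some k -> runseq x k = 0) ->
  represents f F (runint x) (runseq x).
Proof.
  intros Hf Hfx Hx HF Hnz Hk y Hy.
  assert (L := Jdual_lim f y Hf Hy); change (fun n => f (basis n) * y n) with
    (fun n => coefs f n * y n) in L; rewrite Hfx in L.
  assert (Hb : forall i, inF F i -> brk x (runpos x i)) by (intros; apply runseq_neq0; auto).
  destruct F as [k|].
  - simpl in HF; specialize (Hk k eq_refl).
    rewrite sum_n_m_psum by lia; simpl psum at 2; rewrite Rminus_0_r.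
    replace (S (k - 1)) with k by lia.
    destruct (brk_dec x (runpos x k)) as [Hbk|Hbk].
    (* The break at [runpos x k] opens a zero run that lasts for ever, so the partial sum up to it
       is already [f y]. *)
    + rewrite runs_partial_sum.
      * apply psum_eventually_lim with (1 := L); intros n Hn.
        assert (Hnb := runseq_zero x k Hx Hnz Hk).
        destruct (runpos_brk x (S k)) as [|Hend]; [tauto|].
        assert (E : x n = x (runpos x k)).
        { apply (constant_on x _ n); [|lia]; intros j Hj.
          destruct (Nat.lt_ge_cases j (runpos x (S k))); [|auto].
          apply (proj1 (proj2 (runpos_S x k))); lia. }
        rewrite E, <- runseq_brk, Hk by auto; ring.
      * intros i Hi; split; [apply Hb; simpl; lia|].
        destruct (Nat.eq_dec (S i) k) as [->|]; auto; apply Hb; simpl; lia.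
    (* Here the last run is infinite, and its contribution is obtained as a limit. *)
    + destruct k as [|k]; [lia|]; rewrite psum_S, runs_partial_sum
        by (intros; split; apply Hb; simpl; lia).
      assert (Hend : forall j, (runpos x k < j)%nat -> ~ brk x j).
      { intros j Hj; destruct (Nat.lt_ge_cases j (runpos x (S k))).
        - apply (proj1 (proj2 (runpos_S x k))); lia.
        - destruct (runpos_brk x (S k)) as [|Hend]; [tauto|]; auto. }
      assert (Hint : runint x k = IInf (runpos x k)).
      { unfold runint; destruct (excluded_middle_informative _); [tauto|auto]. }
      rewrite Hint, runseq_brk by (apply Hb; simpl; lia).
      assert (L' : is_lim_seq (psum (fun n => x n * y n))
        (psum (fun j => x j * y j) (runpos x k) + x (runpos x k) * Isum y (IInf (runpos x k)))).
      { apply is_lim_seq_ext_loc with (fun n => psum (fun j => x j * y j) (runpos x k) +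
          x (runpos x k) * (psum y n - psum y (runpos x k))).
        - exists (runpos x k); intros n Hn.
          rewrite <- (psum_mul_const x y (runpos x k) n); [ring|auto|].
          intros j Hj; apply (constant_on x _ j); [|lia]; intros i Hi; apply Hend; lia.
        - apply is_lim_seq_plus'; [apply is_lim_seq_const|].
          apply is_lim_seq_mult'; [apply is_lim_seq_const|now apply Isum_IInf]. }
      apply is_lim_seq_unique in L; apply is_lim_seq_unique in L'; rewrite L in L'.
      now injection L'.
  - apply is_series_psum.
    (* Summing run by run picks a subsequence of the coordinatewise partial sums. *)
    apply is_lim_seq_ext with (fun m => psum (fun j => x j * y j) (runpos x m)).
    + intros m; symmetry; apply runs_partial_sum; intros; split; apply Hb; exact I.
    + apply (is_lim_seq_subseq _ _ (runpos x)); auto.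
      apply eventually_subseq, runpos_increasing.
Qed.

Theorem theorem5p10 (f : seqR -> R) (Hf : in_Jdual f) :
  extreme_BJdual f <->
  exists (F : option nat) (I : nat -> interval) (alpha : nat -> R),
    interval_family F I /\
    (forall i, inF F i -> alpha i <> 0) /\
    represents f F I alpha /\
    extreme_BJ (coef_seq F alpha) /\
    union_is_interval F I.
Proof.
  split.
  - intros Hext; set (x := coefs f).
    assert (Hx : runs_extreme x) by now apply extreme_runs_extreme.
    destruct (runs_support x Hx) as [F [HF [Hnz [Hz Hk]]]].
    exists F, (runint x), (runseq x); split; [now apply runint_family|split; [auto|split]].
    + now apply runs_represents.
    + split; [|now apply runint_union].
      replace (coef_seq F (runseq x)) with (runseq x).
      * apply extreme_BJ_intro; apply (runseq_l2unit x Hx).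
      * apply functional_extensionality; intros i.
        destruct (inF_dec F i) as [Hi|Hi]; [now rewrite coef_in|].
        rewrite coef_out by auto; auto.
  - intros [F [I [alpha [HF [Hnz [Hr [He HU]]]]]]].
    now apply (represents_extreme f F I alpha).
Qed.
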